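(* Let $A\in M_d(\mathbb C)^g$ and let $e$ be a positive integer. Assume $\mathcal D_A$ is bounded and $G:\mathcal G_Q\to M_e(M(\mathbb C))$ is an $e\times e$ matrix-valued free function analytic on a free pseudoconvex set $\mathcal G_Q$ containing the free spectrahedron $\mathcal D_A$. If $G(0)=0$ and $I+G(X)+G(X)^*\succeq0$ for all $X\in\mathcal D_A$, then there exist (1) a Hilbert space $H$; (2) a formal power series $W=\sum_{\alpha}W_\alpha\alpha$ (sum over words $\alpha$ in $x$) with coefficients $W_\alpha:\mathbb C^e\to H\otimes\mathbb C^d$; (3) a unitary mapping $C:H\otimes\mathbb C^d\to H\otimes\mathbb C^d$ and an isometry $\mathscr W:\mathbb C^e\to H\otimes\mathbb C^d$, such that the identity $$I+G(x)+G(x)^*=W(x)^*L_{I_H\otimes A}(x)W(x)\qquad( * )$$ holds in the ring of $e\times e$ matrices over formal power series in $x,x^*$, and there exists a $\tau>0$ such that $( * )$ holds at each $X\in\Delta_\tau$. Moreover, letting $\mathbf A_j=I_H\otimes A_j$ and $R_j=(C-I)\mathbf A_j$ for $1\le j\le g$, the functions $G$ and $W$ are given by $$G(x)=\mathscr W^*C\Big(\sum_{j=1}^g\mathbf A_jx_j\Big)W(x),\qquad W(x)=\Big(I-\sum_{j=1}^gR_jx_j\Big)^{-1}\mathscr W,$$ and the coefficients $G_{x_j\alpha}$ of $G$ are given by $G_{x_j\alpha}=\mathscr W^*C\mathbf A_jR^\alpha\mathscr W$ for all words $\alpha$ and all $1\le j\le g$.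
   Context: For a tuple $A=(A_1,\dots,A_g)$ of operators on a Hilbert space, $L_A(x)=I+\sum_jA_jx_j+\sum_jA_j^*x_j^*$, evaluated at $X\in M_n(\mathbb C)^g$ by $L_A(X)=I+\sum_jA_j\otimes X_j+\sum_jA_j^*\otimes X_j^*$. For $A\in M_d(\mathbb C)^g$, $\mathcal D_A=(\mathcal D_A(n))_n$ with $\mathcal D_A(n)=\{X\in M_n(\mathbb C)^g:L_A(X)\succeq0\}$; it is bounded if there is $N$ with $\|X\|\le N$ for all $n$, $X\in\mathcal D_A(n)$. $I_H\otimes A=(I_H\otimes A_1,\dots,I_H\otimes A_g)$. A free pseudoconvex set is $\mathcal G_Q=\{X:\|Q(X)\|<1\}$ (over all sizes), where $Q=\sum Q_ww$ is a matrix-valued polynomial in freely noncommuting variables $x_1,\dots,x_g$ (no adjoints) and $Q(X)=\sum Q_w\otimes w(X)$. A matrix-valued free function is a sequence of functions on matrix levels respecting intertwinings (equivalently direct sums and similarities); it is analytic if analytic on each (open) level. Near $0$ a free analytic function has a power series $G=\sum_\alpha G_\alpha\alpha$, with $G_\alpha\in M_e(\mathbb C)$. A formal power series $f=\sum_\alpha f_\alpha\alpha$ is evaluated as $f(X)=\sum_{N\ge0}\sum_{|\alpha|=N}f_\alpha\otimes X^\alpha$ when this converges, where for a word $\alpha=x_{i_1}\cdots x_{i_m}$, $X^\alpha=X_{i_1}\cdots X_{i_m}$ and likewise $R^\alpha=R_{i_1}\cdots R_{i_m}$. The spectral radius of $X\in M_n(\mathbb C)^g$ is $\rho(X)=\limsup_N\max\{\|X^\alpha\|^{1/N}:|\alpha|=N\}$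 and $\Delta_\tau=\{X:\rho(X)<\tau\}$ (over all sizes). That $( * )$ holds in the ring of formal power series means: with $\mathbf A=I_H\otimes A$, for all words $\alpha,\beta$ and $1\le j,k\le g$, $W_\beta^*\mathbf A_k^*W_{x_j\alpha}+W_{x_k\beta}^*\mathbf A_jW_\alpha+W_{x_k\beta}^*W_{x_j\alpha}=0$, $W_\emptyset^*(\mathbf A_kW_\alpha+W_{x_k\alpha})=G_{x_k\alpha}$, and $W_\emptyset^*W_\emptyset=I$. *)

(* Defs.v *)
From HB Require Import structures.
From mathcomp Require Import all_boot all_order all_algebra finmap.
From mathcomp Require Import all_classical all_reals all_analysis.
From mathcomp Require Import complex mxtens.
Set Implicit Arguments.
Unset Strict Implicit.
Unset Printing Implicit Defensive.
Import Order.TTheory GRing.Theory Num.Theory.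
Import numFieldNormedType.Exports.
Local Open Scope classical_set_scope.
Local Open Scope ring_scope.
Local Open Scope sesquilinear_scope.

(* Naming the numClosedFieldType (rather than writing R[i]) is what lets
   inference find the topology and the norm of the complex field. *)
Definition Cplx (R : realType) : numClosedFieldType := R[i].

Section Matrices.
Variable R : realType.
Local Notation C := (Cplx R).

Definition cabs (z : C) : R := complex.Re `|z|.

Definition l2norm n (v : 'cV[C]_n) : R := Num.sqrt (\sum_i cabs (v i 0) ^+ 2).

Definition opnorm m n (M : 'M[C]_(m, n)) : R :=
  sup [set l2norm (M *m v) | v in [set v : 'cV[C]_n | l2norm v <= 1]].

(* In C, 0 <= z means that z is real and nonnegative; hence a psd matrix is
   automatically Hermitian. *)
Definition psd n (M : 'M[C]_n) : Prop :=
  forall v : 'cV[C]_n, 0 <= (v^t* *m M *m v) 0 0.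

Variable g : nat.

Definition word := seq 'I_g.

Definition wordmx n (X : 'I_g -> 'M[C]_n) (a : word) : 'M[C]_n :=
  \big[mulmx/1%:M]_(j <- a) X j.

Definition spectral_radius n (X : 'I_g -> 'M[C]_n) : \bar R :=
  limn_esup (fun N : nat =>
    (\big[Num.max/0]_(a : N.-tuple 'I_g)
        opnorm (wordmx X a) `^ (N%:R^-1))%:E).

Definition Delta (tau : R) n (X : 'I_g -> 'M[C]_n) : Prop :=
  (spectral_radius X < tau%:E)%E.

Definition pencil d (A : 'I_g -> 'M[C]_d) n (X : 'I_g -> 'M[C]_n)
    : 'M[C]_(d * n) :=
  1%:M + \sum_j tensmx (A j) (X j) + \sum_j tensmx ((A j)^t* ) ((X j)^t* ).

Definition spectrahedron d (A : 'I_g -> 'M[C]_d) n (X : 'I_g -> 'M[C]_n)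
    : Prop := psd (pencil A X).

(* Bounding every X_j is, uniformly in n, the same as bounding any of the usual
   norms (row, column, maximum) of the tuple X. *)
Definition free_bounded (D : forall n, ('I_g -> 'M[C]_n) -> Prop) : Prop :=
  exists N : R, forall n (X : 'I_g -> 'M[C]_n), D n X ->
    forall j, opnorm (X j) <= N.

Definition ncpoly r s := {fsfun word -> 'M[C]_(r, s) with 0}.

Definition ncpoly_eval r s (Q : ncpoly r s) n (X : 'I_g -> 'M[C]_n)
    : 'M[C]_(r * n, s * n) :=
  \sum_(w <- finsupp Q) tensmx (Q w) (wordmx X w).

Definition pseudoconvex r s (Q : ncpoly r s) n (X : 'I_g -> 'M[C]_n) : Prop :=
  opnorm (ncpoly_eval Q X) < 1.

(* Values outside the domain D are arbitrary; every property of G below is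
   relative to D. *)
Definition graded_fun e := forall n, ('I_g -> 'M[C]_n) -> 'M[C]_(e * n).

Definition free_function e (D : forall n, ('I_g -> 'M[C]_n) -> Prop)
    (G : graded_fun e) : Prop :=
  forall n m (X : 'I_g -> 'M[C]_n) (Y : 'I_g -> 'M[C]_m) (T : 'M[C]_(n, m)),
    D n X -> D m Y -> (forall j, X j *m T = T *m Y j) ->
    G n X *m tensmx (1%:M : 'M[C]_e) T = tensmx (1%:M : 'M[C]_e) T *m G m Y.

(* The homogeneous part of degree k, at h, of the power series
   sum_mu c_mu h^mu in the commuting coordinates h_i, mu ranging over the
   multi-indices. *)
Definition mpow_part (I : finType) p q (c : {ffun I -> nat} -> 'M[C]_(p, q))
    (h : I -> C) (k : nat) : 'M[C]_(p, q) :=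
  \sum_(mu : {ffun I -> 'I_k.+1} | (\sum_i mu i)%N == k)
     (\prod_i h i ^+ mu i) *: c [ffun i => mu i : nat].

(* Near z, F is the sum of an absolutely convergent power series. *)
Definition analytic_at (I : finType) p q (F : (I -> C) -> 'M[C]_(p, q))
    (z : I -> C) : Prop :=
  exists (c : {ffun I -> nat} -> 'M[C]_(p, q)) (r : R), 0 < r /\
    forall h : I -> C, (forall i, cabs (h i) < r) ->
      (\esum_(mu in [set: {ffun I -> nat}])
          (opnorm (c mu) * \prod_i cabs (h i) ^+ mu i)%:E < +oo)%E /\
      series (mpow_part c h) @ \oo --> F (fun i => z i + h i).

(* The coordinates on M_n(C)^g are the entries of the g matrices. *)
Definition free_analytic e (D : forall n, ('I_g -> 'M[C]_n) -> Prop)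
    (G : graded_fun e) : Prop :=
  forall n (X : 'I_g -> 'M[C]_n), D n X ->
    analytic_at
      (fun z : 'I_g * 'I_n * 'I_n -> C =>
         G n (fun j => \matrix_(a, b) z (j, a, b)))
      (fun t => X t.1.1 t.1.2 t.2).

Definition mxfps_part e (f : word -> 'M[C]_e) n (X : 'I_g -> 'M[C]_n) (N : nat)
    : 'M[C]_(e * n) :=
  \sum_(a : N.-tuple 'I_g) tensmx (f a) (wordmx X a).

(* The radius r is uniform over the levels n. *)
Definition power_series_near0 e (G : graded_fun e) (f : word -> 'M[C]_e)
    : Prop :=
  exists2 r : R, 0 < r &
    forall n (X : 'I_g -> 'M[C]_n), (forall j, opnorm (X j) < r) ->
      series (mxfps_part f X) @ \oo --> G n X.

End Matrices.

(* The inner product is linear in its first argument. *)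
Record hilbertType (R : realType) := HilbertType {
  hspace :> completeNormedModType (Cplx R);
  hdot : {dot hspace for @Num.conj (Cplx R)};
  hdot_norm : forall x : hspace, hdot x x = `|x| ^+ 2 }.

Section Operators.
Variable R : realType.
Local Notation C := (Cplx R).

(* U (x) C^n is represented by {ffun 'I_n -> U}: the function u stands for
   sum_k u_k (x) e_k. *)
Definition tens (U : lmodType C) (n : nat) : lmodType C := {ffun 'I_n -> U}.

Definition tensdot (U : lmodType C) (dot : U -> U -> C) n (x y : tens U n) : C :=
  \sum_i dot (x i) (y i).

(* T (x) M *)
Definition tensop (U V : lmodType C) (T : U -> V) m n (M : 'M[C]_(m, n))
    (u : tens U n) : tens V m :=
  [ffun i => \sum_k M i k *: T (u k)].

(* The identification of C^e (x) C^n with column vectors that is used by the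
   Kronecker product tensmx. *)
Definition untens e n (u : 'cV[C]_(e * n)) : tens 'cV[C]_e n :=
  [ffun k => \col_i u (mxtens_index (i, k)) 0].

(* The adjoint of a linear T : C^m -> V; see adjcP. *)
Definition adjc (V : lmodType C) (dot : V -> V -> C) m (T : 'cV[C]_m -> V)
    (y : V) : 'cV[C]_m :=
  \col_i dot y (T (delta_mx i 0)).

Definition cdot m (u v : 'cV[C]_m) : C := (v^t* *m u) 0 0.

Definition adjoint_op (U V : lmodType C) (dotU : U -> U -> C)
    (dotV : V -> V -> C) (T : U -> V) (S : V -> U) : Prop :=
  forall u v, dotV (T u) v = dotU u (S v).

Definition isometry_op (U V : lmodType C) (dotU : U -> U -> C)
    (dotV : V -> V -> C) (T : U -> V) : Prop :=
  forall u v, dotV (T u) (T v) = dotU u v.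

Definition unitary_op (U : lmodType C) (dot : U -> U -> C) (T : {linear U -> U})
    : Prop :=
  exists S : {linear U -> U},
    [/\ adjoint_op dot dot T S, cancel T S & cancel S T].

Variable g : nat.
Local Notation word := (word g).

Definition opword (U : Type) (T : 'I_g -> U -> U) (a : word) (u : U) : U :=
  foldr T u a.

(* Formal power series in x whose coefficients are maps U -> V. *)
Definition fps (U V : lmodType C) := word -> U -> V.

Definition fps_mul (U V W : lmodType C) (f : fps V W) (h : fps U V) : fps U W :=
  fun a u => \sum_(i < (size a).+1) f (take i a) (h (drop i a) u).

Definition fps_const (U V : lmodType C) (T : U -> V) : fps U V :=
  fun a u => if a is [::] then T u else 0.

(* sum_j T_j x_j *)
Definition fps_lin (U V : lmodType C) (T : 'I_g -> U -> V) : fps U V :=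
  fun a u => if a is [:: j] then T j u else 0.

Definition fps_sub (U V : lmodType C) (f h : fps U V) : fps U V :=
  fun a u => f a u - h a u.

Definition fps_inverse (U : lmodType C) (f h : fps U U) : Prop :=
  fps_mul f h = fps_const id /\ fps_mul h f = fps_const id.

Definition fps_part (K : lmodType C) e (W : word -> 'cV[C]_e -> K)
    n (X : 'I_g -> 'M[C]_n) (u : 'cV[C]_(e * n)) (N : nat) : tens K n :=
  \sum_(a : N.-tuple 'I_g) tensop (W a) (wordmx X a) (untens u).

Definition ampl (H : lmodType C) d (A : 'I_g -> 'M[C]_d) (j : 'I_g)
    : tens H d -> tens H d :=
  tensop id (A j).

(* sum_j T_j (x) X_j *)
Definition linsum (U : lmodType C) (T : 'I_g -> U -> U) n
    (X : 'I_g -> 'M[C]_n) (u : tens U n) : tens U n :=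
  \sum_j tensop (T j) (X j) u.

Definition pencil_op (H : lmodType C) d (A : 'I_g -> 'M[C]_d)
    n (X : 'I_g -> 'M[C]_n) (u : tens (tens H d) n) : tens (tens H d) n :=
  u + linsum (ampl (H := H) A) X u
    + linsum (ampl (H := H) (fun j => (A j)^t* )) (fun j => (X j)^t* ) u.

(* The operators W_a have finite-dimensional domain, so that norm convergence
   of the series is the same as convergence of each H-coordinate at each u. *)
Definition fps_cvg (H : hilbertType R) d e (W : word -> 'cV[C]_e -> tens H d)
    n (X : 'I_g -> 'M[C]_n) (WX : 'cV[C]_(e * n) -> tens (tens H d) n) : Prop :=
  forall u (k : 'I_n) (l : 'I_d),
    series (fun N => fps_part W X u N k l) @ \oo --> (WX u k l : H).

(* I + G + G^* = W^* L_{I (x) A} W in the ring of formal power series in x and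
   x^*, by comparing the coefficients of the words b^* x_k^* x_j a, of x_k a
   and of the empty word; the remaining coefficients are adjoints of these. *)
Definition formal_identity (H : hilbertType R) d e (A : 'I_g -> 'M[C]_d)
    (G : word -> 'M[C]_e) (W : word -> 'cV[C]_e -> tens H d) : Prop :=
  let adj := adjc (tensdot (@hdot R H) (n := d)) (m := e) in
  let bA := ampl (H := H) A in
  let bAs := ampl (H := H) (fun j => (A j)^t* ) in
  [/\ forall (a b : word) (j k : 'I_g) (v : 'cV[C]_e),
        adj (W b) (bAs k (W (j :: a) v)) + adj (W (k :: b)) (bA j (W a v))
        + adj (W (k :: b)) (W (j :: a) v) = 0,
      forall (k : 'I_g) (a : word) (v : 'cV[C]_e),
        adj (W [::]) (bA k (W a v) + W (k :: a) v) = G (k :: a) *m v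
    & forall v : 'cV[C]_e, adj (W [::]) (W [::] v) = v].

Lemma adjcP (V : lmodType C) (dot : V -> V -> C)
    (dot_linear : forall a x y z, dot (a *: x + y) z = a * dot x z + dot y z)
    (dot_herm : forall x y, dot x y = (dot y x)^*) m
    (T : {linear 'cV[C]_m -> V}) :
  adjoint_op (@cdot m) dot T (adjc dot T).
Proof.
move=> u y; rewrite /cdot mxE.
have dot0 z : dot 0 z = 0.
  have := dot_linear 0 0 0 z; rewrite scale0r addr0 mul0r add0r => E.
  have := dot_linear 1 0 0 z; rewrite scale1r addr0 mul1r => /eqP.
  by rewrite -subr_eq0 opprD addrA subrr add0r oppr_eq0 => /eqP.
have {1}-> : u = \sum_i u i 0 *: delta_mx i 0.
  apply/colP => i; rewrite summxE (bigD1 i) //= big1 => [|k ki].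
    by rewrite !mxE !eqxx mulr1 addr0.
  by rewrite !mxE eq_sym (negPf ki) mulr0.
rewrite linear_sum; apply: (big_rec2 (fun x c => dot x y = c)) => [//|i c x _ <-].
by rewrite linearZ dot_linear !mxE mulrC -dot_herm.
Qed.

Lemma tensdot_linear (V : lmodType C) (dot : V -> V -> C)
    (dot_linear : forall a x y z, dot (a *: x + y) z = a * dot x z + dot y z)
    n a (x y z : tens V n) :
  tensdot dot (a *: x + y) z = a * tensdot dot x z + tensdot dot y z.
Proof.
rewrite /tensdot mulr_sumr -big_split /=; apply: eq_bigr => i _.
by rewrite !ffunE dot_linear.
Qed.

Lemma tensdot_herm (V : lmodType C) (dot : V -> V -> C)
    (dot_herm : forall x y, dot x y = (dot y x)^*) n (x y : tens V n) :
  tensdot dot x y = (tensdot dot y x)^*.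
Proof. by rewrite /tensdot rmorph_sum; apply: eq_bigr => i _. Qed.

End Operators.

(* Main.v *)
Require Import Defs.
From HB Require Import structures.
From mathcomp Require Import all_boot all_order all_algebra finmap.
From mathcomp Require Import all_classical all_reals all_analysis.
From mathcomp Require Import complex mxtens ring.
Set Implicit Arguments.
Unset Strict Implicit.
Unset Printing Implicit Defensive.
Import Order.TTheory GRing.Theory Num.Theory.
Import numFieldNormedType.Exports.
Local Open Scope classical_set_scope.
Local Open Scope ring_scope.
Local Open Scope sesquilinear_scope.

(** The function G is reconstructed from its values at nilpotent points of the
    free spectrahedron D_A.

    Coefficients. Let F_j prepend the letter j to the words of length at
    most N. A small multiple r F lies in D_A, and the column of G(r F) at
    the empty word lists matrices which are taken to be the coefficients of
    G. If Z is in D_A and every word of length N+1 in Z kills v, then a |->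
    r^-|a| Z^a v intertwines r F with Z, so that G(Z) acts on v through
    these coefficients ([free_nilpotent]). For small X, let J be a
    Jordan-like matrix of norm less than 3 that is nilpotent apart from one
    eigenvector of eigenvalue 1. The point J (x) X of D_A restricts to X on
    that eigenvector and is nilpotent elsewhere, and the part of G(X) beyond
    degree k is 2^-k times an off-diagonal entry of the positive matrix I +
    G + G^* there. This makes the power series of G converge near 0
    ([power_series_coef]).

    Realization up to degree N. Between words of length at most N, the
    equation I + G + G^* = W^* L_A W is linear in the Gram kernel of the
    coefficients of W. If no positive semidefinite kernel solves it, there
    is a Hermitian form M on the C^e-valued polynomials of degree at most N
    that is nonnegative on all W^* L_A W and negative on I + G + G^*
    ([kpsd_duality]). Since D_A is bounded, some density matrix P satisfies
    tr(P A_j) = 0 for all j, and evaluating M on kernels made from P shows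
    that M is positive semidefinite. After a small perturbation M = B^* B
    with B invertible, and the property of M says that Y_j = B F_j B^-1 is a
    nilpotent point of D_A. Positivity of I + G(Y) + G(Y)^* on the vectors B
    u, with u in the copy of C^e at the empty word, contradicts the choice
    of M ([gram_kernel_exists]). For a solution W, the vectors A_j W_y and
    W_x + A_j W_y, for x = x_j y, have the same Gram matrix, so a unitary C
    maps the former to the latter and W_x = (C - I) A_j W_y
    ([truncated_realization]).

    Passage to the limit. The unitaries for N = 0, 1, 2, ... act together on
    the ultraproduct of their spaces, where inner products are limits along an
    ultrafilter; there C and the isometry V realize every coefficient of G
    ([realization_exists]).

    The identity. With W_a = R^a V, the relation W_x + A_j W_y = C A_j W_y and
    the unitarity of C give the identity word by word
    ([formal_identity_realization]). On Delta_tau with tau small the Neumann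
    series of sum_j R_j (x) X_j converges geometrically along every vector, and
    the same computation applies to its sum ([realization_converges]). *)

(** * Positive semidefinite forms *)

Section PreInnerProduct.
Variables (R : realType) (U : lmodType (Cplx R)).
Local Notation C := (Cplx R).

(** A possibly degenerate inner product. The degenerate ones are the forms of
    positive semidefinite kernels and the limits of inner products along an
    ultrafilter. *)
Record predot (dot : U -> U -> C) : Prop := Predot {
  predot_linear : forall a x y z, dot (a *: x + y) z = a * dot x z + dot y z;
  predot_herm : forall x y, dot x y = (dot y x)^*;
  predot_ge0 : forall x, 0 <= dot x x }.

Variables (dot : U -> U -> C) (dotP : predot dot).

Lemma predotDl x y z : dot (x + y) z = dot x z + dot y z.
Proof. by have := predot_linear dotP 1 x y z; rewrite scale1r mul1r. Qed.

Lemma predot0l z : dot 0 z = 0.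
Proof. by apply: (addrI (dot 0 z)); rewrite -predotDl !addr0. Qed.

Lemma predotZl a x z : dot (a *: x) z = a * dot x z.
Proof. by have := predot_linear dotP a x 0 z; rewrite predot0l !addr0. Qed.

Lemma predotNl x z : dot (- x) z = - dot x z.
Proof. by rewrite -scaleN1r predotZl mulN1r. Qed.

Lemma predotDr x y z : dot z (x + y) = dot z x + dot z y.
Proof. by rewrite (predot_herm dotP) predotDl rmorphD /= -!(predot_herm dotP). Qed.

Lemma predotZr a x z : dot z (a *: x) = a^* * dot z x.
Proof. by rewrite (predot_herm dotP) predotZl rmorphM /= -!(predot_herm dotP). Qed.

Lemma predot0r z : dot z 0 = 0.
Proof. by rewrite (predot_herm dotP) predot0l rmorph0. Qed.

Lemma predotNr x z : dot z (- x) = - dot z x.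
Proof. by rewrite (predot_herm dotP) predotNl rmorphN /= -!(predot_herm dotP). Qed.

Lemma predotBl x y z : dot (x - y) z = dot x z - dot y z.
Proof. by rewrite predotDl predotNl. Qed.

Lemma predotBr x y z : dot z (x - y) = dot z x - dot z y.
Proof. by rewrite predotDr predotNr. Qed.

Lemma predot_suml I (r : seq I) (P : pred I) (F : I -> U) z :
  dot (\sum_(i <- r | P i) F i) z = \sum_(i <- r | P i) dot (F i) z.
Proof.
by apply: (big_morph (dot^~ z)) => [x y|]; rewrite ?predotDl ?predot0l.
Qed.

Lemma predot_sumr I (r : seq I) (P : pred I) (F : I -> U) z :
  dot z (\sum_(i <- r | P i) F i) = \sum_(i <- r | P i) dot z (F i).
Proof.
by apply: (big_morph (dot z)) => [x y|]; rewrite ?predotDr ?predot0r.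
Qed.

Lemma predotD x y :
  dot (x + y) (x + y) = dot x x + dot y y + (dot x y + (dot x y)^*).
Proof.
by rewrite predotDl !predotDr -(predot_herm dotP y x) addrACA addrAC addrA
           [dot x x + _ + _]addrAC -!addrA [dot y x + _]addrC.
Qed.

Theorem predot_CauchySchwarz x y : `|dot x y| ^+ 2 <= dot x x * dot y y.
Proof.
have [y0|yn0] := eqVneq (dot y y) 0.
  rewrite y0 mulr0; set z := dot x y.
  suff: `|z| ^+ 2 = 0 by move=> ->.
  apply/eqP; apply: contraT => zn0.
  have zp : 0 < `|z| ^+ 2 by rewrite lt_def zn0 exprn_ge0.
  (* As y is a null vector, adding t z y to x changes the value of the form by
     2 t |z|^2; this t makes it equal to - dot x x - 2. *)
  pose t := - (dot x x + 1) / `|z| ^+ 2.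
  have xp := predot_ge0 dotP x.
  have tr : t^* = t.
    apply/CrealP; apply: realM; last by rewrite realV ger0_real // ltW.
    by rewrite realN; apply: realD; rewrite ?real1 // ger0_real.
  have := predot_ge0 dotP (x + (t * z) *: y).
  rewrite predotD predotZr predotZl predotZr y0 !mulr0 addr0 -/z.
  rewrite rmorphM /= tr -mulrA -normCKC (rmorphM _ t) /= tr.
  rewrite (geC0_conj (ltW zp)) -mulr2n /t mulrVK ?unitfE //.
  move=> h; suff: (0 : C) < 0 by rewrite ltxx.
  apply: le_lt_trans h _.
  have -> : dot x x + - (dot x x + 1) *+ 2 = - (dot x x + (1 + 1)) by ring.
  by rewrite oppr_lt0 ltr_wpDl // addr_gt0 ?ltr01.
have yp : 0 < dot y y by rewrite lt_def yn0 predot_ge0.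
pose a := dot x y / dot y y.
have := predot_ge0 dotP (x - a *: y).
rewrite predotBl !predotBr !predotZl !predotZr.
have -> : a * (a^* * dot y y) = a^* * dot x y.
  by rewrite mulrCA /a mulrVK ?unitfE.
rewrite opprB addrA subrK (predot_herm dotP y x).
by rewrite /a mulrAC -normCK subr_ge0 ler_pdivrMr.
Qed.

Definition pnorm x : C := sqrtC (dot x x).

Lemma pnorm_ge0 x : 0 <= pnorm x.
Proof. by rewrite sqrtC_ge0 predot_ge0. Qed.

Lemma pnormK x : pnorm x ^+ 2 = dot x x. Proof. exact: sqrtCK. Qed.

Lemma predot_le x y : `|dot x y| <= pnorm x * pnorm y.
Proof.
rewrite -(ler_pXn2r (ltn0Sn 1)) ?nnegrE ?mulr_ge0 ?pnorm_ge0 ?normr_ge0 //.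
by rewrite exprMn !pnormK predot_CauchySchwarz.
Qed.

Lemma pnormZ a x : pnorm (a *: x) = `|a| * pnorm x.
Proof.
rewrite /pnorm predotZl predotZr mulrA -normCK rootCMl ?exprn_ge0 //.
by rewrite sqrCK ?normr_ge0.
Qed.

Lemma pnormN x : pnorm (- x) = pnorm x.
Proof. by rewrite -scaleN1r pnormZ normrN1 mul1r. Qed.

Lemma pnorm0 : pnorm 0 = 0. Proof. by rewrite /pnorm predot0l sqrtC0. Qed.

Lemma ler_pnormD x y : pnorm (x + y) <= pnorm x + pnorm y.
Proof.
rewrite -(ler_pXn2r (ltn0Sn 1)) ?nnegrE ?addr_ge0 ?pnorm_ge0 //.
rewrite sqrrD !pnormK predotD [leRHS]addrAC lerD2l.
have h : `|dot x y + (dot x y)^*| <= (pnorm x * pnorm y) *+ 2.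
  apply: le_trans (ler_normD _ _) _.
  by rewrite norm_conjC -mulr2n lerMn2r predot_le orbT.
apply: le_trans h; apply: real_ler_norm.
by rewrite CrealE rmorphD /= conjCK addrC.
Qed.

Lemma pnorm_distC x y : pnorm (x - y) = pnorm (y - x).
Proof. by rewrite -pnormN opprB. Qed.

Lemma ler_pnorm_sum I (r : seq I) (P : pred I) (F : I -> U) :
  pnorm (\sum_(i <- r | P i) F i) <= \sum_(i <- r | P i) pnorm (F i).
Proof.
elim/big_rec2: _ => [|i x y _ h]; first by rewrite pnorm0.
by apply: le_trans (ler_pnormD _ _) _; rewrite lerD2l.
Qed.

End PreInnerProduct.

(** * Limits along an ultrafilter and along the integers *)

Section UltraLimit.
Variable R : realType.
Local Notation C := (Cplx R).

(** An ultrafilter that contains all the sets of large integers, chosen once and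
    for all: along it, every bounded sequence converges. *)
Definition freeU : set_system nat :=
  projT1 (cid (ultraFilterLemma eventually_filter)).

#[global] Instance freeU_ultra : UltraFilter freeU.
Proof. by rewrite /freeU; case: cid => F []. Qed.

#[global] Instance freeU_proper : ProperFilter freeU.
Proof. exact: ultra_proper. Qed.

Lemma freeU_near A : (\oo : set_system nat) A -> freeU A.
Proof. by rewrite /freeU; case: cid => F [_ s] /= /s. Qed.

Lemma freeU_ge n : freeU [set k | (n <= k)%N].
Proof. by apply: freeU_near; exists n. Qed.

(** By compactness the image of the ultrafilter has a cluster point, and an
    ultrafilter converges to each of its cluster points. *)
Lemma real_ultra_cvg (x : nat -> R) (B : R) :
  (forall n, `|x n| <= B) -> exists l : R, x @ freeU --> l.
Proof.
move=> xB.
have [p [_ pc]] : `[-B, B] `&` cluster (x @ freeU) !=set0.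
  apply: (@segment_compact R (-B) B).
  suff : freeU (x @^-1` `[-B, B]) by [].
  by apply: filterS filterT => n _ /=; rewrite in_itv /= -ler_norml.
exists p => A /= nA.
have [//|nAC] := in_ultra_setVsetC (x @^-1` A) freeU_ultra.
have [y [ny Ay]] := pc (~` A) A nAC nA.
by have := ny Ay.
Qed.

Lemma real_complex_cvg (F : set_system nat) (FF : Filter F) (x : nat -> R) (l : R) :
  x @ F --> l -> (fun n => (x n)%:C%C : C) @ F --> (l%:C%C : C).
Proof.
move=> xl; apply/cvgrPdist_lt => e e0.
have er : (complex.Re e)%:C%C = e by rewrite RRe_real // gtr0_real.
have e0' : 0 < complex.Re e by move: e0; rewrite -er ltcR.
move/cvgrPdist_lt: xl => /(_ _ e0'); apply: filterS => n h.
rewrite -rmorphB normc_def /= expr0n addr0 sqrtr_sqr.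
by rewrite -[e in ltRHS]er ltcR.
Qed.

Lemma ultra_cvg (x : nat -> C) (B : C) :
  (forall n, `|x n| <= B) -> exists l : C, x @ freeU --> l.
Proof.
move=> xB.
have Br : (complex.Re B)%:C%C = B.
  by rewrite RRe_real // ger0_real // (le_trans _ (xB 0%N)).
have h1 n : `|complex.Re (x n)| <= complex.Re B.
  by rewrite -lecR Br (le_trans _ (xB n)) // normc_ge_Re.
have h2 n : `|complex.Im (x n)| <= complex.Re B.
  rewrite -lecR Br (le_trans _ (xB n)) // normc_def lecR.
  by rewrite -sqrtr_sqr ler_wsqrtr // lerDr sqr_ge0.
have [l1 xl1] := real_ultra_cvg h1; have [l2 xl2] := real_ultra_cvg h2.
exists (l1%:C%C + 'i%C * l2%:C%C : C).
have -> : x = (fun n => (complex.Re (x n))%:C%C + 'i%C * (complex.Im (x n))%:C%C).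
  by apply/funext => n; rewrite -complexE.
apply: cvgD; first exact: real_complex_cvg.
apply: cvgM; first exact: cvg_cst.
exact: real_complex_cvg.
Qed.

Definition ubounded (x : nat -> C) := exists B, forall n, `|x n| <= B.

Definition ulim (x : nat -> C) : C := lim (x @ freeU).

Lemma ulim_cvg (x : nat -> C) : ubounded x -> x @ freeU --> ulim x.
Proof. by case=> B /ultra_cvg[l xl]; rewrite /ulim (cvg_lim _ xl). Qed.

Lemma ulimE (x : nat -> C) (l : C) : x @ freeU --> l -> ulim x = l.
Proof. by move=> xl; apply: cvg_lim. Qed.

Lemma ulim_cst (l : C) : ulim (fun=> l) = l.
Proof. by apply: ulimE; apply: cvg_cst. Qed.

Lemma ulim_eq x y : freeU [set n | x n = y n] -> ulim x = ulim y.
Proof.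
move=> h; rewrite /ulim; congr lim.
rewrite eqEsubset; split=> A /= nA.
  by apply: filterS2 h nA => n /= ->.
by apply: filterS2 h nA => n /= ->.
Qed.

Lemma conjC_cvg (F : set_system nat) (FF : Filter F) (x : nat -> C) (l : C) :
  x @ F --> l -> (fun n => (x n)^*) @ F --> l^*.
Proof.
move=> xl; apply/cvgrPdist_lt => e e0.
move/cvgrPdist_lt: xl => /(_ _ e0); apply: filterS => n h.
by rewrite -rmorphB norm_conjC.
Qed.

Lemma uboundedD x y : ubounded x -> ubounded y -> ubounded (fun n => x n + y n).
Proof.
move=> [B xB] [D yD]; exists (B + D) => n.
by apply: le_trans (ler_normD _ _) _; rewrite lerD.
Qed.

Lemma uboundedM x y : ubounded x -> ubounded y -> ubounded (fun n => x n * y n).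
Proof.
move=> [B xB] [D yD]; exists (B * D) => n.
by rewrite normrM ler_pM.
Qed.

Lemma ubounded_cst (l : C) : ubounded (fun=> l).
Proof. by exists `|l|. Qed.

Lemma ubounded_sum I (r : seq I) (F : I -> nat -> C) :
  (forall i, ubounded (F i)) -> ubounded (fun n => \sum_(i <- r) F i n).
Proof.
move=> h; elim: r => [|i r IH].
  by under eq_fun do rewrite big_nil; exact: ubounded_cst.
by under eq_fun do rewrite big_cons; exact: uboundedD.
Qed.

Lemma ulimD x y : ubounded x -> ubounded y ->
  ulim (fun n => x n + y n) = ulim x + ulim y.
Proof. by move=> xb yb; apply: ulimE; apply: cvgD; apply: ulim_cvg. Qed.

Lemma ulimM x y : ubounded x -> ubounded y ->
  ulim (fun n => x n * y n) = ulim x * ulim y.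
Proof. by move=> xb yb; apply: ulimE; apply: cvgM; apply: ulim_cvg. Qed.

Lemma ulimZ a x : ubounded x -> ulim (fun n => a * x n) = a * ulim x.
Proof. by move=> xb; rewrite ulimM ?ulim_cst //; exact: ubounded_cst. Qed.

Lemma ulim_conj x : ubounded x -> ulim (fun n => (x n)^*) = (ulim x)^*.
Proof. by move=> xb; apply: ulimE; apply: conjC_cvg; apply: ulim_cvg. Qed.

Lemma ulim_sum I (r : seq I) (F : I -> nat -> C) :
  (forall i, ubounded (F i)) ->
  ulim (fun n => \sum_(i <- r) F i n) = \sum_(i <- r) ulim (F i).
Proof.
move=> h; elim: r => [|i r IH].
  by under eq_fun do rewrite big_nil; rewrite big_nil ulim_cst.
under eq_fun do rewrite big_cons.
by rewrite big_cons ulimD ?IH //; exact: ubounded_sum.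
Qed.

Lemma ulim_norm x : ubounded x -> ulim (fun n => `|x n|) = `|ulim x|.
Proof. by move=> xb; apply: ulimE; apply: cvg_norm; apply: ulim_cvg. Qed.

Lemma ulim_ge0 x : ubounded x -> freeU [set n | 0 <= x n] -> 0 <= ulim x.
Proof.
move=> xb x0; rewrite -(@ulim_eq (fun n => `|x n|)) ?ulim_norm //.
by apply: filterS x0 => n /= /ger0_norm.
Qed.

Lemma ler_ulim x y : ubounded x -> ubounded y ->
  freeU [set n | x n <= y n] -> ulim x <= ulim y.
Proof.
move=> xb yb h; rewrite -subr_ge0.
have nb : ubounded (fun n => - 1 * x n) by apply: uboundedM => //; exact: ubounded_cst.
rewrite -[- ulim x]mulN1r -ulimZ // -ulimD //; apply: ulim_ge0.
  exact: uboundedD.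
by apply: filterS h => n /=; rewrite mulN1r subr_ge0.
Qed.

End UltraLimit.

Section SequentialLimit.
Variable R : realType.
Local Notation C := (Cplx R).

Lemma pow2_small (b eps : C) : 0 <= b -> 0 < eps ->
  exists k, forall k', (k <= k')%N -> (2 ^+ k')^-1 * b < eps.
Proof.
move=> b0 eps0.
have bR : (complex.Re b)%:C%C = b by rewrite RRe_real // ger0_real.
have eR : (complex.Re eps)%:C%C = eps by rewrite RRe_real // gtr0_real.
have er0 : 0 < complex.Re eps by move: eps0; rewrite -{1}eR ltcR.
exists (Num.trunc (complex.Re b / complex.Re eps)).+1 => k kk.
rewrite mulrC ltr_pdivrMr ?exprn_gt0 //.
have : complex.Re b / complex.Re eps < 2 ^+ k.
  apply: lt_le_trans (truncnS_gt _) _; rewrite -natrX ler_nat.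
  by apply: leq_trans kk _; apply: ltnW; rewrite ltn_expl.
rewrite ltr_pdivrMr // mulrC -ltcR bR rmorphM /= eR rmorphXn /= rmorph_nat.
by [].
Qed.

Lemma geometric_cvg (u : nat -> C) (l b : C) :
  (forall k, `|l - u k.+1| <= (2 ^+ k.+1)^-1 * b) -> u @ \oo --> l.
Proof.
move=> h; rewrite -(@cvg_shiftS _ u); apply/cvgrPdist_lt => eps eps0.
have b0 : 0 <= b.
  have := le_trans (normr_ge0 _) (h 0%N).
  by rewrite pmulr_rge0 // invr_gt0 exprn_gt0.
have [k kP] := pow2_small b0 eps0; exists k => // k' kk'.
by apply: le_lt_trans (h k') _; apply: kP; exact: leqW.
Qed.

Lemma mx_cvg m n (u : nat -> 'M[C]_(m, n)) (M : 'M[C]_(m, n)) :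
  (forall p q, (fun k => u k p q) @ \oo --> M p q) -> u @ \oo --> M.
Proof.
move=> h; apply/cvg_ballP => eps eps0.
have h' p q : \forall k \near \oo, ball (M p q) eps (u k p q).
  by move/cvg_ballP: (h p q); apply.
have : \forall k \near \oo, forall p q, ball (M p q) eps (u k p q).
  by apply: filter_forall => p; apply: filter_forall => q; exact: h'.
by apply: filterS => k hk.
Qed.

End SequentialLimit.

(** * Positive semidefinite kernels *)

Section SesquiGe0.
Variables (R : realType) (U : lmodType (Cplx R)).
Local Notation C := (Cplx R).
Variable (f : U -> U -> C).
Hypothesis fl : forall a x y z, f (a *: x + y) z = a * f x z + f y z.
Hypothesis fr : forall a x y z, f z (a *: x + y) = a^* * f z x + f z y.
Hypothesis f0 : forall x, 0 <= f x x.

(** Polarization: a sesquilinear form whose diagonal is real is Hermitian. *)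
Lemma predot_of_ge0 : predot f.
Proof.
split=> // x y.
have fD a : f (a *: x + y) (a *: x + y) =
    f y y + (a * a^* * f x x + (a * f x y + a^* * f y x)).
  by rewrite fl !fr; ring.
have h a : a * f x y + a^* * f y x \is Num.real.
  have -> : a * f x y + a^* * f y x =
      f (a *: x + y) (a *: x + y) - f y y - a * a^* * f x x by rewrite fD; ring.
  apply: realB; last by rewrite -normCK realM ?ger0_real ?exprn_ge0.
  by apply: realB; exact: ger0_real.
have := h 1; have := h 'i; rewrite !CrealE.
rewrite !rmorphD !rmorphM /= !conjCK !conjCi !conjC1 !mul1r => /eqP h1 /eqP h2.
rewrite !mulNr in h1.
have {}h1 : - (f x y)^* + (f y x)^* = f x y - f y x.
  by apply: (mulfI (neq0Ci C)); rewrite mulrDr mulrN h1; ring.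
have : (f y x)^* *+ 2 = f x y *+ 2.
  have -> : (f y x)^* *+ 2 = (- (f x y)^* + (f y x)^*) + ((f x y)^* + (f y x)^*).
    by ring.
  by rewrite h1 h2; ring.
by move/eqP; rewrite eqrMn2r // => /eqP <-.
Qed.

End SesquiGe0.

Section Kernels.
Variable R : realType.
Local Notation C := (Cplx R).

Definition kform (I : finType) (K : I -> I -> C) (u v : I -> C) : C :=
  \sum_x \sum_y (v x)^* * K x y * u y.

Definition kpsd (I : finType) (K : I -> I -> C) : Prop :=
  forall v, 0 <= kform K v v.

Lemma kform_predot (I : finType) (K : I -> I -> C) : kpsd K -> predot (kform K).
Proof.
move=> K0; apply: predot_of_ge0 => [a x y z|a x y z|]; last exact: K0.
  rewrite /kform mulr_sumr -big_split; apply: eq_bigr => i _ /=.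
  rewrite mulr_sumr -big_split; apply: eq_bigr => j _ /=.
  by rewrite !fctE /= /GRing.scale /=; ring.
rewrite /kform mulr_sumr -big_split; apply: eq_bigr => i _ /=.
rewrite mulr_sumr -big_split; apply: eq_bigr => j _ /=.
by rewrite !fctE /= /GRing.scale /= rmorphD rmorphM /=; ring.
Qed.

Definition kdelta (I : finType) (x : I) : I -> C := fun y => (y == x)%:R.

Lemma sum_kdelta (I : finType) (F : I -> C) x : \sum_y kdelta x y * F y = F x.
Proof.
rewrite (bigD1 x) //= /kdelta eqxx mul1r big1 ?addr0 // => y /negPf ->.
by rewrite mul0r.
Qed.

Lemma kform_delta (I : finType) (K : I -> I -> C) x y :
  kform K (kdelta y) (kdelta x) = K x y.
Proof.
rewrite /kform -[RHS](sum_kdelta (K ^~ y)); apply: eq_bigr => x' _.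
rewrite -(sum_kdelta (K x')) mulr_sumr; apply: eq_bigr => y' _.
by rewrite conjC_nat -mulrA; congr (_ * _); rewrite mulrC.
Qed.

Lemma kpsd_diag_ge0 (I : finType) (K : I -> I -> C) x : kpsd K -> 0 <= K x x.
Proof. by move=> K0; rewrite -kform_delta; apply: K0. Qed.

Lemma kpsd_herm (I : finType) (K : I -> I -> C) x y :
  kpsd K -> K x y = (K y x)^*.
Proof.
move=> K0; rewrite -!kform_delta.
exact: predot_herm (kform_predot K0) _ _.
Qed.

(** Cauchy-Schwarz, linearized by the inequality of arithmetic and geometric
    means; the weight t serves to absorb one of the two diagonal entries. *)
Lemma kpsd_entry_le (I : finType) (K : I -> I -> C) x y (t : C) :
  kpsd K -> 0 < t -> `|K x y| *+ 2 <= t * K x x + t^-1 * K y y.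
Proof.
move=> K0 t0; have := predot_CauchySchwarz (kform_predot K0) (kdelta y) (kdelta x).
rewrite !kform_delta => h.
have a0 := kpsd_diag_ge0 x K0; have b0 := kpsd_diag_ge0 y K0.
have t1 := ltW t0; have t2 : 0 <= t^-1 by rewrite invr_ge0.
rewrite -(ler_pXn2r (ltn0Sn 1)) ?nnegrE ?mulrn_wge0 ?addr_ge0 ?mulr_ge0 //.
rewrite -mulr_natl exprMn -natrX.
apply: (@le_trans _ _ ((2 ^ 2)%:R * (K y y * K x x))).
  by rewrite ler_wpM2l ?ler0n.
rewrite -subr_ge0.
have -> : (t * K x x + t^-1 * K y y) ^+ 2 - (2 ^ 2)%:R * (K y y * K x x) =
          (t * K x x - t^-1 * K y y) ^+ 2 + (t / t - 1) * ((2 ^ 2)%:R * (K y y * K x x)).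
  by ring.
rewrite divff ?gt_eqF // subrr mul0r addr0 -realEsqr.
by rewrite realB // realM ?ger0_real.
Qed.

Lemma kpsd0 (I : finType) : kpsd (fun _ _ : I => 0).
Proof.
by move=> v; rewrite /kform big1 // => x _; rewrite big1 // => y _; rewrite mulr0 mul0r.
Qed.

Lemma kformZD (I : finType) (K L : I -> I -> C) (a : C) u v :
  kform (a *: K + L) u v = a * kform K u v + kform L u v.
Proof.
rewrite /kform mulr_sumr -big_split; apply: eq_bigr => x _ /=.
rewrite mulr_sumr -big_split; apply: eq_bigr => y _ /=.
by have -> : (a *: K + L) x y = a * K x y + L x y by []; ring.
Qed.

Lemma kpsdZD (I : finType) (K L : I -> I -> C) (a : C) :
  0 <= a -> kpsd K -> kpsd L -> kpsd (a *: K + L).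
Proof. by move=> a0 K0 L0 v; rewrite kformZD addr_ge0 ?mulr_ge0. Qed.

Lemma kpsd_ulim (I : finType) (K : nat -> I -> I -> C) :
  (forall n, kpsd (K n)) -> (forall x y, ubounded (fun n => K n x y)) ->
  kpsd (fun x y => ulim (fun n => K n x y)).
Proof.
move=> K0 Kb v.
have h x y : ubounded (fun n => (v x)^* * K n x y * v y).
  by apply: uboundedM (@ubounded_cst R _); apply: uboundedM => //; exact: ubounded_cst.
have -> : kform (fun x y => ulim (fun n => K n x y)) v v =
          ulim (fun n => kform (K n) v v).
  rewrite /kform ulim_sum => [|x]; last exact: ubounded_sum.
  apply: eq_bigr => x _; rewrite ulim_sum //; apply: eq_bigr => y _.
  by rewrite ulimM ?ulimZ ?ulim_cst //; [apply: uboundedM => //|]; exact: ubounded_cst.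
apply: ulim_ge0; last by apply: filterS filterT => n _; exact: K0.
by do 2!apply: ubounded_sum => ?.
Qed.

Lemma kpsd_rank1 (I : finType) (h : I -> C) : kpsd (fun x y => (h x)^* * h y).
Proof.
move=> v; suff -> : kform (fun x y => (h x)^* * h y) v v =
    (\sum_x h x * v x)^* * \sum_x h x * v x.
  by rewrite -normCKC exprn_ge0.
rewrite rmorph_sum /kform mulr_suml; apply: eq_bigr => x _.
rewrite mulr_sumr; apply: eq_bigr => y _ /=.
by rewrite rmorphM /=; ring.
Qed.

End Kernels.

(** * Linear feasibility over the cone of positive semidefinite kernels *)

Section Perturbation.
Variable R : realType.
Local Notation C := (Cplx R).

(** Letting s tend to 0, without limits. It gives first-order conditions at a
    minimum and removes perturbations. *)
Lemma ge0_of_perturb (a c : C) : a \is Num.real -> 0 <= c ->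
  (forall s : C, 0 < s -> s <= 1 -> 0 <= a + s * c) -> 0 <= a.
Proof.
move=> ar c0 h; have [//|a0] := real_leP (real0 _) ar.
have d0 : 0 < c + 1 - a by rewrite subr_gt0 (lt_trans a0) // ltr_wpDl.
(* At s = - a / (c + 1 - a) the value is a (1 - a) / (c + 1 - a), which has the
   sign of a. *)
have sp : 0 < - a / (c + 1 - a) by rewrite divr_gt0 // oppr_gt0.
have s1 : - a / (c + 1 - a) <= 1.
  by rewrite ler_pdivrMr // mul1r lerDr addr_ge0.
have := h _ sp s1.
have -> : a + - a / (c + 1 - a) * c = a * ((1 - a) / (c + 1 - a)).
  by field; rewrite gt_eqF.
have p : 0 < (1 - a) / (c + 1 - a).
  by rewrite divr_gt0 // subr_gt0 (lt_trans a0).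
by move=> h'; have := le_lt_trans h' (_ : _ < 0); rewrite ltxx nmulr_rlt0 //; apply.
Qed.

End Perturbation.

Section Duality.
Variable R : realType.
Local Notation C := (Cplx R).

Lemma norm_perturb (z p s : C) : s^* = s ->
  `|s * p + z| ^+ 2 = `|z| ^+ 2 + s * (z^* * p + (z^* * p)^* + s * `|p| ^+ 2).
Proof. by move=> sr; rewrite !normCK rmorphD !rmorphM /= sr conjCK; ring. Qed.

Variables (I J : finType) (phi : J -> (I -> I -> C) -> C) (t : J -> C).
Hypothesis phi_lin : forall j a K L, phi j (a *: K + L) = a * phi j K + phi j L.
Hypothesis phi_coercive : forall c : C, exists b : C, forall K, kpsd K ->
  (forall j, `|phi j K| <= c) -> forall x, K x x <= b.

Let E (x y : I) : I -> I -> C := fun x' y' => (x' == x)%:R * (y' == y)%:R.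

Let phiE j K : phi j K = \sum_x \sum_y K x y * phi j (E x y).
Proof.
have phiD K' L : phi j (K' + L) = phi j K' + phi j L.
  by have := phi_lin j 1 K' L; rewrite scale1r mul1r.
have phi0 : phi j 0 = 0 by apply: (addrI (phi j 0)); rewrite -phiD !addr0.
have phiZ a K' : phi j (a *: K') = a * phi j K'.
  by have := phi_lin j a K' 0; rewrite phi0 !addr0.
have {1}-> : K = \sum_x \sum_y K x y *: E x y.
  apply/funext => x'; apply/funext => y'; rewrite !fct_sumE.
  transitivity (\sum_x \sum_y K x y * E x y x' y'); last first.
    by apply: eq_bigr => x _; rewrite !fct_sumE.
  rewrite (bigD1 x') //= [X in _ = _ + X]big1 ?addr0 => [|x xn].
    rewrite (bigD1 y') //= [X in _ = _ + X]big1 ?addr0 => [|y yn].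
      by rewrite /E !eqxx !mulr1.
    by rewrite /E [y' == y]eq_sym (negPf yn) !mulr0.
  by rewrite big1 // => y _; rewrite /E [x' == x]eq_sym (negPf xn) mul0r mulr0.
rewrite (big_morph (phi j) phiD phi0); apply: eq_bigr => x _.
by rewrite (big_morph (phi j) phiD phi0); apply: eq_bigr => y _.
Qed.

Let dist (K : I -> I -> C) : C := \sum_j `|phi j K - t j| ^+ 2.

Let dist_ge0 K : 0 <= dist K.
Proof. by apply: sumr_ge0 => j _; rewrite exprn_ge0. Qed.

Let Re_dist K : (complex.Re (dist K))%:C%C = dist K.
Proof. by rewrite RRe_real // ger0_real. Qed.

Let psd_entries (K : nat -> I -> I -> C) c : (forall n, kpsd (K n)) ->
  (forall n, dist (K n) <= c) -> forall x y, ubounded (fun n => K n x y).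
Proof.
move=> K0 Kc x y.
have c0 : 0 <= c by apply: le_trans (Kc 0%N).
have h n j : `|phi j (K n)| <= 1 + c + \sum_i `|t i|.
  have -> : phi j (K n) = (phi j (K n) - t j) + t j by rewrite subrK.
  apply: le_trans (ler_normD _ _) _; apply: lerD; last first.
    by rewrite (bigD1 j) //= lerDl sumr_ge0.
  set z := phi j (K n) - t j.
  have zc : `|z| ^+ 2 <= c.
    apply: le_trans (Kc n); rewrite /dist (bigD1 j) //= lerDl.
    by apply: sumr_ge0 => i _; rewrite exprn_ge0.
  rewrite -(ler_pXn2r (ltn0Sn 1)) ?nnegrE ?addr_ge0 ?ler01 //.
  apply: le_trans zc _; have -> : (1 + c) ^+ 2 = c + (1 + c + c * c) by ring.
  by rewrite lerDl !addr_ge0 ?ler01 ?mulr_ge0.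
have [b bP] := phi_coercive (1 + c + \sum_i `|t i|).
exists (b + b) => n; have := kpsd_entry_le x y (K0 n) (ltr01 : (0 : C) < 1).
rewrite invr1 !mul1r mulr2n => h'.
apply: le_trans (_ : _ <= `|K n x y| + `|K n x y|) _; first by rewrite lerDl.
by apply: le_trans h' _; rewrite lerD ?bP.
Qed.

Let phi_ulim (K : nat -> I -> I -> C) j :
  (forall x y, ubounded (fun n => K n x y)) ->
  ubounded (fun n => phi j (K n)) /\
  phi j (fun x y => ulim (fun n => K n x y)) = ulim (fun n => phi j (K n)).
Proof.
move=> Kb.
have e : (fun n => phi j (K n)) = (fun n => \sum_x \sum_y K n x y * phi j (E x y)).
  by apply/funext => n; rewrite phiE.
have h x y : ubounded (fun n => K n x y * phi j (E x y)).
  by apply: uboundedM => //; exact: ubounded_cst.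
split; first by rewrite e; do 2!apply: ubounded_sum => ?.
rewrite e phiE ulim_sum => [|x]; last exact: ubounded_sum.
apply: eq_bigr => x _; rewrite ulim_sum //; apply: eq_bigr => y _.
by rewrite ulimM ?ulim_cst //; exact: ubounded_cst.
Qed.

(** A minimizing sequence has bounded entries by coercivity, hence a limit along
    the ultrafilter, and the cone of positive semidefinite kernels is closed. *)
Let dist_min : exists2 K, kpsd K & forall L, kpsd L -> dist K <= dist L.
Proof.
pose S := [set complex.Re (dist K) | K in [set K | kpsd K]].
have S0 : has_inf S.
  split; first by exists (complex.Re (dist (fun _ _ => 0))); exists (fun _ _ => 0) => //; exact: kpsd0.
  by exists 0 => _ [K _ <-]; rewrite -lecR Re_dist.
have /choice[K KP] (n : nat) : exists K, kpsd K /\ complex.Re (dist K) < inf S + n.+1%:R^-1.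
  have e0 : (0 : R) < n.+1%:R^-1 by rewrite invr_gt0 ltr0n.
  have [_ [K K0 <-] h] := inf_adherent e0 S0.
  by exists K.
have K0 n : kpsd (K n) by case: (KP n).
have Kd n : dist (K n) <= (inf S + 1)%:C%C.
  rewrite -Re_dist lecR; apply: le_trans (ltW (KP n).2) _.
  by rewrite lerD2l invf_le1 // ler1n.
have Kb := psd_entries K0 Kd.
pose L := fun x y => ulim (fun n => K n x y).
exists L; first exact: kpsd_ulim.
have b1 j : ubounded (fun n => phi j (K n) - t j).
  by apply: uboundedD (ubounded_cst _); case: (phi_ulim j Kb).
have b2 j : ubounded (fun n => `|phi j (K n) - t j| ^+ 2).
  by have [B h] := b1 j; exists (B ^+ 2) => n; rewrite normrX normr_id ler_pXn2r // ?nnegrE // (le_trans _ (h n)).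
have eL : dist L = ulim (fun n => dist (K n)).
  rewrite /dist ulim_sum //; apply: eq_bigr => j _.
  have [b e] := phi_ulim j Kb.
  have nb : ubounded (fun n => `|phi j (K n) - t j|).
    by have [B h] := b1 j; exists B => n; rewrite normr_id.
  have -> : (fun n => `|phi j (K n) - t j| ^+ 2) =
     (fun n => `|phi j (K n) - t j| * `|phi j (K n) - t j|) by [].
  rewrite ulimM // ulim_norm // ulimD ?ulim_cst ?e //; exact: ubounded_cst.
move=> M M0; rewrite -(Re_dist L) -(Re_dist M) lecR.
have h : complex.Re (dist L) <= inf S.
  apply/ler_addgt0Pr => eps eps0.
  have : dist L <= (inf S + eps)%:C%C.
    rewrite eL -[leRHS](@ulim_cst R); apply: ler_ulim.
    - exact: ubounded_sum.
    - exact: ubounded_cst.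
    - have [n0 n0P] : exists n0, n0.+1%:R^-1 < eps.
        exists (Num.trunc (eps^-1)); rewrite invf_plt ?posrE //.
        by rewrite truncnS_gt.
      apply: filterS (freeU_ge n0) => n /= nn.
      rewrite -Re_dist lecR; apply: le_trans (ltW (KP n).2) _.
      rewrite lerD2l; apply: le_trans (ltW n0P).
      by rewrite lef_pV2 ?posrE // ler_nat.
  by rewrite -Re_dist lecR.
apply: le_trans h _; apply: ge_inf; last by exists M.
by exists 0 => _ [K' _ <-]; rewrite -lecR Re_dist.
Qed.

(** The residual at the positive semidefinite kernel closest to the system is
    a separating functional, by the first-order conditions at that kernel. *)
Theorem kpsd_duality :
  (exists2 K, kpsd K & forall j, phi j K = t j) \/
  exists lam : J -> C,
    (forall K, kpsd K ->
       0 <= \sum_j lam j * phi j K + (\sum_j lam j * phi j K)^*) /\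
    \sum_j lam j * t j + (\sum_j lam j * t j)^* < 0.
Proof.
have [K K0 Kmin] := dist_min.
have [dK0|dKn0] := eqVneq (dist K) 0.
  left; exists K => // j; apply/eqP; rewrite -subr_eq0 -normr_eq0 -sqrf_eq0.
  have := dK0; rewrite /dist => /psumr_eq0P/(_ j) -> //.
right; pose lam j := (phi j K - t j)^*; exists lam.
pose D L := \sum_j lam j * phi j L.
have key L (s : C) : s^* = s -> kpsd L ->
    dist (s *: L + K) = dist K + s * (D L + (D L)^* + s * \sum_j `|phi j L| ^+ 2).
  move=> sr L0; rewrite /dist /D rmorph_sum mulr_sumr -!big_split mulr_sumr -big_split.
  apply: eq_bigr => j _ /=.
  have -> : phi j (s *: L + K) - t j = s * phi j L + (phi j K - t j).
    by rewrite phi_lin addrA.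
  by rewrite norm_perturb.
have realD2 L : D L + (D L)^* \is Num.real.
  by rewrite CrealE rmorphD /= conjCK addrC.
have pos L : kpsd L -> 0 <= D L + (D L)^*.
  move=> L0; apply: (@ge0_of_perturb _ _ (\sum_j `|phi j L| ^+ 2)) => //.
    by apply: sumr_ge0 => j _; rewrite exprn_ge0.
  move=> s s0 _; have := Kmin _ (kpsdZD (ltW s0) L0 K0).
  rewrite key // ?lerDl ?pmulr_rge0 //.
  by apply/CrealP; rewrite gtr0_real.
split=> //.
have neg : 0 <= - (D K + (D K)^*).
  apply: (@ge0_of_perturb _ _ (\sum_j `|phi j K| ^+ 2)).
  - by rewrite rpredN.
  - by apply: sumr_ge0 => j _; rewrite exprn_ge0.
  move=> s s0 s1.
  have := Kmin ((- s) *: K + K); rewrite key //; last first.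
    by apply/CrealP; rewrite rpredN gtr0_real.
  rewrite lerDl mulNr -mulrN opprD mulNr opprK pmulr_rge0 //; apply.
  have -> : - s *: K + K = (1 - s) *: K + (fun _ _ => 0).
    rewrite scalerBl scale1r scaleNr addrC; apply/esym; exact: addr0.
  by apply: kpsdZD; rewrite ?subr_ge0 //; exact: kpsd0.
have -> : \sum_j lam j * t j = D K - dist K.
  rewrite /D /dist -sumrB; apply: eq_bigr => j _.
  by rewrite normCKC /lam; ring.
have dc : (dist K)^* = dist K by apply/CrealP; rewrite ger0_real.
rewrite rmorphB /= dc addrACA -opprD subr_lt0.
apply: le_lt_trans (_ : _ <= 0) _; first by rewrite -oppr_ge0.
by rewrite -mulr2n pmulrn_lgt0 // lt_def dKn0 dist_ge0.
Qed.

End Duality.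

(** * Matrix factorizations *)

Section Factor.
Variable R : realType.
Local Notation C := (Cplx R).

Lemma gram_eq0 m n (M : 'M[C]_(m, n)) : M *m M^t* = 0 -> M = 0.
Proof.
move=> h; apply/matrixP => i j; rewrite mxE.
have /matrixP/(_ i i) := h; rewrite !mxE.
under eq_bigr do rewrite !mxE -normCK.
move=> /psumr_eq0P/(_ j isT) hj; apply/eqP; rewrite -normr_eq0 -sqrf_eq0 hj //.
Qed.

Lemma mxrank_le_ker (K : fieldType) m n (B : 'M[K]_m) (M : 'M[K]_(m, n)) :
  kermx B *m M = 0 -> (\rank M <= \rank B)%N.
Proof.
move/sub_kermxP/mxrankS; rewrite !mxrank_ker.
by rewrite leq_sub2lE ?rank_leq_row.
Qed.

Lemma rank_gram m n (M : 'M[C]_(m, n)) : \rank (M *m M^t* ) = \rank M.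
Proof.
apply/eqP; rewrite eqn_leq mxrankM_maxl; apply: mxrank_le_ker; apply: gram_eq0.
rewrite trmx_mul map_mxM mulmxA -(mulmxA _ M).
by rewrite mulmx_ker mul0mx.
Qed.

(** Gram-Schmidt orthonormalization of a basis of the orthogonal complement of
    the rows of A. *)
Lemma orthonormal_complement m n (A : 'M[C]_(m, n)) :
  exists N : 'M[C]_(n - \rank A, n),
    [/\ N *m N^t* = 1%:M, A *m N^t* = 0 & row_full (col_mx A N)].
Proof.
pose B := kermx (A^t* ).
have rB : \rank B = (n - \rank A)%N.
  by rewrite mxrank_ker mxrank_map mxrank_tr.
rewrite -rB; pose N := schmidt (row_base B).
have NB : (N :=: B)%MS.
  by apply: eqmx_trans (eqmx_schmidt_free (row_base_free B)) (eq_row_base B).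
have NN : N *m N^t* = 1%:M.
  by apply/unitarymxP/schmidt_unitarymx/rank_leq_col.
have NA : N *m A^t* = 0 by apply/sub_kermxP; rewrite NB.
have AN : A *m N^t* = 0.
  by rewrite -[A]trmxCK -map_mxM -trmx_mul NA trmx0 map_mx0.
exists N; split=> //.
rewrite /row_full -addsmxE mxrank_disjoint_sum; last first.
  apply/eqP; rewrite -submx0; apply/rV_subP => v; rewrite sub_capmx.
  case/andP=> vA vN.
  have : v *m v^t* = 0.
    rewrite NB in vN; case/submxP: vN => y vy; case/submxP: vA => x vx.
    rewrite {1}vx vy trmx_mul map_mxM mulmxA -[x *m A *m _]mulmxA.
    have -> : A *m B^t* = 0 by rewrite -[A]trmxCK -map_mxM -trmx_mul mulmx_ker trmx0 map_mx0.
    by rewrite mulmx0 mul0mx.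
  by move/gram_eq0 => ->; rewrite sub0mx.
by rewrite NB rB subnKC // rank_leq_col.
Qed.

(** The rows of A go isometrically to the rows of B; as the orthogonal
    complements of the two row spaces have the same dimension, orthonormal bases
    of them extend the map to a unitary. *)
Lemma unitary_of_gram m n (A B : 'M[C]_(m, n)) : A *m A^t* = B *m B^t* ->
  exists U : 'M[C]_n, [/\ U *m U^t* = 1%:M, U^t* *m U = 1%:M & A *m U = B].
Proof.
move=> AB; have rk : \rank A = \rank B by rewrite -rank_gram AB rank_gram.
have [N [NN AN fA]] := orthonormal_complement A.
have [P [PP BP]] : exists P : 'M[C]_(n - \rank A, n), P *m P^t* = 1%:M /\ B *m P^t* = 0.
  by rewrite rk; have [P []] := orthonormal_complement B; exists P.
pose Z1 := col_mx A N; pose Z2 := col_mx B P.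
have adj0 p q r (X : 'M[C]_(p, q)) (Y : 'M[C]_(r, q)) : X *m Y^t* = 0 -> Y *m X^t* = 0.
  by move=> h; rewrite -[Y]trmxCK -map_mxM -trmx_mul h trmx0 map_mx0.
have ZZ : Z1 *m Z1^t* = Z2 *m Z2^t*.
  rewrite /Z1 /Z2 !tr_col_mx !map_row_mx !mul_col_row NN PP AN BP AB.
  by rewrite (adj0 _ _ _ _ _ AN) (adj0 _ _ _ _ _ BP).
have [L LZ] := row_fullP fA; rewrite -/Z1 in LZ.
pose U := L *m Z2.
have UU : U *m U^t* = 1%:M.
  rewrite trmx_mul map_mxM mulmxA -(mulmxA L) -ZZ -mulmxA.
  by rewrite -[_ *m L^t*]mulmxA -map_mxM -trmx_mul LZ trmx1 map_mx1 mulmx1.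
have ZU : Z1 *m U = Z2.
  apply/eqP; rewrite -subr_eq0 mulmxA -[X in _ - X]mul1mx -mulmxBl; apply/eqP.
  apply: gram_eq0; rewrite trmx_mul map_mxM mulmxA -(mulmxA _ Z2) -ZZ.
  by rewrite mulmxA [_ *m Z1]mulmxBl mul1mx -(mulmxA Z1) LZ mulmx1 subrr !mul0mx.
exists U; split=> //; first exact: mulmx1C.
by have := ZU; rewrite mul_col_mx => /eq_col_mx[].
Qed.

Lemma cform_col n (M : 'M[C]_n) (v : 'cV[C]_n) :
  (v^t* *m M *m v) 0 0 = kform (fun i j => M i j) (v ^~ 0) (v ^~ 0).
Proof.
rewrite mxE /kform exchange_big; apply: eq_bigr => y _.
by rewrite mxE mulr_suml; apply: eq_bigr => x _; rewrite !mxE.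
Qed.

(** The square root is taken on the spectrum. *)
Lemma psd_factor n (M : 'M[C]_n) : psd M -> exists B : 'M[C]_n, M = B^t* *m B.
Proof.
move=> M0; have k0 : kpsd (fun i j => M i j).
  move=> v; have := M0 (\col_i v i); rewrite cform_col.
  by congr (0 <= kform _ _ _); apply/funext => i; rewrite mxE.
have Mh : M \is hermsymmx.
  apply/is_hermitianmxP; rewrite expr0 scale1r; apply/matrixP => i j.
  by rewrite !mxE (kpsd_herm _ _ k0).
have /hermitian_normalmx/orthomx_spectralP := Mh.
set P := spectralmx M; set sp := spectral_diag M => Me.
have Pu : P \is unitarymx by apply: spectral_unitarymx.
have sp0 k : 0 <= sp 0 k.
  have := M0 ((row k P)^t* ); rewrite trmxCK Me invmx_unitary // !mulmxA.
  rewrite -row_mul (unitarymxP Pu) row1 -[_ *m P *m _]mulmxA.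
  have -> : P *m (row k P)^t* = col k 1%:M.
    rewrite -(unitarymxP Pu) !colE -mulmxA -colE; congr (_ *m _).
    by apply/matrixP => i j; rewrite !mxE.
  have -> : col k (1%:M : 'M[C]_n) = delta_mx k 0.
    by apply/matrixP => i j; rewrite !mxE ord1 eqxx andbT.
  by rewrite -rowE -colE !mxE eqxx mulr1n.
exists (diag_mx (map_mx sqrtC sp) *m P).
rewrite {1}Me (invmx_unitary Pu) trmx_mul map_mxM !mulmxA; congr (_ *m _).
rewrite -mulmxA; congr (_ *m _); rewrite tr_diag_mx map_diag_mx mulmx_diag.
congr diag_mx; apply/rowP => k; rewrite !mxE.
rewrite /= geC0_conj ?sqrtC_ge0 //; by rewrite -expr2 sqrtCK.
Qed.

Lemma kpsd_factor (I : finType) (K : I -> I -> C) : kpsd K ->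
  exists b : I -> 'cV[C]_#|I|, forall x y, K x y = cdot (b y) (b x).
Proof.
move=> K0; pose M : 'M[C]_#|I| := \matrix_(i, j) K (enum_val i) (enum_val j).
have M0 : psd M.
  move=> v; rewrite cform_col; have := K0 (fun x => v (enum_rank x) 0).
  rewrite /kform (reindex _ (onW_bij _ (enum_val_bij I))) /=.
  congr (0 <= _); apply: eq_bigr => i _.
  rewrite (reindex _ (onW_bij _ (enum_val_bij I))) /=.
  by apply: eq_bigr => j _; rewrite !enum_valK mxE.
have [B MB] := psd_factor M0.
exists (fun x => col (enum_rank x) B) => x y.
have /matrixP/(_ (enum_rank x) (enum_rank y)) := MB.
rewrite mxE !enum_rankK => ->; rewrite /cdot !mxE.
by apply: eq_bigr => k _; rewrite !mxE.
Qed.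

End Factor.

(** * Column vectors and operator norms *)

Section Columns.
Variable R : realType.
Local Notation C := (Cplx R).

Lemma cdotE n (u v : 'cV[C]_n) : cdot u v = \sum_i u i 0 * (v i 0)^*.
Proof. by rewrite /cdot mxE; apply: eq_bigr => i _; rewrite !mxE mulrC. Qed.

Lemma cdot_predot n : predot (@cdot R n).
Proof.
split=> [a x y z|x y|x]; rewrite !cdotE.
- by rewrite mulr_sumr -big_split; apply: eq_bigr => i _ /=; rewrite !mxE; ring.
- rewrite rmorph_sum; apply: eq_bigr => i _ /=.
  by rewrite rmorphM /= conjCK mulrC.
- by apply: sumr_ge0 => i _; rewrite -normCK exprn_ge0.
Qed.

Lemma cdot_norm n (v : 'cV[C]_n) : cdot v v = \sum_i `|v i 0| ^+ 2.
Proof. by rewrite cdotE; apply: eq_bigr => i _; rewrite normCK. Qed.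

Lemma cdot_adj m n (M : 'M[C]_(m, n)) u v : cdot (M *m u) v = cdot u (M^t* *m v).
Proof. by rewrite /cdot trmx_mul map_mxM trmxCK mulmxA. Qed.

Lemma cdot_delta n (v : 'cV[C]_n) i : cdot v (delta_mx i 0) = v i 0.
Proof.
rewrite cdotE (bigD1 i) //= !mxE !eqxx conjC1 mulr1 big1 ?addr0 // => k ki.
by rewrite !mxE (negPf ki) conjC0 mulr0.
Qed.

Lemma cdot_eq0 n (v : 'cV[C]_n) : cdot v v = 0 -> v = 0.
Proof.
rewrite cdot_norm => h; apply/colP => i; rewrite mxE; apply/eqP.
move/psumr_eq0P : h => /(_ _ i) h; rewrite -normr_eq0 -sqrf_eq0 h //.
Qed.

Lemma cabsE (z : C) : (cabs z)%:C%C = `|z|.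
Proof. by rewrite /cabs RRe_real // normr_real. Qed.

Lemma l2normE n (v : 'cV[C]_n) : ((l2norm v) ^+ 2)%:C%C = cdot v v.
Proof.
rewrite /l2norm sqr_sqrtr; last by apply: sumr_ge0 => i _; rewrite sqr_ge0.
rewrite cdot_norm rmorph_sum; apply: eq_bigr => i _ /=.
by rewrite rmorphXn /= cabsE.
Qed.

Lemma l2norm_ge0 n (v : 'cV[C]_n) : 0 <= l2norm v.
Proof. exact: sqrtr_ge0. Qed.

Lemma l2norm_pnorm n (v : 'cV[C]_n) : (l2norm v)%:C%C = pnorm (@cdot R n) v.
Proof.
rewrite /pnorm -l2normE rmorphXn /= sqrCK //.
by rewrite ler0c l2norm_ge0.
Qed.

Lemma l2normZ n (a : C) (v : 'cV[C]_n) : l2norm (a *: v) = cabs a * l2norm v.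
Proof.
apply: complexI; rewrite rmorphM /= cabsE !l2norm_pnorm.
exact: pnormZ (@cdot_predot n) _ _.
Qed.

Lemma l2norm_entry n (v : 'cV[C]_n) i : cabs (v i 0) <= l2norm v.
Proof.
rewrite -(ler_pXn2r (ltn0Sn 1)) ?nnegrE ?l2norm_ge0 //; last first.
  by rewrite -ler0c cabsE.
rewrite -lecR l2normE cdot_norm rmorphXn /= cabsE (bigD1 i) //= lerDl.
by apply: sumr_ge0 => k _; rewrite exprn_ge0.
Qed.

Lemma l2norm_sum n (v : 'cV[C]_n) : l2norm v <= \sum_i cabs (v i 0).
Proof.
have c0 (z : C) : 0 <= cabs z by rewrite -ler0c cabsE.
rewrite -(ler_pXn2r (ltn0Sn 1)) ?nnegrE ?l2norm_ge0 ?sumr_ge0 //.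
rewrite /l2norm sqr_sqrtr; last by apply: sumr_ge0 => i _; rewrite sqr_ge0.
rewrite expr2 mulr_suml; apply: ler_sum => i _.
by rewrite expr2 ler_wpM2l // (bigD1 i) //= lerDl sumr_ge0.
Qed.

Lemma opnorm_has_sup m n (M : 'M[C]_(m, n)) :
  has_sup [set l2norm (M *m v) | v in [set v : 'cV[C]_n | l2norm v <= 1]].
Proof.
have c0 (z : C) : 0 <= cabs z by rewrite -ler0c cabsE.
split.
  exists (l2norm (M *m (0 : 'cV[C]_n))); exists 0 => //=.
  rewrite -lecR l2norm_pnorm pnorm0 ?ler01 //; exact: cdot_predot.
exists (\sum_i \sum_j cabs (M i j)) => _ [v /= v1 <-].
apply: le_trans (l2norm_sum _) _; apply: ler_sum => i _.
rewrite -lecR cabsE rmorph_sum mxE; apply: le_trans (ler_norm_sum _ _ _) _.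
apply: ler_sum => j _; rewrite normrM /= cabsE -[leRHS]mulr1 ler_wpM2l //.
by rewrite -cabsE -[1]/((1 : R)%:C%C) lecR (le_trans (l2norm_entry _ _)).
Qed.

Lemma l2norm_opnorm m n (M : 'M[C]_(m, n)) v :
  l2norm (M *m v) <= opnorm M * l2norm v.
Proof.
have [v0|vn0] := eqVneq (l2norm v) 0.
  have -> : v = 0 by apply: cdot_eq0; rewrite -l2normE v0 expr0n.
  have l0 k : l2norm (0 : 'cV[C]_k) = 0.
    apply: complexI; rewrite l2norm_pnorm pnorm0 //; exact: cdot_predot.
  by rewrite mulmx0 !l0 mulr0.
have vp : 0 < l2norm v by rewrite lt_def vn0 l2norm_ge0.
have ca : cabs ((l2norm v)^-1)%:C%C = (l2norm v)^-1.
  by apply: complexI; rewrite cabsE ger0_norm // ler0c invr_ge0 ltW.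
rewrite -ler_pdivrMr // mulrC -ca -l2normZ scalemxAr.
apply: sup_ubound; first by case: (opnorm_has_sup M).
by exists (((l2norm v)^-1)%:C%C *: v) => //=; rewrite l2normZ ca mulVf.
Qed.

Lemma opnorm_ge0 m n (M : 'M[C]_(m, n)) : 0 <= opnorm M.
Proof.
apply: le_trans (l2norm_ge0 (M *m (0 : 'cV[C]_n))) _.
apply: sup_ubound; first by case: (opnorm_has_sup M).
exists 0 => //=; rewrite -lecR l2norm_pnorm pnorm0 ?ler01 //; exact: cdot_predot.
Qed.

Lemma opnorm_entry m n (M : 'M[C]_(m, n)) i j : `|M i j| <= (opnorm M)%:C%C.
Proof.
rewrite -cabsE lecR; have := l2norm_opnorm M (delta_mx j 0).
have -> : l2norm (delta_mx j 0 : 'cV[C]_n) = 1.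
  apply: complexI; rewrite l2norm_pnorm /pnorm cdot_delta mxE !eqxx sqrtC1 //.
rewrite mulr1; apply: le_trans; apply: le_trans (l2norm_entry _ i).
by rewrite -colE mxE.
Qed.

Lemma cdot_opnorm m n (M : 'M[C]_(m, n)) (r : R) v : opnorm M <= r ->
  cdot (M *m v) (M *m v) <= (r%:C%C) ^+ 2 * cdot v v.
Proof.
move=> Mr; have r0 : 0 <= r by apply: le_trans (opnorm_ge0 M) Mr.
rewrite -!l2normE -rmorphXn -rmorphM /= lecR -exprMn.
rewrite ler_pXn2r ?nnegrE ?mulr_ge0 ?l2norm_ge0 //.
by apply: le_trans (l2norm_opnorm M v) _; rewrite ler_wpM2r ?l2norm_ge0.
Qed.

Definition blk d n (v : 'cV[C]_(d * n)) (i : 'I_d) : 'cV[C]_n :=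
  \col_k v (mxtens_index (i, k)) 0.

Definition unblk d n (w : 'I_d -> 'cV[C]_n) : 'cV[C]_(d * n) :=
  \col_p w (mxtens_unindex p).1 (mxtens_unindex p).2 0.

Lemma blkK d n (w : 'I_d -> 'cV[C]_n) i : blk (unblk w) i = w i.
Proof. by apply/colP => k; rewrite !mxE mxtens_indexK. Qed.

Lemma sum_mxtens (V : nmodType) d n (F : 'I_(d * n) -> V) :
  \sum_p F p = \sum_i \sum_k F (mxtens_index (i, k)).
Proof.
rewrite pair_big /= (reindex (@mxtens_index d n)) /=; first by apply: eq_bigr => -[].
by exists (@mxtens_unindex d n) => p _; rewrite ?mxtens_indexK ?mxtens_unindexK.
Qed.

Lemma cdot_blk d n (u v : 'cV[C]_(d * n)) :
  cdot u v = \sum_i cdot (blk u i) (blk v i).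
Proof.
rewrite cdotE sum_mxtens; apply: eq_bigr => i _.
by rewrite cdotE; apply: eq_bigr => k _; rewrite !mxE.
Qed.

Lemma blk_tensmx d c n m (A : 'M[C]_(d, c)) (X : 'M[C]_(n, m)) v i :
  blk (tensmx A X *m v) i = \sum_l A i l *: (X *m blk v l).
Proof.
apply/colP => k; rewrite !mxE summxE sum_mxtens; apply: eq_bigr => l _.
rewrite !mxE mulr_sumr; apply: eq_bigr => q _.
by rewrite tensmxE !mxE mulrA.
Qed.

End Columns.

Local Notation cdotP := (@cdot_predot _ _).

(** * Free spectrahedra *)

Section Spectrahedron.
Variables (R : realType) (g d : nat).
Local Notation C := (Cplx R).
Variable A : 'I_g -> 'M[C]_d.

(** The quadratic form of sum_j A_j (x) X_j at the vector of C^d (x) C^n whose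
    blocks are the w i. *)
Definition pencil_form n (X : 'I_g -> 'M[C]_n) (w : 'I_d -> 'cV[C]_n) : C :=
  \sum_j \sum_i \sum_l A j i l * cdot (X j *m w l) (w i).

Lemma spectrahedronP n (X : 'I_g -> 'M[C]_n) :
  spectrahedron A X <-> forall w : 'I_d -> 'cV[C]_n,
    0 <= \sum_i cdot (w i) (w i) + (pencil_form X w + (pencil_form X w)^*).
Proof.
have key (v : 'cV[C]_(d * n)) : (v^t* *m pencil A X *m v) 0 0 =
    \sum_i cdot (blk v i) (blk v i) +
    (pencil_form X (blk v) + (pencil_form X (blk v))^*).
  have e : cdot ((\sum_j tensmx (A j) (X j)) *m v) v = pencil_form X (blk v).
    rewrite mulmx_suml (predot_suml cdotP); apply: eq_bigr => j _.
    rewrite cdot_blk; apply: eq_bigr => i _.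
    rewrite blk_tensmx (predot_suml cdotP); apply: eq_bigr => l _.
    exact: predotZl cdotP _ _ _.
  have -> : (v^t* *m pencil A X *m v) 0 0 = cdot (pencil A X *m v) v.
    by rewrite /cdot mulmxA.
  rewrite /pencil !mulmxDl mul1mx !(predotDl cdotP) -cdot_blk -addrA.
  congr (_ + (_ + _)); first exact: e.
  rewrite -e -(predot_herm cdotP) cdot_adj; congr cdot.
  congr (_ *m v); rewrite !raddf_sum /=; apply: eq_bigr => j _.
  by rewrite trmx_tens map_mxT !trmxCK.
split=> h w; last by rewrite key.
have := h (unblk w); rewrite key.
have -> : blk (unblk w) = w by apply/funext => i; rewrite blkK.
by [].
Qed.

(** For X in the ball of radius r the linear part of L_A(X) has norm at most 2 r
    times the sum of the moduli of the entries of A. *)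
Lemma spectrahedron_ball : exists2 r : R, 0 < r &
  forall n (X : 'I_g -> 'M[C]_n),
    (forall j v, cdot (X j *m v) (X j *m v) <= (r%:C%C) ^+ 2 * cdot v v) ->
    spectrahedron A X.
Proof.
pose S := \sum_j \sum_i \sum_l cabs (A j i l).
have c0 (z : C) : 0 <= cabs z by rewrite -ler0c cabsE.
have S0 : 0 <= S by do 3!apply: sumr_ge0 => ? _.
have r0 : 0 < (2 * (S + 1))^-1 by rewrite invr_gt0 mulr_gt0 // ltr_wpDl.
exists (2 * (S + 1))^-1 => // n X; set r := _^-1 => Xr.
apply/spectrahedronP => w; set s := \sum_i cdot _ _.
have nw0 i : 0 <= cdot (w i) (w i) by apply: predot_ge0 cdotP _.
have s0 : 0 <= s by apply: sumr_ge0.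
have ws i : pnorm (@cdot R n) (w i) <= sqrtC s.
  by rewrite ler_sqrtC ?nnegrE // /s (bigD1 i) //= lerDl sumr_ge0.
have h : `|pencil_form X w| <= (S * r)%:C%C * s.
  rewrite /pencil_form rmorphM /= /S rmorph_sum !mulr_suml.
  apply: le_trans (ler_norm_sum _ _ _) _; apply: ler_sum => j _.
  rewrite rmorph_sum !mulr_suml.
  apply: le_trans (ler_norm_sum _ _ _) _; apply: ler_sum => i _.
  rewrite rmorph_sum !mulr_suml.
  apply: le_trans (ler_norm_sum _ _ _) _; apply: ler_sum => l _ /=.
  rewrite cabsE normrM -mulrA ler_wpM2l //.
  apply: le_trans (predot_le cdotP _ _) _.
  have -> : (r%:C%C : C) * s = (r%:C%C * sqrtC s) * sqrtC s.
    by rewrite -mulrA -expr2 sqrtCK.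
  apply: ler_pM => //; rewrite ?(pnorm_ge0 cdotP) //.
  have rC : 0 <= r%:C%C :> C by rewrite ler0c ltW.
  rewrite -(ler_pXn2r (ltn0Sn 1)) ?nnegrE ?mulr_ge0 ?sqrtC_ge0 ?(predot_ge0 cdotP) //.
  rewrite pnormK exprMn sqrtCK; apply: le_trans (Xr _ _) _.
  by rewrite ler_wpM2l ?exprn_ge0 // /s (bigD1 l) //= lerDl sumr_ge0.
have h2 : `|pencil_form X w + (pencil_form X w)^*| <= s.
  apply: le_trans (ler_normD _ _) _; rewrite norm_conjC -mulr2n.
  apply: le_trans (_ : _ <= (S * r)%:C%C * s *+ 2) _; first by rewrite lerMn2r h orbT.
  rewrite -mulrnAl -rmorphMn /= -[leRHS]mul1r ler_wpM2r // lecR /r.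
  by rewrite -mulrnAl -mulr_natl ler_pdivrMr ?mul1r ?ler_wpM2l ?lerDl // mulr_gt0 // ltr_wpDl.
have re : pencil_form X w + (pencil_form X w)^* \is Num.real.
  by rewrite CrealE rmorphD /= conjCK addrC.
move: h2; rewrite real_ler_norml // => /andP[h3 _].
by rewrite addrC -lerBlDr sub0r.
Qed.

(** By duality, the alternative to P is a scalar tuple y and a number c < 0 such
    that c + 2 Re (sum_j y_j A_j) >= 0. All positive multiples of y are then in
    D_A(1), so that y = 0 by boundedness, which contradicts c < 0. *)
Lemma trace_zero_density (d_gt0 : (0 < d)%N)
    (bounded_DA : free_bounded (spectrahedron A)) :
  exists P : 'I_d -> 'I_d -> C, [/\ kpsd P, \sum_i P i i = 1 &
    forall j, \sum_i \sum_l A j i l * P i l = 0].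
Proof.
pose phi (o : option 'I_g) (K : 'I_d -> 'I_d -> C) : C :=
  if o is Some j then \sum_i \sum_l A j i l * K i l else \sum_i K i i.
pose t (o : option 'I_g) : C := if o is Some j then 0 else 1.
have lin o a K L : phi o (a *: K + L) = a * phi o K + phi o L.
  case: o => [j|] /=.
    rewrite mulr_sumr -big_split; apply: eq_bigr => i _ /=.
    rewrite mulr_sumr -big_split; apply: eq_bigr => l _ /=.
    by have -> : (a *: K + L) i l = a * K i l + L i l by []; ring.
  by rewrite mulr_sumr -big_split; apply: eq_bigr => i _.
have coer (c : C) : exists b : C, forall K, kpsd K ->
    (forall o, `|phi o K| <= c) -> forall x, K x x <= b.
  exists c => K K0 /(_ None) /= h x; apply: le_trans h.
  rewrite ger0_norm; last by apply: sumr_ge0 => i _; apply: kpsd_diag_ge0.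
  by rewrite (bigD1 x) //= lerDl; apply: sumr_ge0 => i _; apply: kpsd_diag_ge0.
have [[P P0 Pt]|[lam [lam0 lamt]]] := kpsd_duality t lin coer.
  by exists P; split=> //; [exact: (Pt None)|move=> j; exact: (Pt (Some j))].
exfalso.
have sumo (F : option 'I_g -> C) : \sum_o F o = F None + \sum_j F (Some j).
  rewrite (bigD1 None) //=; congr (_ + _).
  rewrite (reindex_omap (@Some 'I_g) id) //=; last by case.
  by apply: eq_bigl => j; rewrite eqxx.
have Sz : \sum_j lam (Some j) * 0 = 0 by rewrite big1 // => j _; rewrite mulr0.
rewrite sumo /= mulr1 Sz addr0 in lamt.
have in_DA (s : C) : 0 < s ->
    spectrahedron A (fun j => (s * lam (Some j))%:M : 'M[C]_1).
  move=> s0; apply/spectrahedronP => w.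
  pose h i := w i 0 0.
  have := lam0 _ (kpsd_rank1 h); rewrite sumo /=.
  set tr := \sum_i _; set sm := \sum_j _ => hh.
  have -> : \sum_i cdot (w i) (w i) = tr.
    by apply: eq_bigr => i _; rewrite cdotE big_ord1 mulrC.
  have tr0 : 0 <= tr by apply: sumr_ge0 => i _; rewrite -normCKC exprn_ge0.
  have -> : pencil_form (fun j => (s * lam (Some j))%:M) w = s * sm.
    rewrite mulr_sumr; apply: eq_bigr => j _.
    rewrite !mulr_sumr; apply: eq_bigr => i _.
    rewrite !mulr_sumr; apply: eq_bigr => l _.
    by rewrite cdotE big_ord1 mul_scalar_mx mxE /h; ring.
  have sr : s^* = s by apply/CrealP; rewrite gtr0_real.
  have trr : tr^* = tr by apply/CrealP; rewrite ger0_real.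
  rewrite rmorphM /= sr -mulrDr.
  have e : sm + sm^* = (lam None * tr + sm + (lam None * tr + sm)^* ) - (lam None + (lam None)^* ) * tr.
    by rewrite rmorphD rmorphM /= trr; ring.
  rewrite addr_ge0 // pmulr_rge0 // e addr_ge0 // oppr_ge0.
  by rewrite mulr_le0_ge0 // ltW.
have [N hN] := bounded_DA.
(* Otherwise the multiple of modulus N + 1 exceeds the bound N. *)
have lamS j : lam (Some j) = 0.
  apply/eqP; apply: contraT => ln0.
  have lp : 0 < `|lam (Some j)| by rewrite normr_gt0.
  have N0 : 0 <= (N%:C%C : C).
    rewrite ler0c; have := hN _ _ (in_DA 1 ltr01) j.
    by apply: le_trans; exact: opnorm_ge0.
  pose s := ((N%:C%C : C) + 1) / `|lam (Some j)|.
  have s0 : 0 < s by rewrite divr_gt0 // ltr_wpDl.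
  have := hN _ _ (in_DA s s0) j; rewrite -lecR => h.
  have := le_trans (opnorm_entry _ 0 0) h.
  rewrite mxE eqxx mulr1n normrM (gtr0_norm s0) /s mulrVK ?unitfE ?gt_eqF //.
  by rewrite gerDl ler10.
pose i0 := Ordinal d_gt0.
have := lam0 _ (kpsd_rank1 (kdelta R i0)); rewrite sumo /=.
have {}Sz F : \sum_j lam (Some j) * F j = 0 by rewrite big1 // => j _; rewrite lamS mul0r.
rewrite Sz addr0.
have -> : \sum_i (kdelta R i0 i)^* * kdelta R i0 i = 1.
  rewrite (bigD1 i0) //= /kdelta eqxx conjC_nat mulr1 big1 ?addr0 // => i /negPf ->.
  by rewrite mulr0.
by rewrite mulr1 => /(lt_le_trans lamt); rewrite ltxx.
Qed.

End Spectrahedron.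

(** * Tensor products of column vectors *)

Section VTens.
Variable R : realType.
Local Notation C := (Cplx R).

Definition vtens e n (u : 'cV[C]_e) (v : 'cV[C]_n) : 'cV[C]_(e * n) :=
  \col_p (u (mxtens_unindex p).1 0 * v (mxtens_unindex p).2 0).

Lemma vtensE e n (u : 'cV[C]_e) (v : 'cV[C]_n) i k :
  vtens u v (mxtens_index (i, k)) 0 = u i 0 * v k 0.
Proof. by rewrite mxE mxtens_indexK. Qed.

Lemma colP_mxtens e n (u v : 'cV[C]_(e * n)) :
  (forall i k, u (mxtens_index (i, k)) 0 = v (mxtens_index (i, k)) 0) -> u = v.
Proof. by move=> h; apply/colP => p; rewrite -(mxtens_unindexK p); case: mxtens_unindex. Qed.

Lemma tensmx_vtens e f n m (M : 'M[C]_(f, e)) (N : 'M[C]_(m, n)) u v :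
  tensmx M N *m vtens u v = vtens (M *m u) (N *m v).
Proof.
apply: colP_mxtens => i k; rewrite vtensE !mxE sum_mxtens mulr_suml.
apply: eq_bigr => i' _; rewrite mulr_sumr; apply: eq_bigr => k' _.
by rewrite tensmxE vtensE; ring.
Qed.

Lemma vtensDl e n (u u' : 'cV[C]_e) (v : 'cV[C]_n) :
  vtens (u + u') v = vtens u v + vtens u' v.
Proof. by apply/colP => p; rewrite !mxE mulrDl. Qed.

Lemma vtensDr e n (u : 'cV[C]_e) (v v' : 'cV[C]_n) :
  vtens u (v + v') = vtens u v + vtens u v'.
Proof. by apply/colP => p; rewrite !mxE mulrDr. Qed.

Lemma vtensZl e n (a : C) (u : 'cV[C]_e) (v : 'cV[C]_n) :
  vtens (a *: u) v = a *: vtens u v.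
Proof. by apply/colP => p; rewrite !mxE mulrA. Qed.

Lemma vtensZr e n (a : C) (u : 'cV[C]_e) (v : 'cV[C]_n) :
  vtens u (a *: v) = a *: vtens u v.
Proof. by apply/colP => p; rewrite !mxE mulrCA. Qed.

Lemma vtens0r e n (u : 'cV[C]_e) : vtens u (0 : 'cV[C]_n) = 0.
Proof. by apply/colP => p; rewrite !mxE mulr0. Qed.

Lemma vtens0l e n (v : 'cV[C]_n) : vtens (0 : 'cV[C]_e) v = 0.
Proof. by apply/colP => p; rewrite !mxE mul0r. Qed.

Lemma vtens_sumr e n I (r : seq I) (P : pred I) (u : 'cV[C]_e) (F : I -> 'cV[C]_n) :
  vtens u (\sum_(i <- r | P i) F i) = \sum_(i <- r | P i) vtens u (F i).
Proof. by apply: big_morph => [v v'|]; [exact: vtensDr|exact: vtens0r]. Qed.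

Lemma vtens_suml e n I (r : seq I) (P : pred I) (v : 'cV[C]_n) (F : I -> 'cV[C]_e) :
  vtens (\sum_(i <- r | P i) F i) v = \sum_(i <- r | P i) vtens (F i) v.
Proof.
by apply: (big_morph (fun u => vtens u v)) => [u u'|]; [exact: vtensDl|exact: vtens0l].
Qed.

Lemma cdot_vtens e n (u u' : 'cV[C]_e) (v v' : 'cV[C]_n) :
  cdot (vtens u v) (vtens u' v') = cdot u u' * cdot v v'.
Proof.
rewrite !cdotE sum_mxtens mulr_suml; apply: eq_bigr => i _.
rewrite mulr_sumr; apply: eq_bigr => k _.
by rewrite !vtensE rmorphM /=; ring.
Qed.

Lemma vtens_delta e n i k : vtens (delta_mx i 0) (delta_mx k 0) =
  delta_mx (mxtens_index (i, k)) 0 :> 'cV[C]_(e * n).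
Proof.
apply: colP_mxtens => i' k'; rewrite vtensE !mxE !andbT -natrM mulnb.
by rewrite (can_eq (@mxtens_indexK e n)).
Qed.

Lemma mulmx_ext m n (M N : 'M[C]_(m, n)) :
  (forall v : 'cV[C]_n, M *m v = N *m v) -> M = N.
Proof.
move=> h; apply/matrixP => i j.
by have /colP/(_ i) := h (delta_mx j 0); rewrite -!colE !mxE.
Qed.

Lemma mulmx_vtens_ext m e n (M N : 'M[C]_(m, e * n)) :
  (forall u v, M *m vtens u v = N *m vtens u v) -> M = N.
Proof.
move=> h; apply/matrixP => i p; rewrite -(mxtens_unindexK p).
case: (mxtens_unindex p) => k l.
have /colP/(_ i) := h (delta_mx k 0) (delta_mx l 0).
by rewrite !vtens_delta -!colE !mxE.
Qed.

(** The operator w |-> s (x) w. *)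
Definition vlift k n (s : 'cV[C]_k) : 'M[C]_(k * n, n) :=
  \matrix_(p, q) (s (mxtens_unindex p).1 0 * ((mxtens_unindex p).2 == q)%:R).

Lemma vliftE k n (s : 'cV[C]_k) (w : 'cV[C]_n) : vlift n s *m w = vtens s w.
Proof.
apply/colP => p; rewrite !mxE (bigD1 (mxtens_unindex p).2) //= !mxE eqxx mulr1.
rewrite big1 ?addr0 // => q /negPf qp.
by rewrite mxE eq_sym qp mulr0 mul0r.
Qed.

Lemma tensmx_vlift k n (K : 'M[C]_k) (X : 'M[C]_n) s :
  tensmx K X *m vlift n s = vlift n (K *m s) *m X.
Proof. by apply: mulmx_ext => w; rewrite -!mulmxA !vliftE tensmx_vtens. Qed.

Lemma vlift_adj k n (s s' : 'cV[C]_k) (w : 'cV[C]_n) :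
  (vlift n s)^t* *m vtens s' w = cdot s' s *: w.
Proof.
apply/colP => q; rewrite !mxE sum_mxtens cdotE mulr_suml.
apply: eq_bigr => i _; rewrite (bigD1 q) //= big1 => [|q' /negPf qq'].
  by rewrite addr0 vtensE !mxE mxtens_indexK /= eqxx mulr1; ring.
by rewrite !mxE mxtens_indexK /= qq' mulr0 conjC0 mul0r.
Qed.

Lemma vlift_adj_tensmx k n (K : 'M[C]_k) (X : 'M[C]_n) s :
  (vlift n s)^t* *m tensmx K X = X *m (vlift n (K^t* *m s))^t*.
Proof.
apply: mulmx_vtens_ext => s' w; rewrite -!mulmxA tensmx_vtens !vlift_adj.
by rewrite cdot_adj scalemxAr.
Qed.

(** A matrix with at most one nonzero entry in each row maps distinct basis
    vectors to orthogonal vectors. *)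
Lemma cdot_row_monomial m n (K : 'M[C]_(m, n)) (b : C) (v : 'cV[C]_n) :
  (forall i l l', K i l != 0 -> K i l' != 0 -> l = l') ->
  (forall l, \sum_i `|K i l| ^+ 2 <= b) ->
  cdot (K *m v) (K *m v) <= b * cdot v v.
Proof.
move=> Kmono Kb; rewrite !cdot_norm.
have -> : \sum_i `|(K *m v) i 0| ^+ 2 = \sum_l (\sum_i `|K i l| ^+ 2) * `|v l 0| ^+ 2.
  under [RHS]eq_bigr do rewrite mulr_suml.
  rewrite exchange_big; apply: eq_bigr => i _ /=; rewrite mxE.
  case: (pickP (fun l => K i l != 0)) => [l0 Kl0|K0].
    have z l : l != l0 -> K i l = 0.
      by move=> ll0; apply/eqP; apply: contraT => /Kmono/(_ Kl0) e; rewrite e eqxx in ll0.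
    rewrite !(bigD1 l0 (P := xpredT)) //= !big1 ?addr0 => [|l /z ->|l /z ->].
    - by rewrite normrM exprMn.
    - by rewrite normr0 expr0n mul0r.
    - by rewrite mul0r.
  have {}K0 l : K i l = 0 by have /negbFE/eqP := K0 l.
  rewrite !big1 ?normr0 ?expr0n // => l _; rewrite K0 ?normr0 ?expr0n mul0r //.
by rewrite mulr_sumr; apply: ler_sum => l _; rewrite ler_wpM2r ?exprn_ge0.
Qed.

Lemma ler_sum_atmost1 (I : finType) (F : I -> C) (b : C) : 0 <= b ->
  (forall i j, F i != 0 -> F j != 0 -> i = j) -> (forall i, F i <= b) ->
  \sum_i F i <= b.
Proof.
move=> b0 F1 Fb; case: (pickP (fun i => F i != 0)) => [i0 Fi0|F0].
  rewrite (bigD1 i0) //= big1 ?addr0 // => i ii0.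
  by apply/eqP; apply: contraT => /F1/(_ Fi0) ee; rewrite ee eqxx in ii0.
by rewrite big1 // => i _; have /negbFE/eqP := F0 i.
Qed.

Lemma cdot_tens1mx k n (X : 'M[C]_n) (b : C) (v : 'cV[C]_(k * n)) :
  (forall w, cdot (X *m w) (X *m w) <= b * cdot w w) ->
  cdot (tensmx 1%:M X *m v) (tensmx 1%:M X *m v) <= b * cdot v v.
Proof.
move=> Xb; rewrite !cdot_blk mulr_sumr; apply: ler_sum => i _.
have -> : blk (tensmx 1%:M X *m v) i = X *m blk v i; last exact: Xb.
rewrite blk_tensmx (bigD1 i) //= big1 ?addr0 => [|l /negPf li].
  by rewrite mxE eqxx scale1r.
by rewrite mxE eq_sym li scale0r.
Qed.

End VTens.

(** * Creation matrices on words of bounded length *)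

Section Shift.
Variables (R : realType) (g : nat).
Local Notation C := (Cplx R).
Local Notation word := (word g).

Definition ev (T : finType) (x : T) : 'cV[C]_#|T| := delta_mx (enum_rank x) 0.

Lemma mulmx_ev_ext m (T : finType) (M N : 'M[C]_(m, #|T|)) :
  (forall x, M *m ev x = N *m ev x) -> M = N.
Proof.
move=> h; apply/matrixP => i q; have /colP/(_ i) := h (enum_val q).
by rewrite /ev enum_valK -!colE !mxE.
Qed.

Lemma ev_ortho (T : finType) (x y : T) : (ev x)^T *m ev y = (x == y)%:R%:M.
Proof.
apply/matrixP => i k; rewrite /ev -colE !mxE !ord1 eqxx andbT mulr1n.
by rewrite eq_sym (can_eq (@enum_rankK T)).
Qed.

(** The creation matrix of the letter j on the span of the words of length at
    most N, with multiplicity space C^M; words that become too long are sent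
    to 0. *)
Definition shift N (M : finType) (j : 'I_g) : 'M[C]_#|{: N.-bseq 'I_g * M}| :=
  \matrix_(p, q) ((val (enum_val p).1 == j :: val (enum_val q).1) &&
                  ((enum_val p).2 == (enum_val q).2))%:R.

(** The basis vector of the word a, which is read as 0 beyond length N so that
    creation acts on it without a side condition. *)
Definition wv N (M : finType) (u : M) (a : word) : 'cV[C]_#|{: N.-bseq 'I_g * M}| :=
  if (size a <= N)%N then ev (insub_bseq N a, u) else 0.

Lemma insub_bseqK N (a : word) : (size a <= N)%N -> val (insub_bseq N a) = a.
Proof. by move=> h; rewrite /insub_bseq /insubd insubT. Qed.

Lemma shift_wv N (M : finType) j (u : M) (a : word) : shift N M j *m wv N u a = wv N u (j :: a).
Proof.
rewrite /wv /=; have [aN|aN] := leqP (size a) N; last first.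
  by rewrite mulmx0 ltnNge (ltnW aN).
apply/colP => p; rewrite /ev -colE !mxE enum_rankK /= insub_bseqK //.
have [jaN|jaN] := leqP (size a).+1 N.
  rewrite mxE andbT -[p in RHS]enum_valK (can_eq (@enum_rankK _)).
  by rewrite -pair_eqE /pair_eq /= -val_eqE insub_bseqK.
rewrite mxE; case: eqP => // e.
by have := size_bseq (enum_val p).1; rewrite e /= leqNgt jaN.
Qed.

Lemma wordmx_cons n (X : 'I_g -> 'M[C]_n) j a :
  wordmx X (j :: a) = X j *m wordmx X a.
Proof. by rewrite /wordmx big_cons. Qed.

Lemma wordmx_nil n (X : 'I_g -> 'M[C]_n) : wordmx X [::] = 1%:M.
Proof. by rewrite /wordmx big_nil. Qed.

Lemma wordmx_scale n (X : 'I_g -> 'M[C]_n) (r : C) a :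
  wordmx (fun j => r *: X j) a = r ^+ size a *: wordmx X a.
Proof.
elim: a => [|j a IH]; first by rewrite !wordmx_nil expr0 scale1r.
by rewrite !wordmx_cons IH -scalemxAl -scalemxAr scalerA exprS.
Qed.

Lemma wordmx_shift N (M : finType) (u : M) (a : word) : wordmx (shift N M) a *m wv N u [::] = wv N u a.
Proof.
elim: a => [|j a IH]; first by rewrite wordmx_nil mul1mx.
by rewrite wordmx_cons -mulmxA IH shift_wv.
Qed.

Lemma shift_contraction N (M : finType) j v :
  cdot (shift N M j *m v) (shift N M j *m v) <= cdot v v.
Proof.
rewrite -[leRHS]mul1r; apply: cdot_row_monomial => [p q q'|q].
  rewrite !mxE !pnatr_eq0 !eqb0 !negbK => /andP[/eqP e1 /eqP e2] /andP[/eqP e3 /eqP e4].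
  apply: enum_val_inj; rewrite (surjective_pairing (enum_val q)) (surjective_pairing (enum_val q')).
  congr pair; last by rewrite -e2 e4.
  by apply: val_inj; move: e3; rewrite e1 => -[].
apply: ler_sum_atmost1 => // [p p'|p].
  rewrite !mxE !normr_nat -!natrX !pnatr_eq0 !expn_eq0 !andbT !eqb0 !negbK.
  move=> /andP[/eqP e1 /eqP e2] /andP[/eqP e3 /eqP e4].
  apply: enum_val_inj; rewrite (surjective_pairing (enum_val p)) (surjective_pairing (enum_val p')).
  by congr pair; [apply: val_inj; rewrite e1 -e3|rewrite e2 -e4].
by rewrite mxE; case: (_ && _); rewrite ?normr1 ?expr1n ?normr0 ?expr0n ?ler01.
Qed.

Lemma sum_bseq (V : nmodType) N (F : word -> V) :
  \sum_(a : N.-bseq 'I_g) F a = \sum_(i < N.+1) \sum_(a : i.-tuple 'I_g) F a.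
Proof.
have sz (a : N.-bseq 'I_g) : (size a < N.+1)%N by rewrite ltnS size_bseq.
rewrite (partition_big (fun a => Ordinal (sz a)) xpredT) //=; apply: eq_bigr => i _.
have iN : (i <= N)%N by rewrite -ltnS.
pose h (t : i.-tuple 'I_g) : N.-bseq 'I_g := insub_bseq N t.
have hK t : val (h t) = t by rewrite /h insub_bseqK // size_tuple.
rewrite (reindex_omap h (fun a => insub (val a))) => [|a /eqP e] /=.
  apply: eq_big => [t|t _]; last by rewrite hK.
  by rewrite -val_eqE /= hK size_tuple eqxx valK eqxx.
have ai : size (val a) == i by move/(congr1 val): e => /= /eqP.
by rewrite insubT /=; congr Some; apply: val_inj; rewrite hK.
Qed.

End Shift.

(** * Free functions on nilpotent tuples *)

Section FreeNilpotent.
Variables (R : realType) (g d e : nat).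
Local Notation C := (Cplx R).
Local Notation word := (word g).
Variables (A : 'I_g -> 'M[C]_d) (G : graded_fun R g e) (r : R).
Hypothesis r_gt0 : 0 < r.
Hypothesis ball_DA : forall n (X : 'I_g -> 'M[C]_n),
  (forall j v, cdot (X j *m v) (X j *m v) <= (r%:C%C) ^+ 2 * cdot v v) ->
  spectrahedron A X.
Hypothesis free_G : free_function (spectrahedron A) G.

Let rC : C := r%:C%C.
Let rC_neq0 : rC != 0. Proof. by rewrite gt_eqF // ltcR. Qed.

(** Creation matrices scaled into the ball of radius r inside D_A. *)
Definition model N (j : 'I_g) : 'M[C]_#|{: N.-bseq 'I_g * unit}| :=
  rC *: shift R N unit j.

Lemma model_DA N : spectrahedron A (model N).
Proof.
apply: ball_DA => j v; rewrite /model -scalemxAl.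
rewrite (predotZl cdotP) (predotZr cdotP) mulrA -normCK.
rewrite gtr0_norm ?ltcR //; apply: ler_wpM2l; first by rewrite exprn_ge0 // ler0c ltW.
by have := shift_contraction (N := N) (M := unit) j v.
Qed.

(** The component of G (model N) at the word a along the column of the empty
    word, divided by the scaling factor of a. *)
Definition coefN N (a : word) : 'M[C]_e :=
  \matrix_(i, k) (G (model N)
     (mxtens_index (i, enum_rank (insub_bseq N a, tt)))
     (mxtens_index (k, enum_rank (insub_bseq N [::], tt))) / rC ^+ size a).

Lemma wv_bseq N (a : N.-bseq 'I_g) : wv R N tt a = ev R (a, tt).
Proof. by rewrite /wv size_bseq /insub_bseq valKd. Qed.

Lemma model_vacuum N u : G (model N) *m vtens u (wv R N tt [::]) =
  \sum_(a : N.-bseq 'I_g) vtens (rC ^+ size a *: (coefN N a *m u)) (wv R N tt a).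
Proof.
apply: colP_mxtens => i q; rewrite mxE summxE sum_mxtens.
have -> : \sum_(a : N.-bseq 'I_g) vtens (rC ^+ size a *: (coefN N a *m u))
      (wv R N tt a) (mxtens_index (i, q)) 0 =
    rC ^+ size (enum_val q).1 * (coefN N (enum_val q).1 *m u) i 0.
  rewrite (bigD1 (enum_val q).1) //= [X in _ + X]big1 ?addr0 => [|a aq].
    rewrite vtensE wv_bseq.
    have -> : ev R ((enum_val q).1, tt) q 0 = 1.
      rewrite /ev mxE andbT.
      have -> : ((enum_val q).1, tt) = enum_val q by case: (enum_val q) => ? [].
      by rewrite enum_valK eqxx.
    by rewrite mulr1 [LHS]mxE.
  rewrite vtensE wv_bseq /ev [delta_mx _ _ _ _]mxE andbT.
  rewrite -[q in q == _]enum_valK (can_eq (@enum_rankK _)).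
  case: eqP; rewrite ?mulr0 // => ee.
  by rewrite ee eqxx in aq.
rewrite mxE mulr_sumr; apply: eq_bigr => k _.
rewrite (bigD1 (enum_rank (insub_bseq N [::], tt))) //= [X in _ + X]big1 ?addr0 => [|l lq].
  rewrite vtensE /wv /= /ev [delta_mx _ _ _ _]mxE eqxx mulr1 [coefN _ _ _ _]mxE.
  have -> : (insub_bseq N (enum_val q).1, tt) = enum_val q.
    by rewrite /insub_bseq valKd; case: (enum_val q) => ? [].
  by rewrite enum_valK mulrA; congr (_ * _); rewrite mulrC mulfVK // expf_neq0.
by rewrite vtensE /wv /= /ev [delta_mx _ _ _ _]mxE (negPf lq) mulr0 mulr0.
Qed.

Lemma wv_scale_model N (a : word) :
  wordmx (model N) a *m wv R N tt [::] = rC ^+ size a *: wv R N tt a.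
Proof. by rewrite /model wordmx_scale -scalemxAl wordmx_shift. Qed.

Lemma free_nilpotent_coefN N m (Z : 'I_g -> 'M[C]_m) u v :
  spectrahedron A Z -> (forall a : word, size a = N.+1 -> wordmx Z a *m v = 0) ->
  G Z *m vtens u v =
  \sum_(a : N.-bseq 'I_g) vtens (coefN N a *m u) (wordmx Z a *m v).
Proof.
move=> ZA Zv.
(* T intertwines model N with Z and takes the empty word to v. *)
pose T : 'M[C]_(m, #|{: N.-bseq 'I_g * unit}|) :=
  \sum_(a : N.-bseq 'I_g) rC ^- size a *: (wordmx Z a *m v *m (ev R (a, tt))^T).
have Tev (a : N.-bseq 'I_g) : T *m ev R (a, tt) = rC ^- size a *: (wordmx Z a *m v).
  rewrite mulmx_suml (bigD1 a) //= [X in _ + X]big1 ?addr0 => [|b ba].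
    by rewrite -scalemxAl -mulmxA ev_ortho eqxx mulmx1.
  rewrite -scalemxAl -mulmxA ev_ortho -pair_eqE /pair_eq /= (negPf ba).
  by rewrite -scalemx1 scale0r mulmx0 scaler0.
have Twv (a : word) : (size a <= N.+1)%N ->
    T *m wv R N tt a = rC ^- size a *: (wordmx Z a *m v).
  move=> aN; have [aN'|aN'] := leqP (size a) N.
    have e1 := insub_bseqK aN'.
    by rewrite /wv aN' Tev e1.
  by rewrite /wv leqNgt aN' mulmx0 Zv ?scaler0 //; apply/eqP; rewrite eqn_leq aN aN'.
have inter j : Z j *m T = T *m model N j.
  apply: mulmx_ev_ext => -[a []]; rewrite -!mulmxA Tev /model -scalemxAl -wv_bseq shift_wv.
  have sa := size_bseq a.
  rewrite -[in RHS]scalemxAr Twv //= wordmx_cons -scalemxAr -mulmxA scalerA exprS.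
  by rewrite invfM mulrA divff // mul1r.
have v0 : v = T *m wv R N tt [::].
  by rewrite Twv //= expr0 invr1 scale1r wordmx_nil mul1mx.
rewrite {1}v0 -[u in LHS]mul1mx -tensmx_vtens mulmxA (free_G ZA (@model_DA N) inter).
rewrite -mulmxA model_vacuum mulmx_sumr; apply: eq_bigr => a _.
rewrite tensmx_vtens mul1mx Twv ?leqW ?size_bseq //.
by rewrite vtensZl vtensZr scalerA divff ?scale1r // expf_neq0.
Qed.

Definition coef (a : word) : 'M[C]_e := coefN (size a) a.

Lemma wv_component N M (F : word -> 'cV[C]_e) (a : word) i :
  (size a <= N)%N -> (size a <= M)%N ->
  (\sum_(b : N.-bseq 'I_g) vtens (F b) (wv R M tt b))
    (mxtens_index (i, enum_rank (insub_bseq M a, tt))) 0 = F a i 0.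
Proof.
move=> aN aM; rewrite summxE (bigD1 (insub_bseq N a)) //= [X in _ + X]big1 ?addr0.
  by rewrite vtensE (insub_bseqK aN) /wv aM /ev mxE !eqxx mulr1.
move=> b ba; rewrite vtensE /wv; case: ifP => bM; last by rewrite mxE mulr0.
rewrite /ev mxE (can_eq (@enum_rankK _)) -pair_eqE /pair_eq /= andbT eqxx andbT.
rewrite -val_eqE /= (insub_bseqK aM) (insub_bseqK bM).
by rewrite -val_eqE /= (insub_bseqK aN) eq_sym in ba; rewrite (negPf ba) mulr0.
Qed.

(** Words of length N+1 vanish in model (size a), so that the formula for G on
    nilpotent tuples expresses G there through the coefN N. *)
Lemma coefN_stable N (a : word) : (size a <= N)%N -> coefN N a = coef a.
Proof.
move=> aN; set M := size a.
apply: mulmx_ext => u; apply/colP => i.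
have h : \sum_(b : N.-bseq 'I_g) vtens (rC ^+ size b *: (coefN N b *m u)) (wv R M tt b) =
         \sum_(b : M.-bseq 'I_g) vtens (rC ^+ size b *: (coefN M b *m u)) (wv R M tt b).
  rewrite -model_vacuum (@free_nilpotent_coefN N); last 2 first.
  - exact: model_DA.
  - by move=> b bN; rewrite wv_scale_model /wv bN leqNgt ltnS aN scaler0.
  by apply: eq_bigr => b _; rewrite wv_scale_model vtensZl vtensZr.
have /colP/(_ (mxtens_index (i, enum_rank (insub_bseq M a, tt)))) := h.
rewrite (@wv_component N M (fun b => rC ^+ size b *: (coefN N b *m u)) a i aN (leqnn _)).
rewrite (@wv_component M M (fun b => rC ^+ size b *: (coefN M b *m u)) a i (leqnn _) (leqnn _)).
have sc (c : C) (w : 'cV[C]_e) : (c *: w) i 0 = c * w i 0 by rewrite mxE.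
by rewrite !sc => /(mulfI (expf_neq0 _ rC_neq0)).
Qed.

(** The words in Z applied to v are the image of the creation matrices under an
    intertwiner, hence G acts on v through universal coefficients. *)
Theorem free_nilpotent N m (Z : 'I_g -> 'M[C]_m) u v :
  spectrahedron A Z -> (forall a : word, size a = N.+1 -> wordmx Z a *m v = 0) ->
  G Z *m vtens u v =
  \sum_(i < N.+1) \sum_(a : i.-tuple 'I_g) vtens (coef a *m u) (wordmx Z a *m v).
Proof.
move=> ZA Zv; rewrite (free_nilpotent_coefN u ZA Zv).
rewrite -(sum_bseq N (fun a => vtens (coef a *m u) (wordmx Z a *m v))).
by apply: eq_bigr => a _; rewrite coefN_stable ?size_bseq.
Qed.

Lemma coef_nil (G0 : forall n, G (fun=> 0 : 'M[C]_n) = 0) : coef [::] = 0.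
Proof.
apply/matrixP => i k; rewrite !mxE.
have -> : model 0 = (fun=> 0).
  apply/funext => j; apply/matrixP => p q; rewrite !mxE.
  case: eqP => [ee|_]; rewrite ?mulr0 //.
  by have := size_bseq (enum_val p).1; rewrite ee.
by rewrite G0 mxE mul0r.
Qed.

End FreeNilpotent.

(** * Convergence of the power series near the origin *)

Section PowerSeries.
Variables (R : realType) (g d e : nat).
Local Notation C := (Cplx R).
Local Notation word := (word g).
Variables (A : 'I_g -> 'M[C]_d) (G : graded_fun R g e) (r : R).
Hypothesis r_gt0 : 0 < r.
Hypothesis ball_DA : forall n (X : 'I_g -> 'M[C]_n),
  (forall j v, cdot (X j *m v) (X j *m v) <= (r%:C%C) ^+ 2 * cdot v v) ->
  spectrahedron A X.
Hypothesis free_G : free_function (spectrahedron A) G.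
Hypothesis G0 : forall n, G (fun=> 0 : 'M[C]_n) = 0.
Hypothesis psd_G : forall n (X : 'I_g -> 'M[C]_n),
  spectrahedron A X -> psd (1%:M + G X + (G X)^t* ).
Local Notation coef := (coef G r).

Section Level.
Variables (n : nat) (X : 'I_g -> 'M[C]_n) (k' : nat).
Hypothesis X_small : forall j v,
  cdot (X j *m v) (X j *m v) <= ((r / 3)%:C%C) ^+ 2 * cdot v v.
Let k := k'.+1.

(** J e_0 = 0, J e_i = 2 e_(i-1) for 0 < i < k, and J e_k = 2 e_(k-1) + e_k. Thus
    e_0, ..., e_(k-1) span a nilpotent part, fixvec is fixed by J and e_k is fixed
    by the adjoint of J. *)
Definition jordan : 'M[C]_k.+1 :=
  \matrix_(i, l) (if (l == i.+1 :> nat) then 2 else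
                  ((i == k :> nat) && (l == k :> nat))%:R).
Definition basis (i : nat) : 'cV[C]_k.+1 := \col_p (p == i :> nat)%:R.
Definition fixvec : 'cV[C]_k.+1 := \col_p 2 ^+ (k - p).
Definition dilation (j : 'I_g) : 'M[C]_(k.+1 * n) := tensmx jordan (X j).

(** The rows of jordan have at most one nonzero entry and its columns have squared
    norm at most 5, so that jordan has norm less than 3. *)
Lemma dilation_DA : spectrahedron A dilation.
Proof.
apply: ball_DA => j v; rewrite /dilation.
have -> : tensmx jordan (X j) = tensmx jordan 1%:M *m tensmx 1%:M (X j).
  by rewrite tensmx_mul mulmx1 mul1mx.
have h1 := cdot_tens1mx v (X_small j).
rewrite -mulmxA; set y := tensmx 1%:M (X j) *m v in h1 *.
have J0 (i l : 'I_k.+1) : jordan i l != 0 -> (l == i.+1 :> nat) || ((i == k :> nat) && (l == k :> nat)).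
  by rewrite mxE; case: ifP => [_ _|_] //=; rewrite pnatr_eq0 eqb0 negbK.
have h2 : cdot (tensmx jordan 1%:M *m y) (tensmx jordan 1%:M *m y) <= 9 * cdot y y.
  apply: cdot_row_monomial => [p q q'|q].
    rewrite -(mxtens_unindexK p) -(mxtens_unindexK q) -(mxtens_unindexK q').
    case: (mxtens_unindex p) => i a; case: (mxtens_unindex q) => l b.
    case: (mxtens_unindex q') => l' b'; rewrite !tensmxE !mxE.
    rewrite !mulf_eq0 !negb_or => /andP[h3 h4] /andP[h5 h6].
    have ab : a = b by apply/eqP; move: h4; case: (a == b) => //; rewrite eqxx.
    have ab' : a = b' by apply/eqP; move: h6; case: (a == b') => //; rewrite eqxx.
    congr (mxtens_index (_, _)); last by rewrite -ab -ab'.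
    have := J0 i l; rewrite mxE => /(_ h3) c1.
    have := J0 i l'; rewrite mxE => /(_ h5) c2.
    apply/val_inj => /=; have := ltn_ord l; have := ltn_ord l'.
    by move: c1 c2 => /orP[/eqP->|/andP[/eqP-> /eqP->]] /orP[/eqP->|/andP[/eqP e1 /eqP->]] //; rewrite ?e1 ltnn.
  rewrite -(mxtens_unindexK q); case: (mxtens_unindex q) => l b.
  rewrite sum_mxtens.
  have -> : \sum_i \sum_a `|tensmx jordan (1%:M : 'M[C]_n) (mxtens_index (i, a)) (mxtens_index (l, b))| ^+ 2
          = \sum_i `|jordan i l| ^+ 2.
    apply: eq_bigr => i _; rewrite (bigD1 b) //= big1 ?addr0 => [|a ab].
      by rewrite tensmxE [(1%:M : 'M[C]_n) b b]mxE eqxx mulr1.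
    by rewrite tensmxE [(1%:M : 'M[C]_n) a b]mxE (negPf ab) mulr0 normr0 expr0n.
  have b1 (i : 'I_k.+1) : `|jordan i l| ^+ 2 <= 4 * (i.+1 == l)%:R + (i == k :> nat)%:R.
    rewrite mxE [l == i.+1 :> nat]eq_sym; case: eqP => _.
      by rewrite normr_nat -natrX mulr1 lerDl ler0n.
    rewrite mulr0 add0r; case: eqP => _; case: eqP => _ /=; rewrite ?normr1 ?expr1n ?normr0 ?expr0n //.
  apply: le_trans (ler_sum _ (fun i _ => b1 i)) _.
  rewrite big_split /= -mulr_sumr.
  have s1 (P : pred nat) : (forall i j, P i -> P j -> i = j) ->
      \sum_(i < k.+1) (P i)%:R <= 1 :> C.
    move=> P1; apply: ler_sum_atmost1 => // [i0 j0|i0].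
      rewrite !pnatr_eq0 !eqb0 !negbK => Pi Pj; apply: val_inj; exact: P1.
    by case: (P i0); rewrite ?ler01.
  have a1 := s1 (fun i => i.+1 == l); have a2 := s1 (fun i => i == k).
  have -> : 9 = 4 * 1 + 1 + 4 :> C by ring.
  apply: le_trans (_ : _ <= 4 * 1 + 1) _; last by rewrite lerDl ler0n.
  apply: lerD; last by apply: a2 => i0 j0 /eqP -> /eqP.
  apply: ler_wpM2l; first by rewrite ler0n.
  by apply: a1 => i0 j0 /eqP <- /eqP[].
apply: le_trans h2 _; apply: le_trans (_ : 9 * (((r / 3)%:C%C) ^+ 2 * cdot v v) <= _).
  by rewrite ler_wpM2l ?ler0n.
rewrite mulrA; apply: ler_wpM2r; first exact: predot_ge0 cdotP _.
rewrite rmorphM /= fmorphV /= rmorph_nat exprMn exprVn.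
by have -> : 9 * (r%:C%C ^+ 2 / 3 ^+ 2) = r%:C%C ^+ 2 :> C by field.
Qed.

Lemma jordan_basis0 : jordan *m basis 0 = 0.
Proof.
apply/colP => p; rewrite !mxE (bigD1 ord0) //= big1 ?addr0 => [|l l0].
  by rewrite !mxE /= andbF mul0r.
rewrite [basis 0 _ _]mxE; case: eqP => [l0'|]; rewrite ?mulr0 //.
by move: l0; rewrite -val_eqE /= l0' eqxx.
Qed.

Lemma jordan_basisS i : (i.+1 < k)%N -> jordan *m basis i.+1 = 2 *: basis i.
Proof.
move=> ik; have ik1 : (i.+1 < k.+1)%N by rewrite ltnW.
apply/colP => p; rewrite !mxE (bigD1 (Ordinal ik1)) //= big1 ?addr0 => [|l li].
  rewrite !mxE /= eqxx mulr1 eqSS [p == i :> nat]eq_sym; case: eqP => [|_].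
    by rewrite mulr1.
  by rewrite mulr0 (ltn_eqF ik) andbF.
rewrite [basis i.+1 _ _]mxE; case: eqP => [li'|]; rewrite ?mulr0 //.
by move: li; rewrite -val_eqE /= li' eqxx.
Qed.

Lemma jordan_adj_basis : jordan^t* *m basis k = basis k.
Proof.
apply/colP => p; rewrite !mxE (bigD1 ord_max) //= big1 ?addr0 => [|l li].
  rewrite !mxE /= !eqxx mulr1 /=; case: eqP => [pk|_]; last by rewrite conjC_nat.
  by have := ltn_ord p; rewrite pk ltnn.
rewrite [basis k _ _]mxE; case: eqP => [li'|]; rewrite ?mulr0 //.
by move: li; rewrite -val_eqE /= li' eqxx.
Qed.

Lemma jordan_fixvec : jordan *m fixvec = fixvec.
Proof.
apply/colP => p; rewrite !mxE.
have := ltn_ord p; rewrite ltnS leq_eqVlt => /orP[/eqP pk|pk].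
  rewrite (bigD1 ord_max) //= big1 ?addr0 => [|l li].
    by rewrite !mxE /= pk !eqxx -[k == k.+1]/(k == k.+1) (ltn_eqF (ltnSn k)) /= mul1r.
  rewrite !mxE pk eqxx /=; case: eqP => [li'|_].
    by have := ltn_ord l; rewrite li' ltnn.
  case: eqP => [lk|_]; last by rewrite mul0r.
  by move: li; rewrite -val_eqE /= lk eqxx.
have pk1 : (p.+1 < k.+1)%N by [].
rewrite (bigD1 (Ordinal pk1)) //= big1 ?addr0 => [|l li].
  by rewrite !mxE /= eqxx -exprS -subSn // subSS.
rewrite !mxE (ltn_eqF pk) /=; case: eqP => [li'|_]; last by rewrite mul0r.
by move: li; rewrite -val_eqE /= li' eqxx.
Qed.

Lemma fixvecE : fixvec = \sum_(i < k) 2 ^+ (k - i) *: basis i + basis k.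
Proof.
apply/colP => p; rewrite !mxE summxE.
have := ltn_ord p; rewrite ltnS leq_eqVlt => /orP[/eqP pk|pk].
  rewrite pk eqxx subnn expr0 big1 ?add0r // => i _.
  by rewrite !mxE pk gtn_eqF ?mulr0 // ltn_ord.
rewrite (ltn_eqF pk) addr0 (bigD1 (Ordinal pk)) //= big1 ?addr0 => [|l li].
  by rewrite !mxE eqxx mulr1.
rewrite !mxE; case: eqP => [li'|_]; last by rewrite mulr0.
by move: li; rewrite -val_eqE /= li' eqxx.
Qed.

Lemma cdot_basis i j : (i <= k)%N -> cdot (basis i) (basis j) = (i == j)%:R.
Proof.
move=> ik; have ik1 : (i < k.+1)%N by [].
rewrite cdotE (bigD1 (Ordinal ik1)) //= big1 ?addr0 => [|l li].
  by rewrite !mxE eqxx mul1r conjC_nat.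
rewrite !mxE; case: eqP => [li'|_]; last by rewrite mul0r.
by move: li; rewrite -val_eqE /= li' eqxx.
Qed.

Lemma dilation_word (a : word) i w : (i < k)%N ->
  wordmx dilation a *m vtens (basis i) w =
  if (size a <= i)%N then 2 ^+ size a *: vtens (basis (i - size a)) (wordmx X a *m w)
  else 0.
Proof.
move=> ik; elim: a => [|j a IH].
  by rewrite !wordmx_nil !mul1mx /= expr0 scale1r subn0.
rewrite wordmx_cons -mulmxA IH /=; case: (ltnP (size a) i) => ai.
  rewrite (ltnW ai) -scalemxAr tensmx_vtens -[(i - size a)%N]prednK ?subn_gt0 //.
  rewrite jordan_basisS; last first.
    by rewrite prednK ?subn_gt0 // (leq_ltn_trans _ ik) // leq_subr.
  by rewrite vtensZl scalerA -exprSr subnS wordmx_cons mulmxA.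
have [ia|ia] := leqP (size a) i; last by rewrite mulmx0.
have -> : (i - size a)%N = 0%N by apply/eqP; rewrite subn_eq0.
by rewrite -scalemxAr tensmx_vtens jordan_basis0 vtens0l scaler0.
Qed.

Let L (s : 'cV[C]_k.+1) := tensmx (1%:M : 'M[C]_e) (vlift n s).
Let Ld (s : 'cV[C]_k.+1) := tensmx (1%:M : 'M[C]_e) ((vlift n s)^t* ).

Lemma tens1_adj s : Ld s = (L s)^t*.
Proof. by rewrite /L /Ld trmx_tens map_mxT trmx1 map_mx1. Qed.

Lemma tens1_adjM s s' : Ld s *m L s' = (cdot s' s)%:M.
Proof.
apply: mulmx_vtens_ext => u w; rewrite -mulmxA !tensmx_vtens !mul1mx vliftE vlift_adj.
by rewrite vtensZr mul_scalar_mx.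
Qed.

(** Below k the dilation is nilpotent, and the words that lead from basis i to
    basis 0 are exactly those of length i. *)
Lemma G_dilation_basis i (y : 'cV[C]_(e * n)) : (i < k)%N ->
  Ld (basis 0) *m (G dilation *m (L (basis i) *m y)) =
  2 ^+ i *: (mxfps_part coef X i *m y).
Proof.
move=> ik; rewrite !mulmxA scalemxAl; congr (_ *m y); apply: mulmx_vtens_ext => u w.
rewrite -!mulmxA tensmx_vtens mul1mx vliftE.
rewrite (@free_nilpotent _ _ _ _ _ _ _ r_gt0 ball_DA free_G i _ dilation u _ dilation_DA); last first.
  by move=> a ai; rewrite dilation_word // ai ltnn.
rewrite mulmx_sumr (bigD1 ord_max) //= [X in _ + X]big1 ?addr0 => [|l li].
  rewrite mulmx_sumr -scalemxAl mulmx_suml scaler_sumr; apply: eq_bigr => a _.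
  rewrite dilation_word // size_tuple leqnn subnn tensmx_vtens mul1mx.
  by rewrite -scalemxAr vlift_adj cdot_basis // eqxx scale1r vtensZr -tensmx_vtens.
rewrite mulmx_sumr big1 // => a _.
rewrite dilation_word // size_tuple -ltnS ltn_ord tensmx_vtens -scalemxAr vlift_adj.
rewrite cdot_basis; last by rewrite (leq_trans (leq_subr _ _)) // ltnW.
have -> : (i - l == 0)%N = false.
  apply/negbTE; rewrite subn_eq0 -ltnNge ltn_neqAle -[(l <= i)%N]ltnS ltn_ord andbT.
  by move: li; rewrite -val_eqE.
by rewrite scale0r scaler0 vtens0r.
Qed.

Lemma G_dilation_basis0 (y : 'cV[C]_(e * n)) : G dilation *m (L (basis 0) *m y) = 0.
Proof.
rewrite mulmxA; suff -> : G dilation *m L (basis 0) = 0 by rewrite mul0mx.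
apply: mulmx_vtens_ext => u w; rewrite -mulmxA tensmx_vtens mul1mx vliftE mul0mx.
rewrite (@free_nilpotent _ _ _ _ _ _ _ r_gt0 ball_DA free_G 0 _ dilation u _ dilation_DA); last first.
  by move=> a ai; rewrite dilation_word // ai.
rewrite big_ord_recl big_ord0 addr0 big1 // => a _.
by rewrite tuple0 /= (coef_nil r G0) mul0mx vtens0l.
Qed.

Lemma X_DA : spectrahedron A X.
Proof.
apply: ball_DA => j v; apply: le_trans (X_small j v) _.
apply: ler_wpM2r; first exact: predot_ge0 cdotP _.
rewrite -!rmorphXn lecR ler_pXn2r ?nnegrE ?divr_ge0 ?ltW //.
by rewrite ltr_pdivrMr // ltr_pMr // ltr1n.
Qed.

(** On fixvec the dilation acts as X, so that G (dilation) acts there as G X.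
    Expanding fixvec in the basis, the nilpotent part contributes the partial sum
    of the power series, and basis k the remainder. *)
Lemma remainder_eq :
  2 ^+ k *: (G X - series (mxfps_part coef X) k) =
  Ld (basis 0) *m G dilation *m L (basis k).
Proof.
have h1 : G dilation *m L fixvec = L fixvec *m G X.
  apply: free_G; [exact: dilation_DA|exact: X_DA|move=> j].
  by rewrite tensmx_vlift jordan_fixvec.
have Lfix : L fixvec = \sum_(i < k) 2 ^+ (k - i) *: L (basis i) + L (basis k).
  apply: mulmx_vtens_ext => u w; rewrite mulmxDl mulmx_suml !tensmx_vtens !mul1mx !vliftE.
  rewrite {1}fixvecE; have vDl a b : vtens (a + b) w = vtens a w + vtens b w by exact: vtensDl.
  rewrite vDl vtens_suml vtensDr vtens_sumr; congr (_ + _); apply: eq_bigr => i _.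
  by rewrite -scalemxAl tensmx_vtens mul1mx vliftE vtensZl vtensZr.
have h2 : Ld (basis 0) *m (L fixvec *m G X) = 2 ^+ k *: G X.
  rewrite mulmxA tens1_adjM mul_scalar_mx; congr (_ *: _).
  rewrite cdotE (bigD1 ord0) //= big1 ?addr0 => [|l /negPf l0].
    by rewrite !mxE subn0 conjC_nat mulr1.
  by rewrite !mxE -val_eqE /= in l0 *; rewrite l0 conjC0 mulr0.
apply: mulmx_ext => y; rewrite -!mulmxA -scalemxAl mulmxBl scalerBr.
have -> : 2 ^+ k *: (G X *m y) = Ld (basis 0) *m (G dilation *m (L fixvec *m y)).
  by rewrite scalemxAl -h2 -h1 !mulmxA.
have hS : \sum_(i < k) Ld (basis 0) *m (G dilation *m (2 ^+ (k - i) *: L (basis i) *m y)) =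
    2 ^+ k *: (series (mxfps_part coef X) k *m y).
  rewrite /series /= big_mkord mulmx_suml scaler_sumr; apply: eq_bigr => i _.
  rewrite -scalemxAl -!scalemxAr G_dilation_basis // scalerA -exprD subnK //.
  by rewrite ltnW.
by rewrite Lfix mulmxDl !mulmxDr mulmx_suml !mulmx_sumr addrC hS addKr.
Qed.

(** The remainder is an off-diagonal entry of I + G + G^* at the dilation; the
    diagonal entries at basis 0 and at basis k do not depend on k, since G0 and
    the vector fixed by the adjoint of jordan determine them. *)
Lemma remainder_le p q :
  `|(G X - series (mxfps_part coef X) k) p q| <=
  (2 ^+ k)^-1 * (1 + (1 + G X q q + (G X q q)^* )).
Proof.
pose H v w := cdot ((1%:M + G dilation + (G dilation)^t* ) *m v) w.
have HP : predot H.
  apply: predot_of_ge0 => [a x y z|a x y z|x]; rewrite /H.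
  - by rewrite linearP /= (predot_linear cdotP).
  - by rewrite (predotDr cdotP) (predotZr cdotP).
  - by have := psd_G dilation_DA x; rewrite /cdot mulmxA.
have HE v w : H v w = cdot v w + cdot (G dilation *m v) w + cdot v (G dilation *m w).
  rewrite /H !mulmxDl mul1mx !(predotDl cdotP); congr (_ + _).
  by rewrite cdot_adj trmxCK.
have cdotL s s' y z : cdot (L s *m y) (L s' *m z) = cdot s s' * cdot y z.
  rewrite [LHS]cdot_adj -[LHS]/(cdot y ((L s)^t* *m (L s' *m z))) -tens1_adj mulmxA.
  rewrite tens1_adjM mul_scalar_mx (predotZr cdotP).
  by rewrite -(predot_herm cdotP).
pose x := L (basis k) *m (delta_mx q 0 : 'cV[C]_(e * n)).
pose z := L (basis 0) *m (delta_mx p 0 : 'cV[C]_(e * n)).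
have Hxz : H x z = 2 ^+ k * (G X - series (mxfps_part coef X) k) p q.
  rewrite HE cdotL cdot_basis // mul0r add0r G_dilation_basis0.
  rewrite (predot0r cdotP) addr0.
  have -> : cdot (G dilation *m x) z =
      cdot (Ld (basis 0) *m G dilation *m L (basis k) *m delta_mx q 0) (delta_mx p 0).
    by rewrite /z -!mulmxA tens1_adj [RHS]cdot_adj trmxCK.
  by rewrite -remainder_eq cdot_delta -colE !mxE.
have Hzz : H z z = 1.
  rewrite HE !G_dilation_basis0 (predot0r cdotP) (predot0l cdotP).
  by rewrite !addr0 cdotL cdot_basis // mul1r cdot_delta mxE !eqxx.
have h3 : Ld (basis k) *m G dilation = G X *m Ld (basis k).
  apply/esym; apply: free_G; [exact: X_DA|exact: dilation_DA|move=> j].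
  by rewrite vlift_adj_tensmx jordan_adj_basis.
have cGx : cdot (G dilation *m x) x = G X q q.
  have -> : cdot (G dilation *m x) x =
     cdot (Ld (basis k) *m G dilation *m L (basis k) *m delta_mx q 0) (delta_mx q 0).
    by rewrite /x -!mulmxA tens1_adj [RHS]cdot_adj trmxCK.
  rewrite h3 -[_ *m Ld _ *m L _]mulmxA tens1_adjM cdot_basis // eqxx mulmx1.
  by rewrite cdot_delta -colE mxE.
have Hxx : H x x = 1 + G X q q + (G X q q)^*.
  rewrite HE cdotL cdot_basis // eqxx mul1r cdot_delta mxE !eqxx cGx.
  by rewrite (predot_herm cdotP) cGx.
have := predot_CauchySchwarz HP x z; rewrite Hzz mulr1 Hxz -Hxx.
have b0 := predot_ge0 HP x; set b := H x x in b0 *.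
rewrite normrM normrX normr_nat => h.
rewrite ler_pdivlMl ?exprn_gt0 // -(ler_pXn2r (ltn0Sn 1)) ?nnegrE ?mulr_ge0 ?addr_ge0 ?exprn_ge0 ?ler01 //.
apply: le_trans h _; have -> : (1 + b) ^+ 2 = b + (1 + b + b * b) by ring.
by rewrite lerDl !addr_ge0 ?ler01 ?mulr_ge0.
Qed.

End Level.

Theorem power_series_coef : power_series_near0 G coef.
Proof.
exists (r / 3) => [|n X hX]; first by rewrite divr_gt0.
apply: mx_cvg => p q.
apply: (@geometric_cvg R _ _ (1 + (1 + G X q q + (G X q q)^* ))) => k.
have := @remainder_le n X k _ p q; rewrite !mxE; apply.
by move=> j v; apply: cdot_opnorm; apply: ltW.
Qed.

End PowerSeries.

(** * Finite-dimensional realization up to a given degree *)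

Section Truncated.
Variables (R : realType) (g d e : nat).
Local Notation C := (Cplx R).
Local Notation word := (word g).
Variables (A : 'I_g -> 'M[C]_d) (G : graded_fun R g e) (r : R).
Hypothesis d_gt0 : (0 < d)%N.
Hypothesis bounded_DA : free_bounded (spectrahedron A).
Hypothesis r_gt0 : 0 < r.
Hypothesis ball_DA : forall n (X : 'I_g -> 'M[C]_n),
  (forall j v, cdot (X j *m v) (X j *m v) <= (r%:C%C) ^+ 2 * cdot v v) ->
  spectrahedron A X.
Hypothesis free_G : free_function (spectrahedron A) G.
Hypothesis G0 : forall n, G (fun=> 0 : 'M[C]_n) = 0.
Hypothesis psd_G : forall n (X : 'I_g -> 'M[C]_n),
  spectrahedron A X -> psd (1%:M + G X + (G X)^t* ).
Local Notation coef := (coef G r).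

Variable N : nat.
Let T : finType := {: N.-bseq 'I_g * 'I_e}.
Let m := #|T|.
Let F j : 'M[C]_m := shift R N 'I_e j.
Let wd (x : 'I_m) : word := val (enum_val x).1.
Let ix (x : 'I_m) : 'I_e := (enum_val x).2.

Let FE j x y : F j x y = ((wd x == j :: wd y) && (ix x == ix y))%:R.
Proof. by rewrite mxE. Qed.

(** K ((x, i), (y, l)) stands for the inner product of the block l of W_y with
    the block i of W_x, where an index x is a word with a vector of the canonical
    basis of C^e. This function and shift_part are the coefficients of W^* W and
    of W^* A W. *)
Definition gram_part (K : 'I_m * 'I_d -> 'I_m * 'I_d -> C) x y : C :=
  \sum_i K (x, i) (y, i).

Definition shift_part (K : 'I_m * 'I_d -> 'I_m * 'I_d -> C) x y : C :=
  \sum_j \sum_i \sum_l A j i l * \sum_y' F j y y' * K (x, i) (y', l).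

(** The coefficients of W^* L_A W. The two conjugations in the last term make it
    linear in K even if K is not Hermitian, as required by [kpsd_duality]. *)
Definition pencil_coef (xy : 'I_m * 'I_m) (K : 'I_m * 'I_d -> 'I_m * 'I_d -> C) : C :=
  gram_part K xy.1 xy.2 +
  (shift_part K xy.1 xy.2 + (shift_part (fun p q => (K q p)^*) xy.2 xy.1)^*).

(** The coefficients of I + G + G^*. *)
Definition target (xy : 'I_m * 'I_m) : C :=
  ((wd xy.1 == [::]) && (wd xy.2 == [::]) && (ix xy.1 == ix xy.2))%:R +
  ((wd xy.1 == [::])%:R * coef (wd xy.2) (ix xy.1) (ix xy.2) +
   ((wd xy.2 == [::])%:R * coef (wd xy.1) (ix xy.2) (ix xy.1))^*).

Lemma pencil_coef_linear xy a K L :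
  pencil_coef xy (a *: K + L) = a * pencil_coef xy K + pencil_coef xy L.
Proof.
have h p q : (a *: K + L) p q = a * K p q + L p q by [].
have g1 x y : gram_part (a *: K + L) x y = a * gram_part K x y + gram_part L x y.
  by rewrite mulr_sumr -big_split.
have s1 x y : shift_part (a *: K + L) x y = a * shift_part K x y + shift_part L x y.
  rewrite mulr_sumr -big_split; apply: eq_bigr => j _ /=.
  rewrite mulr_sumr -big_split; apply: eq_bigr => i _ /=.
  rewrite mulr_sumr -big_split; apply: eq_bigr => l _ /=.
  rewrite [in RHS]mulrCA -mulrDr; congr (_ * _).
  rewrite mulr_sumr -big_split; apply: eq_bigr => y' _ /=.
  by rewrite h; ring.
have s2 x y : shift_part (fun p q => ((a *: K + L) q p)^*) x y =
    a^* * shift_part (fun p q => (K q p)^*) x y + shift_part (fun p q => (L q p)^*) x y.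
  rewrite mulr_sumr -big_split; apply: eq_bigr => j _ /=.
  rewrite mulr_sumr -big_split; apply: eq_bigr => i _ /=.
  rewrite mulr_sumr -big_split; apply: eq_bigr => l _ /=.
  rewrite [in RHS]mulrCA -mulrDr; congr (_ * _).
  rewrite mulr_sumr -big_split; apply: eq_bigr => y' _ /=.
  by rewrite h rmorphD rmorphM /=; ring.
rewrite /pencil_coef g1 s1 s2 rmorphD rmorphM /= conjCK; ring.
Qed.

Lemma pencil_coef_psd xy K : kpsd K -> pencil_coef xy K =
  gram_part K xy.1 xy.2 + (shift_part K xy.1 xy.2 + (shift_part K xy.2 xy.1)^*).
Proof.
move=> K0; rewrite /pencil_coef; congr (_ + (_ + (shift_part _ _ _)^*)).
by apply/funext => p; apply/funext => q; rewrite -(kpsd_herm _ _ K0).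
Qed.

Lemma pencil_coef_herm x y K : kpsd K ->
  pencil_coef (y, x) K = (pencil_coef (x, y) K)^*.
Proof.
move=> K0; rewrite !pencil_coef_psd //= !rmorphD /= conjCK [_^* + shift_part _ _ _]addrC.
by congr (_ + _); rewrite rmorph_sum; apply: eq_bigr => i _; rewrite (kpsd_herm _ _ K0).
Qed.

Lemma target_herm x y : target (y, x) = (target (x, y))^*.
Proof.
rewrite /target /= !rmorphD /= conjCK [_^* + _ * _]addrC conjC_nat.
by rewrite [(wd y == _) && _]andbC [ix y == _]eq_sym.
Qed.

(** Induction on the length of the word of x: the block of K at x is the sum of
    pencil_coef (x, x) and of cross terms with shorter words, and a small weight
    tau leaves of the cross terms at most half of the block itself. *)
Lemma pencil_coef_coercive (c : C) : exists b : C, forall K, kpsd K ->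
  (forall xy, `|pencil_coef xy K| <= c) -> forall p, K p p <= b.
Proof.
have [c0|c0] := boolP (0 <= c); last first.
  exists 0 => K K0 h [x i]; have := h (x, x) => h'.
  by move/negP: c0; case; apply: le_trans h'.
pose S := \sum_j \sum_i \sum_l `|A j i l|.
have S0 : 0 <= S by do 3!apply: sumr_ge0 => ? _.
pose tau := (2 * (S + 1))^-1.
have t0 : 0 < tau by rewrite invr_gt0 mulr_gt0 // ltr_wpDl.
have St : S * tau *+ 2 <= 1.
  by rewrite -mulrnAl -mulr_natl ler_pdivrMr ?mul1r ?ler_wpM2l ?lerDl // mulr_gt0 // ltr_wpDl.
have D0 K x : kpsd K -> 0 <= gram_part K x x.
  by move=> K0; apply: sumr_ge0 => i _; exact: kpsd_diag_ge0.
suff key n : exists2 b : C, 0 <= b & forall K, kpsd K ->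
    (forall xy, `|pencil_coef xy K| <= c) ->
    forall x, (size (wd x) <= n)%N -> gram_part K x x <= b.
  have [b b0 hb] := key N; exists b => K K0 h [x i].
  apply: le_trans (hb K K0 h x (size_bseq _)).
  by rewrite /gram_part (bigD1 i) //= lerDl; apply: sumr_ge0 => l _; exact: kpsd_diag_ge0.
elim: n => [|n [b b0 IH]].
  exists c => // K K0 h x; rewrite leqn0 size_eq0 => /eqP x0.
  have s0 : shift_part K x x = 0.
    rewrite /shift_part big1 // => j _; rewrite big1 // => i _; rewrite big1 // => l _.
    by rewrite big1 ?mulr0 // => y' _; rewrite FE x0 mul0r.
  have := h (x, x); rewrite pencil_coef_psd //= s0 conjC0 !addr0 ger0_norm //.
  exact: D0.
exists (b + (c + (S * tau^-1) * b) *+ 2) => [|K K0 h x xn].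
  by rewrite addr_ge0 // mulrn_wge0 // addr_ge0 // !mulr_ge0 // invr_ge0 ltW.
have [xn'|xn'] := leqP (size (wd x)) n.
  apply: le_trans (IH K K0 h x xn') _.
  by rewrite lerDl mulrn_wge0 // addr_ge0 // !mulr_ge0 // invr_ge0 ltW.
set D := gram_part K x x.
have Kle i y l : `|K (x, i) (y, l)| *+ 2 <= tau * D + tau^-1 * gram_part K y y.
  apply: le_trans (kpsd_entry_le _ _ K0 t0) _.
  have hh z k : K (z, k) (z, k) <= gram_part K z z.
    rewrite /gram_part (bigD1 k) //= lerDl; apply: sumr_ge0 => k' _; exact: kpsd_diag_ge0.
  have t2 : 0 <= tau^-1 by rewrite invr_ge0 (ltW t0).
  by apply: lerD; [apply: (ler_wpM2l (ltW t0))|apply: (ler_wpM2l t2)]; exact: hh.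
have sle : `|shift_part K x x| *+ 2 <= S * (tau * D + tau^-1 * b).
  rewrite -mulr_natr /S /shift_part !mulr_suml.
  have ns (I : finType) (f f' : I -> C) (z : C) : (forall k, `|f k| * 2 <= f' k * z) ->
      `|\sum_k f k| * 2 <= \sum_k f' k * z.
    move=> hf; apply: le_trans (_ : (\sum_k `|f k|) * 2 <= _).
      by rewrite ler_wpM2r ?ler0n // ler_norm_sum.
    by rewrite mulr_suml; apply: ler_sum => k _.
  refine (ns _ _ (fun j => \sum_i \sum_l `|A j i l|) _ _) => j; rewrite mulr_suml.
  refine (ns _ _ (fun i => \sum_l `|A j i l|) _ _) => i; rewrite mulr_suml.
  refine (ns _ _ (fun l => `|A j i l|) _ _) => l.
  rewrite normrM -mulrA; apply: ler_wpM2l => //.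
  set z := tau * D + tau^-1 * b.
  have z0 : 0 <= z.
    have t2 : 0 <= tau^-1 by rewrite invr_ge0 (ltW t0).
    by apply: addr_ge0; apply: mulr_ge0 => //; [exact: ltW|exact: D0].
  apply: le_trans (_ : \sum_y' F j x y' * z <= _).
    apply: le_trans (_ : (\sum_y' `|F j x y' * K (x, i) (y', l)|) * 2 <= _).
      by rewrite ler_wpM2r ?ler0n // ler_norm_sum.
    rewrite mulr_suml; apply: ler_sum => y' _.
    rewrite normrM FE normr_nat -mulrA.
    case: andP => [[/eqP ex _]|_]; last by rewrite !mul0r.
    rewrite !mul1r mulr_natr; apply: le_trans (Kle _ _ _) _; rewrite lerD2l.
    apply: ler_wpM2l; first by rewrite invr_ge0 ltW.
    by apply: IH => //; move: xn; rewrite ex.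
  rewrite -mulr_suml -[leRHS]mul1r ler_wpM2r //.
  apply: ler_sum_atmost1 => [|y y'|y']; first exact: ler01.
    rewrite !FE !pnatr_eq0 !eqb0 !negbK => /andP[/eqP e1 /eqP e2] /andP[/eqP e3 /eqP e4].
    apply: enum_val_inj; rewrite (surjective_pairing (enum_val y)) (surjective_pairing (enum_val y')).
    congr pair; last by rewrite -[(enum_val y).2]e2 e4.
    by apply: val_inj; move: e3; rewrite e1 => -[].
  by rewrite FE; case: (_ && _); rewrite ?ler01.
have DD := D0 _ x K0; rewrite -/D in DD.
have Dle : D <= c + `|shift_part K x x| *+ 2.
  have e1 : D = pencil_coef (x, x) K - (shift_part K x x + (shift_part K x x)^*).
    by rewrite pencil_coef_psd //= addrK.
  rewrite -(ger0_norm DD) e1; apply: le_trans (ler_normB _ _) _.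
  apply: lerD => //; apply: le_trans (ler_normD _ _) _.
  by rewrite norm_conjC -mulr2n.
have D2 : D <= c + S * (tau * D + tau^-1 * b).
  by apply: le_trans Dle _; rewrite lerD2l.
apply: le_trans (_ : (c + S * tau^-1 * b) *+ 2 <= _); last by rewrite lerDr.
have D3 : D *+ 2 <= (c + S * tau^-1 * b) *+ 2 + D.
  apply: le_trans (_ : (c + S * (tau * D + tau^-1 * b)) *+ 2 <= _).
    by rewrite lerMn2r D2 orbT.
  have -> : (c + S * (tau * D + tau^-1 * b)) *+ 2 =
            (c + S * tau^-1 * b) *+ 2 + (S * tau *+ 2) * D by ring.
  by rewrite lerD2l -[leRHS]mul1r ler_wpM2r.
by move: D3; rewrite mulr2n lerD2r.
Qed.

(** The kernels on which M is evaluated. A density matrix P that annihilates the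
    A_j, with all h equal, gives the positivity of M; P with all entries 1 gives
    the positivity of L_A at the creation matrices with respect to the form M. *)
Lemma pairing_pencil_coef (M : 'M[C]_m) (P : 'I_d -> 'I_d -> C) (h : 'I_d -> 'cV[C]_m) :
  (forall x y, M x y = (M y x)^*) -> kpsd P ->
  let K := fun p q : 'I_m * 'I_d => P p.2 q.2 * ((h p.2 p.1 0)^* * h q.2 q.1 0) in
  let S := \sum_j \sum_i \sum_l A j i l * (P i l * cdot (M *m (F j *m h l)) (h i)) in
  kpsd K /\
  \sum_xy M xy.1 xy.2 * pencil_coef xy K =
    \sum_i P i i * cdot (M *m h i) (h i) + (S + S^*).
Proof.
move=> Mh P0 K S.
have cM (p q : 'cV[C]_m) : cdot (M *m q) p = \sum_x \sum_y M x y * ((p x 0)^* * q y 0).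
  rewrite cdotE; apply: eq_bigr => x _; rewrite mxE mulr_suml; apply: eq_bigr => y _.
  by ring.
have K0 : kpsd K.
  move=> v; have := P0 (fun i => \sum_x h i x 0 * v (x, i)).
  suff -> : kform K v v = kform P (fun i => \sum_x h i x 0 * v (x, i))
                                  (fun i => \sum_x h i x 0 * v (x, i)) by [].
  rewrite /kform.
  transitivity (\sum_i \sum_x \sum_l \sum_y (v (x, i))^* * K (x, i) (y, l) * v (y, l)).
    have sumP (f : 'I_m * 'I_d -> C) : \sum_p f p = \sum_x \sum_i f (x, i).
      by rewrite pair_big; apply: eq_bigr => -[].
    rewrite sumP exchange_big; apply: eq_bigr => i _; apply: eq_bigr => x _.
    by rewrite sumP exchange_big.
  apply: eq_bigr => i _; rewrite exchange_big; apply: eq_bigr => l _.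
  rewrite rmorph_sum !mulr_suml; apply: eq_bigr => x _.
  rewrite mulr_sumr; apply: eq_bigr => y _.
  by rewrite /K /= rmorphM /=; ring.
split=> //.
have pairE (f : 'I_m -> 'I_m -> C) : \sum_xy f xy.1 xy.2 = \sum_x \sum_y f x y.
  by rewrite pair_big.
have sS : \sum_x \sum_y M x y * shift_part K x y = S.
  rewrite /S /shift_part.
  transitivity (\sum_j \sum_i \sum_l \sum_x \sum_y M x y * (A j i l * \sum_y' F j y y' * K (x, i) (y', l))).
    under eq_bigr => x _ do under eq_bigr => y _ do rewrite mulr_sumr.
    under eq_bigr => x _ do rewrite exchange_big.
    rewrite exchange_big; apply: eq_bigr => j _ /=.
    under eq_bigr => x _ do under eq_bigr => y _ do rewrite mulr_sumr.
    under eq_bigr => x _ do rewrite exchange_big.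
    rewrite exchange_big; apply: eq_bigr => i _ /=.
    under eq_bigr => x _ do under eq_bigr => y _ do rewrite mulr_sumr.
    under eq_bigr => x _ do rewrite exchange_big.
    by rewrite exchange_big.
  apply: eq_bigr => j _; apply: eq_bigr => i _; apply: eq_bigr => l _.
  rewrite cM !mulr_sumr; apply: eq_bigr => x _; rewrite !mulr_sumr; apply: eq_bigr => y _.
  rewrite mxE !mulr_sumr; apply: eq_bigr => y' _.
  by rewrite /K /=; ring.
transitivity (\sum_x \sum_y M x y * gram_part K x y +
   (\sum_x \sum_y M x y * shift_part K x y + \sum_x \sum_y M x y * (shift_part K y x)^*)).
  rewrite -!big_split /=.
  under eq_bigr => xy _ do rewrite pencil_coef_psd //.
  rewrite (pairE (fun x y => M x y * (gram_part K x y + (shift_part K x y + (shift_part K y x)^*)))).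
  apply: eq_bigr => x _; rewrite -!big_split; apply: eq_bigr => y _ /=.
  by rewrite !mulrDr.
congr (_ + (_ + _)).
- under [RHS]eq_bigr => i _ do rewrite cM mulr_sumr.
  rewrite [RHS]exchange_big; apply: eq_bigr => x _.
  under [RHS]eq_bigr => i _ do rewrite mulr_sumr.
  rewrite [RHS]exchange_big; apply: eq_bigr => y _ /=.
  by rewrite mulr_sumr; apply: eq_bigr => i _; rewrite /K /=; ring.
- exact: sS.
rewrite -sS rmorph_sum exchange_big; apply: eq_bigr => y _.
rewrite rmorph_sum; apply: eq_bigr => x _.
by rewrite rmorphM /= -Mh.
Qed.

(** Conjugation by Dg turns F_j into r F_j, which is in D_A. The form Dg^2 is
    thus a positive definite M to which [posdef_pairing_ge0] applies, and adding
    multiples of it keeps the hypotheses of that lemma. *)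
Let Dg : 'M[C]_m := diag_mx (\row_x (r%:C%C : C) ^+ size (wd x)).

Let Dg_adj : Dg^t* = Dg.
Proof.
rewrite tr_diag_mx map_diag_mx; congr diag_mx; apply/rowP => x.
by rewrite !mxE rmorphXn /= (_ : _^* = r%:C%C) //; apply/CrealP; rewrite gtr0_real // ltcR.
Qed.

Let Dg_shift j : Dg *m F j = (r%:C%C : C) *: (F j *m Dg).
Proof.
apply/matrixP => x y; rewrite mul_diag_mx mul_mx_diag !mxE.
case: andP => [[/eqP ex _]|_]; last by rewrite !(mulr0, mul0r).
by rewrite /wd ex /= exprS mul1r mulr1.
Qed.

Let F_DA : spectrahedron A (fun j => (r%:C%C : C) *: F j).
Proof.
apply: ball_DA => j v; rewrite -scalemxAl.
rewrite (predotZl cdotP) (predotZr cdotP) mulrA -normCK.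
rewrite gtr0_norm ?ltcR //; apply: ler_wpM2l; first by rewrite exprn_ge0 // ler0c ltW.
exact: shift_contraction.
Qed.

(** Write M = B^* B. The last hypothesis says that Y_j = B F_j B^-1 is in D_A; as
    Y is nilpotent, G(Y) is known on the vectors B u with u at the empty word,
    and the pairing is the value of I + G(Y) + G(Y)^* at the sum z of
    e_u (x) B u. *)
Lemma posdef_pairing_ge0 (M : 'M[C]_m) : psd M -> M \in unitmx ->
  (forall h : 'I_d -> 'cV[C]_m,
     let S := \sum_j \sum_i \sum_l A j i l * cdot (M *m (F j *m h l)) (h i) in
     0 <= \sum_i cdot (M *m h i) (h i) + (S + S^*)) ->
  0 <= \sum_xy M xy.1 xy.2 * target xy.
Proof.
move=> M0 Mu Mpos; have [B MB] := psd_factor M0.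
have Bu : B \in unitmx by move: Mu; rewrite MB unitmx_mul => /andP[].
have cB u v : cdot (B *m u) (B *m v) = cdot (M *m u) v.
  by rewrite [RHS]/cdot MB mulmxA /cdot trmx_mul map_mxM !mulmxA.
pose Y j := B *m F j *m invmx B.
have YB j (v : 'cV[C]_m) : Y j *m (B *m v) = B *m (F j *m v).
  by rewrite /Y -!mulmxA (mulKmx Bu).
have Y_DA : spectrahedron A Y.
  apply/spectrahedronP => w; have := Mpos (fun i => invmx B *m w i).
  have wB i : w i = B *m (invmx B *m w i) by rewrite mulKVmx.
  have -> : pencil_form A Y w = \sum_j \sum_i \sum_l
      A j i l * cdot (M *m (F j *m (invmx B *m w l))) (invmx B *m w i).
    apply: eq_bigr => j _; apply: eq_bigr => i _; apply: eq_bigr => l _.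
    by rewrite {1}[w l]wB {1}[w i]wB YB cB.
  have -> // : \sum_i cdot (w i) (w i) = \sum_i cdot (M *m (invmx B *m w i)) (invmx B *m w i).
  by apply: eq_bigr => i _; rewrite {1 2}[w i]wB cB.
have Yword (a : word) (v : 'cV[C]_m) : wordmx Y a *m (B *m v) = B *m (wordmx F a *m v).
  elim: a v => [|j a IH] v; first by rewrite !wordmx_nil !mul1mx.
  by rewrite !wordmx_cons -(mulmxA (Y j)) IH YB (mulmxA (F j)).
pose vac u := B *m wv R N u [::].
have Yvac (a : word) u : wordmx Y a *m vac u = B *m wv R N u a.
  by rewrite Yword wordmx_shift.
pose z : 'cV[C]_(e * m) := \sum_u vtens (delta_mx u 0) (vac u).
have Gz : G Y *m z = \sum_u \sum_(a : N.-bseq 'I_g)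
    vtens (coef a *m delta_mx u 0) (B *m wv R N u a).
  rewrite mulmx_sumr; apply: eq_bigr => u _.
  rewrite (@free_nilpotent _ _ _ _ _ _ _ r_gt0 ball_DA free_G N _ Y _ _ Y_DA); last first.
    by move=> a aN; rewrite Yvac /wv aN ltnn mulmx0.
  rewrite -(sum_bseq N (fun a => vtens (coef a *m delta_mx u 0) (wordmx Y a *m vac u))).
  by apply: eq_bigr => a _; rewrite Yvac.
pose rx (a : N.-bseq 'I_g) (u : 'I_e) : 'I_m := enum_rank (a, u).
have wvE (a : N.-bseq 'I_g) u : wv R N u a = delta_mx (rx a u) 0.
  by rewrite /wv size_bseq /insub_bseq valKd.
pose nl : N.-bseq 'I_g := [bseq].
have vacE u : vac u = B *m delta_mx (rx nl u) 0 by rewrite /vac -wvE.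
have Mdelta x y : cdot (M *m delta_mx y 0) (delta_mx x 0) = M x y.
  by rewrite cdot_delta -colE mxE.
have sumT (f : 'I_m -> C) : \sum_x f x = \sum_u \sum_a f (rx a u).
  rewrite exchange_big pair_big /= (reindex _ (onW_bij _ (enum_rank_bij T))) /=.
  by apply: eq_bigr => -[a u].
have zz : cdot z z = \sum_u M (rx nl u) (rx nl u).
  rewrite /z (predot_suml cdotP); apply: eq_bigr => u _.
  rewrite (predot_sumr cdotP) (bigD1 u) //= big1 ?addr0 => [|u' u'u].
    by rewrite cdot_vtens cdot_delta mxE !eqxx mul1r !vacE cB Mdelta.
  by rewrite cdot_vtens cdot_delta mxE (negPf u'u) mul0r.
have Gzz : cdot (G Y *m z) z = \sum_u' \sum_u \sum_(a : N.-bseq 'I_g)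
    M (rx nl u') (rx a u) * coef a u' u.
  rewrite /z (predot_sumr cdotP); apply: eq_bigr => u' _.
  rewrite Gz (predot_suml cdotP); apply: eq_bigr => u _.
  rewrite (predot_suml cdotP); apply: eq_bigr => a _.
  by rewrite cdot_vtens cdot_delta wvE vacE cB Mdelta -colE mxE mulrC.
have Mh x y : M x y = (M y x)^*.
  have := @kpsd_herm R _ (fun i j => M i j); apply.
  move=> v; have := M0 (\col_i v i); rewrite cform_col.
  by congr (0 <= kform _ _ _); apply/funext => i; rewrite mxE.
have wdrx a u : wd (rx a u) = a by rewrite /wd enum_rankK.
have ixrx a u : ix (rx a u) = u by rewrite /ix enum_rankK.
have nlE (a : N.-bseq 'I_g) : (val a == [::]) = (a == nl) by [].
have tsum : \sum_xy M xy.1 xy.2 * target xy =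
    cdot z z + (cdot (G Y *m z) z + (cdot (G Y *m z) z)^*).
  have pairE (f : 'I_m -> 'I_m -> C) : \sum_xy f xy.1 xy.2 = \sum_x \sum_y f x y.
    by rewrite pair_big.
  pose t1 x y : C := ((wd x == [::]) && (wd y == [::]) && (ix x == ix y))%:R.
  pose t2 x y : C := (wd x == [::])%:R * coef (wd y) (ix x) (ix y).
  have nlsum (f : 'I_m -> C) : \sum_x (wd x == [::])%:R * f x = \sum_u f (rx nl u).
    rewrite sumT; apply: eq_bigr => u _; rewrite (bigD1 nl) //= big1 ?addr0 => [|a an].
      by rewrite wdrx eqxx mul1r.
    by rewrite wdrx nlE (negPf an) mul0r.
  have s1 : \sum_x \sum_y M x y * t1 x y = cdot z z.
    rewrite zz -(nlsum (fun x => M x x)); apply: eq_bigr => x _.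
    rewrite (bigD1 x) //= big1 ?addr0 => [|y yx].
      by rewrite /t1 !eqxx andbT andbb mulrC.
    rewrite /t1; case: andP => [[/andP[/eqP ex /eqP ey] /eqP ei]|_]; last by rewrite mulr0.
    suff yx' : y = x by rewrite yx' eqxx in yx.
    apply: enum_val_inj; rewrite (surjective_pairing (enum_val x)) (surjective_pairing (enum_val y)).
    by congr pair; [apply: val_inj; rewrite -[LHS]/(wd y) -[RHS]/(wd x) ex ey|rewrite -[LHS]/(ix y) -ei].
  have s2 : \sum_x \sum_y M x y * t2 x y = cdot (G Y *m z) z.
    transitivity (\sum_x (wd x == [::])%:R * \sum_y M x y * coef (wd y) (ix x) (ix y)).
      apply: eq_bigr => x _; rewrite mulr_sumr; apply: eq_bigr => y _.
      by rewrite mulrCA.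
    rewrite nlsum Gzz; apply: eq_bigr => u' _; rewrite sumT; apply: eq_bigr => u _.
    by apply: eq_bigr => a _; rewrite wdrx !ixrx.
  have s3 : \sum_x \sum_y M x y * (t2 y x)^* = (cdot (G Y *m z) z)^*.
    rewrite -s2 rmorph_sum exchange_big; apply: eq_bigr => y _.
    by rewrite rmorph_sum; apply: eq_bigr => x _; rewrite rmorphM /= -Mh.
  rewrite -s3 -s2 -s1 (pairE (fun x y => M x y * target (x, y))) -!big_split /=.
  apply: eq_bigr => x _; rewrite -!big_split; apply: eq_bigr => y _ /=.
  by rewrite -!mulrDr.
rewrite tsum; have := psd_G Y_DA z; suff -> : (z^t* *m (1%:M + G Y + (G Y)^t* ) *m z) 0 0 =
  cdot z z + (cdot (G Y *m z) z + (cdot (G Y *m z) z)^*) by [].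
rewrite -mulmxA !mulmxDl mul1mx -[LHS]/(cdot _ z) !(predotDl cdotP) -addrA.
congr (_ + (_ + _)); rewrite [LHS]cdot_adj trmxCK.
exact: predot_herm cdotP _ _.
Qed.

(** Otherwise duality provides a Hermitian M that is nonnegative on all the
    W^* L_A W but negative on target. Kernels made from the density matrix of
    [trace_zero_density] show that M is positive semidefinite; M + s Dg^2 is
    positive definite, so the previous lemma applies to it, and s tends to 0. *)
Lemma gram_kernel_exists :
  exists2 K, kpsd K & forall xy, pencil_coef xy K = target xy.
Proof.
have [//|[lam [lam0 lamt]]] := kpsd_duality target pencil_coef_linear pencil_coef_coercive.
exfalso.
pose M : 'M[C]_m := \matrix_(x, y) (lam (x, y) + (lam (y, x))^*).
have Mh x y : M x y = (M y x)^* by rewrite !mxE rmorphD /= conjCK addrC.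
have Msum (f : 'I_m * 'I_m -> C) : (forall x y, f (y, x) = (f (x, y))^*) ->
    \sum_xy M xy.1 xy.2 * f xy = \sum_xy lam xy * f xy + (\sum_xy lam xy * f xy)^*.
  move=> fh; have -> : (\sum_xy lam xy * f xy)^* = \sum_xy (lam (xy.2, xy.1))^* * f xy.
    rewrite rmorph_sum (reindex_inj (h := fun xy => (xy.2, xy.1))) /=; last first.
      by move=> [x y] [x' y'] [-> ->].
    by apply: eq_bigr => -[x y] _; rewrite rmorphM /= [in RHS]fh.
  by rewrite -big_split; apply: eq_bigr => -[x y] _ /=; rewrite mxE mulrDl.
have Mpos K : kpsd K -> 0 <= \sum_xy M xy.1 xy.2 * pencil_coef xy K.
  by move=> K0; rewrite Msum ?lam0 // => x y; exact: pencil_coef_herm.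
have Mt : \sum_xy M xy.1 xy.2 * target xy < 0.
  by rewrite Msum // => x y; exact: target_herm.
have [P [P0 P1 PA]] := trace_zero_density d_gt0 bounded_DA.
have Mpsd q : 0 <= cdot (M *m q) q.
  have [K0 e1] := pairing_pencil_coef (fun=> q) Mh P0.
  have := Mpos _ K0; rewrite e1 -mulr_suml P1 mul1r.
  rewrite (_ : \sum_j _ = 0) ?conjC0 ?addr0 // big1 // => j _.
  transitivity (\sum_i \sum_l A j i l * P i l * cdot (M *m (F j *m q)) q).
    by apply: eq_bigr => i _; apply: eq_bigr => l _; rewrite mulrA.
  under eq_bigr => i _ do rewrite -mulr_suml.
  by rewrite -mulr_suml PA mul0r.
pose L0 := Dg *m Dg.
have cL0 u v : cdot (L0 *m u) v = cdot (Dg *m u) (Dg *m v).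
  by rewrite /L0 -mulmxA cdot_adj Dg_adj.
have Dg_unit : Dg \in unitmx.
  rewrite unitmxE det_diag unitfE; apply/prodf_neq0 => x _.
  by rewrite mxE expf_neq0 // gt_eqF // ltcR.
suff : 0 <= \sum_xy M xy.1 xy.2 * target xy by move=> /(lt_le_trans Mt); rewrite ltxx.
have tr : \sum_xy M xy.1 xy.2 * target xy \is Num.real.
  by rewrite ltr0_real.
apply: (@ge0_of_perturb _ _ (\sum_xy L0 xy.1 xy.2 * target xy) tr).
  apply: sumr_ge0 => -[x y] _ /=; rewrite /L0 mul_diag_mx !mxE.
  case: eqP => [<-|_]; last by rewrite mulr0n mulr0 mul0r.
  apply: mulr_ge0; first by rewrite mulr1n -expr2 !exprn_ge0 // ler0c ltW.
  rewrite /target /=.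
  case: (wd x =P [::]) => [->|_] /=; last by rewrite !mul0r conjC0 !addr0.
  by rewrite (coef_nil r G0) !mxE !mulr0 conjC0 !addr0 ler0n.
move=> s s0 _; have [M' M'E] : exists M', M' = M + s *: L0 by exists (M + s *: L0).
have -> : \sum_xy M xy.1 xy.2 * target xy + s * (\sum_xy L0 xy.1 xy.2 * target xy) =
    \sum_xy M' xy.1 xy.2 * target xy.
  rewrite mulr_sumr -big_split; apply: eq_bigr => xy _ /=.
  by rewrite M'E [X in _ = X * _]mxE [(s *: L0) _ _]mxE; ring.
have cM' u v : cdot (M' *m u) v = cdot (M *m u) v + s * cdot (Dg *m u) (Dg *m v).
  by rewrite M'E mulmxDl (predotDl cdotP) -scalemxAl (predotZl cdotP) cL0.
have D0 u : 0 <= s * cdot (Dg *m u) (Dg *m u).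
  by apply: mulr_ge0; [exact: ltW|exact: predot_ge0 cdotP _].
apply: posdef_pairing_ge0.
- move=> v; rewrite -mulmxA -[X in 0 <= X]/(cdot (M' *m v) v) cM' addr_ge0 //.
- rewrite -row_free_unit -kermx_eq0; apply/eqP/row_matrixP => i; rewrite row0.
  set w := row i _; have wM : w *m M' = 0 by apply/sub_kermxP; exact: row_sub.
  have M'h : M'^t* = M'.
    have L0h x y : (L0 x y)^* = L0 y x.
      have : L0^t* = L0 by rewrite /L0 trmx_mul map_mxM Dg_adj.
      by move=> /matrixP/(_ y x); rewrite !mxE.
    apply/matrixP => x y; rewrite M'E [LHS]mxE [X in X^*]mxE.
    rewrite [X in X^*]mxE rmorphD /= -Mh [RHS]mxE; congr (_ + _).
    rewrite [(s *: L0) y x]mxE [(s *: L0) x y]mxE rmorphM /= L0h; congr (_ * _).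
    by apply/CrealP; rewrite gtr0_real.
  have Mw : M' *m w^t* = 0 by rewrite -M'h -map_mxM -trmx_mul wM trmx0 map_mx0.
  have : cdot (M' *m w^t* ) (w^t* ) = 0 by rewrite Mw (predot0l cdotP).
  rewrite cM' => /eqP; rewrite paddr_eq0 // => /andP[_].
  rewrite mulf_eq0 gt_eqF //= => /eqP/cdot_eq0 Dw.
  have : w^t* = 0 by rewrite -(mulKmx Dg_unit (w^t* )) Dw mulmx0.
  by move/(congr1 (fun X => X^t* )); rewrite trmxCK trmx0 map_mx0.
move=> h; cbv zeta; set S := \sum_(j < g) _.
pose S1 := \sum_j \sum_i \sum_l A j i l * cdot (M *m (F j *m h l)) (h i).
pose S2 := pencil_form A (fun j => (r%:C%C : C) *: F j) (fun i => Dg *m h i).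
have SE : S = S1 + s * S2.
  rewrite /S /S1 /S2 /pencil_form mulr_sumr -big_split; apply: eq_bigr => j _ /=.
  rewrite mulr_sumr -big_split; apply: eq_bigr => i _ /=.
  rewrite mulr_sumr -big_split; apply: eq_bigr => l _ /=.
  have -> : ((r%:C%C : C) *: F j) *m (Dg *m h l) = Dg *m (F j *m h l).
    by rewrite mulmxA -scalemxAl -Dg_shift -mulmxA.
  by rewrite cM' mulrDr; congr (_ + _); rewrite mulrCA.
have p1 : 0 <= \sum_i cdot (M *m h i) (h i) + (S1 + S1^*).
  have one0 : kpsd (fun _ _ : 'I_d => 1 : C).
    have e1 : (fun _ _ : 'I_d => 1 : C) = (fun _ _ => 1^* * (1 : C)).
      by rewrite conjC1 mulr1.
    rewrite e1; exact: (@kpsd_rank1 R _ (fun=> 1)).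
  have [K0 e1] := pairing_pencil_coef h Mh one0.
  have := Mpos _ K0; rewrite e1; under eq_bigr => i _ do rewrite mul1r.
  rewrite (_ : \sum_j _ = S1) //.
  by apply: eq_bigr => j _; apply: eq_bigr => i _; apply: eq_bigr => l _; rewrite mul1r.
have p2 : 0 <= \sum_i cdot (Dg *m h i) (Dg *m h i) + (S2 + S2^*).
  by have /spectrahedronP := F_DA; apply.
have sr : s^* = s by apply/CrealP; rewrite gtr0_real.
have sumE : \sum_i cdot (M' *m h i) (h i) = \sum_i cdot (M *m h i) (h i) +
    s * \sum_i cdot (Dg *m h i) (Dg *m h i).
  by rewrite mulr_sumr -big_split; apply: eq_bigr => i _; rewrite cM'.
have alg (a b c k : C) : a + s * b + ((c + s * k) + (c + s * k)^* ) =
    (a + (c + c^*)) + s * (b + (k + k^*)).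
  by rewrite rmorphD rmorphM /= sr; ring.
clearbody S S1 S2; rewrite sumE SE; move: p1 p2.
move: (\sum_i cdot (M *m h i) (h i)) (\sum_i cdot (Dg *m h i) (Dg *m h i)) => a b p1 p2.
rewrite alg; apply: addr_ge0 => //.
by apply: mulr_ge0 => //; exact: ltW.
Qed.

(** Lurking isometry: for x a nonempty word, Qc x = A_j W_y where x = x_j y, and
    Vc x = W_x + Qc x. The equations solved by K say that Vc and Qc have the same
    Gram matrix, and the unitary U with U Qc = Vc satisfies W_x = (U - 1) A_j
    W_y. *)
Theorem truncated_realization : exists h (U : 'M[C]_(d * h)) (V : 'M[C]_(d * h, e)),
  let bA j := tensmx (A j) (1%:M : 'M[C]_h) in
  [/\ U *m U^t* = 1%:M, U^t* *m U = 1%:M, V^t* *m V = 1%:M &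
   forall j (a : word), (size a < N)%N ->
     V^t* *m U *m bA j *m wordmx (fun j => (U - 1%:M) *m bA j) a *m V = coef (j :: a)].
Proof.
have [K K0 Kt] := gram_kernel_exists.
have [b bK] := kpsd_factor K0.
set h := #|_| in b bK; exists h.
pose bA j := tensmx (A j) (1%:M : 'M[C]_h).
pose Wc x : 'cV[C]_(d * h) := unblk (fun i => b (x, i)).
pose Qc x : 'cV[C]_(d * h) := \sum_j \sum_x' F j x x' *: (bA j *m Wc x').
have WW x y : cdot (Wc y) (Wc x) = gram_part K x y.
  by rewrite cdot_blk; apply: eq_bigr => i _; rewrite !blkK bK.
have QW x y : cdot (Qc y) (Wc x) = shift_part K x y.
  rewrite (predot_suml cdotP); apply: eq_bigr => j _.
  rewrite (predot_suml cdotP).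
  transitivity (\sum_y' \sum_i \sum_l A j i l * (F j y y' * K (x, i) (y', l))).
    apply: eq_bigr => y' _; rewrite (predotZl cdotP) cdot_blk mulr_sumr.
    apply: eq_bigr => i _; rewrite /bA blk_tensmx (predot_suml cdotP) mulr_sumr.
    apply: eq_bigr => l _; rewrite (predotZl cdotP) mul1mx !blkK bK.
    by ring.
  rewrite exchange_big; apply: eq_bigr => i _; rewrite exchange_big; apply: eq_bigr => l _ /=.
  by rewrite mulr_sumr.
pose Vc x := Wc x + Qc x.
have VV x y : cdot (Vc y) (Vc x) = target (x, y) + cdot (Qc y) (Qc x).
  rewrite /Vc (predotDl cdotP) !(predotDr cdotP) WW QW.
  rewrite (predot_herm cdotP (Wc y)) QW -Kt pencil_coef_psd //=.
  by ring.
have Qnil x : wd x = [::] -> Qc x = 0.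
  move=> x0; rewrite /Qc big1 // => j _; rewrite big1 // => x' _.
  by rewrite FE x0 scale0r.
have Qcons x y j : wd x = j :: wd y -> ix x = ix y -> Qc x = bA j *m Wc y.
  move=> e1 e2; rewrite /Qc (bigD1 j) //= [X in _ + X]big1 ?addr0 => [|j' jj'].
    rewrite (bigD1 y) //= [X in _ + X]big1 ?addr0 => [|y' yy'].
      by rewrite FE e1 e2 !eqxx scale1r.
    rewrite FE e1; case: andP => [[/eqP [e3] /eqP e4]|_]; last by rewrite scale0r.
    suff ee : y' = y by rewrite ee eqxx in yy'.
    apply: enum_val_inj; rewrite (surjective_pairing (enum_val y)) (surjective_pairing (enum_val y')).
    by congr pair; [apply: val_inj|rewrite -[LHS]/(ix y') -e4].
  rewrite big1 // => x' _; rewrite FE e1; case: andP => [[/eqP [e3] _]|_]; last by rewrite scale0r.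
  by rewrite e3 eqxx in jj'.
(* Qc vanishes at the empty word, and Vm is made to vanish there as well. *)
pose Vm : 'M[C]_(m, d * h) := \matrix_(x, p) (if wd x == [::] then 0 else (Vc x p 0)^*).
pose Qm : 'M[C]_(m, d * h) := \matrix_(x, p) (Qc x p 0)^*.
have gram : Qm *m Qm^t* = Vm *m Vm^t*.
  apply/matrixP => x y.
  have -> : (Qm *m Qm^t* ) x y = cdot (Qc y) (Qc x).
    by rewrite cdotE mxE; apply: eq_bigr => p _; rewrite !mxE conjCK mulrC.
  have [x0|xn0] := eqVneq (wd x) [::].
    rewrite (Qnil x x0) (predot0r cdotP) mxE big1 // => p _.
    by rewrite !mxE x0 eqxx mul0r.
  have [y0|yn0] := eqVneq (wd y) [::].
    rewrite (Qnil y y0) (predot0l cdotP) mxE big1 // => p _.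
    by rewrite !mxE y0 eqxx conjC0 mulr0.
  have -> : (Vm *m Vm^t* ) x y = cdot (Vc y) (Vc x).
    rewrite cdotE mxE; apply: eq_bigr => p _.
    by rewrite !mxE (negPf xn0) (negPf yn0) conjCK mulrC.
  by rewrite VV /target /= (negPf xn0) (negPf yn0) /= !mul0r conjC0 !addr0 add0r.
have [U0 [UU1 UU2 QU]] := unitary_of_gram gram.
pose U := U0^t*.
have UQ x : wd x != [::] -> U *m Qc x = Vc x.
  move=> xn0; have rQ : row x Qm = (Qc x)^t* by apply/rowP => p; rewrite !mxE.
  have rV : row x Vm = (Vc x)^t* by apply/rowP => p; rewrite !mxE (negPf xn0).
  have : (Qc x)^t* *m U0 = (Vc x)^t* by rewrite -rQ -rV -row_mul QU.
  by move/(congr1 (fun X => X^t* )); rewrite trmx_mul map_mxM !trmxCK.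
pose rx (a : N.-bseq 'I_g) (u : 'I_e) : 'I_m := enum_rank (a, u).
have wdrx a u : wd (rx a u) = a by rewrite /wd enum_rankK.
have ixrx a u : ix (rx a u) = u by rewrite /ix enum_rankK.
pose V : 'M[C]_(d * h, e) := \matrix_(p, u) Wc (rx [bseq] u) p 0.
have Vu u : V *m delta_mx u 0 = Wc (rx [bseq] u).
  by rewrite -colE; apply/colP => p; rewrite !mxE.
pose Rm j := (U - 1%:M) *m bA j.
have step j (a : word) (aN : (size a < N)%N) u :
    U *m (bA j *m Wc (rx (insub_bseq N a) u)) = Vc (rx (insub_bseq N (j :: a)) u).
  rewrite -UQ; last by rewrite wdrx insub_bseqK.
  by congr (_ *m _); rewrite (@Qcons _ (rx (insub_bseq N a) u) j) ?wdrx ?ixrx ?insub_bseqK // ltnW.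
have Wword (a : word) u : (size a <= N)%N ->
    wordmx Rm a *m (V *m delta_mx u 0) = Wc (rx (insub_bseq N a) u).
  elim: a => [|j a IH] aN.
    rewrite wordmx_nil mul1mx Vu; congr (Wc (rx _ u)).
    by apply: val_inj; rewrite insub_bseqK.
  rewrite wordmx_cons -mulmxA IH ?(ltnW aN) // /Rm -mulmxA mulmxBl mul1mx step //.
  rewrite /Vc (@Qcons _ (rx (insub_bseq N a) u) j) ?addrK // ?wdrx ?ixrx ?insub_bseqK //.
  by rewrite ltnW.
have entry (X : 'M[C]_(d * h)) u u' :
    (V^t* *m X *m V) u' u = cdot (X *m Wc (rx [bseq] u)) (Wc (rx [bseq] u')).
  rewrite -!Vu; have -> : (V^t* *m X *m V) u' u = cdot (V^t* *m X *m V *m delta_mx u 0) (delta_mx u' 0).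
    by rewrite cdot_delta -colE [RHS]mxE.
  by rewrite -!mulmxA cdot_adj trmxCK.
have tnil u u' : target (rx [bseq] u', rx [bseq] u) = (u' == u)%:R.
  rewrite /target /= !wdrx !ixrx /=.
  by rewrite (coef_nil r G0) !mxE !mulr0 conjC0 !addr0.
exists U, V; split; rewrite ?trmxCK //.
  apply/matrixP => u' u; have := entry 1%:M u u'; rewrite mulmx1 mul1mx => ->.
  have q0 v : Qc (rx [bseq] v) = 0 by rewrite Qnil // wdrx.
  have := VV (rx [bseq] u') (rx [bseq] u).
  by rewrite /Vc !q0 !addr0 (predot0l cdotP) addr0 tnil mxE.
move=> j a aN; apply/matrixP => u' u.
rewrite -[X in X *m V]mulmxA -[X in X *m V]mulmxA entry.
rewrite -!mulmxA -Vu Wword ?(ltnW aN) // step //.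
have := VV (rx [bseq] u') (rx (insub_bseq N (j :: a)) u).
have q0 : Qc (rx [bseq] u') = 0 by rewrite Qnil // wdrx.
rewrite {2}/Vc q0 addr0 (predot0r cdotP) addr0 => ->.
rewrite /target /= !wdrx !ixrx insub_bseqK //.
by rewrite /= mul1r mul0r conjC0 addr0 add0r.
Qed.

End Truncated.

(** * The Hilbert space of a complete pre-inner product *)

Section HilbertQuotient.
Local Open Scope quotient_scope.
Variable R : realType.
Local Notation C := (Cplx R).

(** Completeness is demanded along sequences with geometric steps: an ultraproduct
    provides exactly this, and it suffices for the quotient. *)
Record preHilbert := PreHilbert {
  ph_sort :> lmodType C;
  ph_dot : ph_sort -> ph_sort -> C;
  ph_dotP : predot ph_dot;
  ph_complete : forall x : nat -> ph_sort,
    (forall k, pnorm ph_dot (x k.+1 - x k) <= (2 ^+ k)^-1) ->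
    exists l, forall k, pnorm ph_dot (l - x k) <= 4 * (2 ^+ k)^-1 }.

Variable E : preHilbert.
Local Notation dot := (@ph_dot E).
Local Notation dotP := (ph_dotP E).

Definition null_eq (x y : E) : bool := pnorm dot (x - y) == 0.

Lemma null_eq_refl : reflexive null_eq.
Proof. by move=> x; rewrite /null_eq subrr (pnorm0 dotP). Qed.

Lemma null_eq_sym : symmetric null_eq.
Proof. by move=> x y; rewrite /null_eq (pnorm_distC dotP). Qed.

Lemma null_eq_trans : transitive null_eq.
Proof.
move=> y x z /eqP h1 /eqP h2; rewrite /null_eq eq_le (pnorm_ge0 dotP) andbT.
have -> : x - z = (x - y) + (y - z) by rewrite addrA subrK.
by apply: le_trans (ler_pnormD dotP _ _) _; rewrite h1 h2 addr0.
Qed.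

Canonical null_equiv := EquivRel null_eq null_eq_refl null_eq_sym null_eq_trans.

Definition hquot : Type := {eq_quot null_eq}.
HB.instance Definition _ := Choice.on hquot.
HB.instance Definition _ := EqQuotient.on hquot.

Definition hcls (x : E) : hquot := \pi_hquot x.

Lemma hcls_eq x y : pnorm dot (x - y) = 0 -> hcls x = hcls y.
Proof. by move=> h; apply/eqmodP; rewrite /= /null_eq h. Qed.

Lemma hcls_repr (a : hquot) : hcls (repr a) = a.
Proof. exact: reprK. Qed.

Lemma repr_hcls x : pnorm dot (repr (hcls x) - x) = 0.
Proof. by apply/eqP; rewrite -[_ == 0]/(null_eq _ _); apply/eqmodP; rewrite reprK. Qed.

Definition hadd (a b : hquot) := hcls (repr a + repr b).
Definition hopp (a : hquot) := hcls (- repr a).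
Definition hscale (c : C) (a : hquot) := hcls (c *: repr a).

Lemma haddE x y : hadd (hcls x) (hcls y) = hcls (x + y).
Proof.
apply: hcls_eq; rewrite opprD addrACA.
apply/eqP; rewrite eq_le (pnorm_ge0 dotP) andbT.
by apply: le_trans (ler_pnormD dotP _ _) _; rewrite !repr_hcls addr0.
Qed.

Lemma hoppE x : hopp (hcls x) = hcls (- x).
Proof. by apply: hcls_eq; rewrite -opprD (pnormN dotP) repr_hcls. Qed.

Lemma hscaleE c x : hscale c (hcls x) = hcls (c *: x).
Proof. by apply: hcls_eq; rewrite -scalerBr (pnormZ dotP) repr_hcls mulr0. Qed.

Lemma haddA : associative hadd.
Proof.
move=> a b c; rewrite -(hcls_repr a) -(hcls_repr b) -(hcls_repr c).
by rewrite !haddE addrA.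
Qed.
Lemma haddC : commutative hadd.
Proof. by move=> a b; rewrite /hadd addrC. Qed.
Lemma hadd0 : left_id (hcls 0) hadd.
Proof. by move=> a; rewrite -(hcls_repr a) haddE add0r. Qed.
Lemma haddN : left_inverse (hcls 0) hopp hadd.
Proof. by move=> a; rewrite -(hcls_repr a) hoppE haddE addNr. Qed.

HB.instance Definition _ := GRing.isZmodule.Build hquot haddA haddC hadd0 haddN.

Lemma hclsD x y : hcls (x + y) = hcls x + hcls y.
Proof. by rewrite -haddE. Qed.

Lemma hscaleA c c' a : hscale c (hscale c' a) = hscale (c * c') a.
Proof. by rewrite -(hcls_repr a) !hscaleE scalerA. Qed.
Lemma hscale1 : left_id 1 hscale.
Proof. by move=> a; rewrite -(hcls_repr a) hscaleE scale1r. Qed.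
Lemma hscaleDr : right_distributive hscale +%R.
Proof.
by move=> c a b; rewrite -(hcls_repr a) -(hcls_repr b) -hclsD !hscaleE -hclsD scalerDr.
Qed.
Lemma hscaleDl a : {morph hscale^~ a : c c' / c + c'}.
Proof. by move=> c c'; rewrite -(hcls_repr a) !hscaleE -hclsD scalerDl. Qed.

HB.instance Definition _ := GRing.Zmodule_isLmodule.Build C hquot
  hscaleA hscale1 hscaleDr hscaleDl.

Lemma hclsZ c x : hcls (c *: x) = c *: hcls x.
Proof. by rewrite -hscaleE. Qed.

Lemma hclsB x y : hcls (x - y) = hcls x - hcls y.
Proof. by rewrite hclsD -scaleN1r hclsZ scaleN1r. Qed.

Definition hform (a b : hquot) : C := dot (repr a) (repr b).

Lemma hformE x y : hform (hcls x) (hcls y) = dot x y.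
Proof.
have null u v : pnorm dot u = 0 -> dot u v = 0.
  move=> u0; apply/eqP; rewrite -normr_le0.
  by apply: le_trans (predot_le dotP _ _) _; rewrite u0 mul0r.
have h1 : dot (repr (hcls x) - x) (repr (hcls y)) = 0 by apply: null; exact: repr_hcls.
have h2 : dot (repr (hcls y) - y) x = 0 by apply: null; exact: repr_hcls.
move: h1; rewrite (predotBl dotP) => /eqP; rewrite subr_eq0 => /eqP; rewrite -/(hform _ _) => ->.
move/(congr1 Num.conj): h2; rewrite conjC0 -(predot_herm dotP) (predotBr dotP).
by move/eqP; rewrite subr_eq0 => /eqP.
Qed.

Lemma hform_linear a x y z : hform (a *: x + y) z = a * hform x z + hform y z.
Proof.
rewrite -(hcls_repr x) -(hcls_repr y) -(hcls_repr z) -hclsZ -hclsD !hformE.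
exact: predot_linear dotP _ _ _ _.
Qed.

Lemma hform_predot : predot hform.
Proof.
split; first exact: hform_linear.
  by move=> x y; exact: predot_herm dotP _ _.
by move=> x; exact: predot_ge0 dotP _.
Qed.

Definition hnorm (a : hquot) : C := pnorm hform a.

Lemma hnorm_eq0 a : hnorm a = 0 -> a = 0.
Proof.
by move=> h; rewrite -(hcls_repr a); apply: hcls_eq; rewrite subr0.
Qed.

HB.instance Definition _ := Lmodule_isNormed.Build C hquot
  (ler_pnormD hform_predot) (pnormZ hform_predot) hnorm_eq0.

Lemma hnormE x : `|hcls x| = pnorm dot x.
Proof. by rewrite -[LHS]/(sqrtC (hform (hcls x) (hcls x))) hformE. Qed.

(** A Cauchy filter contains balls of radius 2^-(k+2) for all k; their centers
    form a sequence with geometric steps. *)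
Lemma hquot_complete (F : set_system hquot) : ProperFilter F -> cauchy F -> cvg F.
Proof.
move=> FF /cauchy_ballP Fc.
have e0 k : 0 < (2 ^+ k.+2)^-1 :> C by rewrite invr_gt0 exprn_gt0.
have /choice[a aP] k : exists x : E, F (ball (hcls x) (2 ^+ k.+2)^-1).
  have [[P Q] /= [FP FQ] h] := Fc _ (e0 k).
  have [p Pp] := filter_ex FP; exists (repr p); rewrite hcls_repr.
  by apply: filterS FQ => q Qq; apply: (h (p, q)).
have step k : pnorm dot (a k.+1 - a k) <= (2 ^+ k)^-1.
  have [p [p1 p2]] := filter_ex (filterI (aP k.+1) (aP k)).
  rewrite -hnormE hclsB.
  move: p1 p2; rewrite -!ball_normE /= => p1 p2.
  have -> : hcls (a k.+1) - hcls (a k) = (hcls (a k.+1) - p) - (hcls (a k) - p).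
    by rewrite opprB addrA subrK.
  apply: le_trans (ler_normB _ _) _; apply: le_trans (lerD (ltW p1) (ltW p2)) _.
  have -> : (2 ^+ k)^-1 = (2 ^+ k.+2)^-1 * 4 :> C.
    by rewrite !exprS !invfM; field; rewrite expf_neq0 // pnatr_eq0.
  have -> : (2 ^+ k.+3)^-1 = (2 ^+ k.+2)^-1 / 2 :> C by rewrite [in LHS]exprS invfM mulrC.
  rewrite -[X in _ + X]mulr1 -mulrDr ler_wpM2l ?(ltW (e0 k)) //.
  have -> : 4 = 2^-1 + 1 + (2 + 2^-1) :> C by field.
  by rewrite lerDl addr_ge0 ?invr_ge0 ?ler0n.
have [l lP] := ph_complete step.
apply/cvg_ex; exists (hcls l); apply/cvg_ballP => eps eps0.
have [k kP] := pow2_small (ltac:(exact: ler0n _ 5) : 0 <= 5%:R) eps0.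
apply: filterS (aP k) => p; rewrite -!ball_normE /= => pk.
have -> : hcls l - p = hcls (l - a k) + (hcls (a k) - p) by rewrite hclsB addrA subrK.
apply: le_lt_trans (ler_normD _ _) _; rewrite hnormE.
apply: le_lt_trans (lerD (lP k) (ltW pk)) _.
apply: le_lt_trans (kP k (leqnn k)).
have -> : (2 ^+ k)^-1 * 5 = 4 * (2 ^+ k)^-1 + (2 ^+ k)^-1 :> C by ring.
rewrite lerD2l lef_pV2 ?posrE ?exprn_gt0 // !exprS mulrA.
by rewrite ler_peMl ?exprn_ge0 // -natrM ler1n.
Qed.

HB.instance Definition _ := Uniform_isComplete.Build hquot hquot_complete.

Definition hilbert_dot (a b : hquot) : C := hform a b.

Lemma hilbert_dot_bilinear : bilinear_for *%R (Num.conj \; *%R) hilbert_dot.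
Proof.
split=> [z a x y|z a x y].
  by rewrite /applyr /=; exact: predot_linear hform_predot _ _ _ _.
by rewrite /hilbert_dot (predotDr hform_predot) (predotZr hform_predot).
Qed.

HB.instance Definition _ := bilinear_isBilinear.Build C hquot hquot C *%R
  (Num.conj \; *%R) hilbert_dot hilbert_dot_bilinear.

Lemma hilbert_dot_herm x y :
  hilbert_dot x y = (-1) ^+ false * Num.conj (hilbert_dot y x).
Proof. by rewrite expr0 mul1r; exact: predot_herm hform_predot _ _. Qed.

HB.instance Definition _ := isHermitianSesquilinear.Build C hquot false
  Num.conj hilbert_dot hilbert_dot_herm.

Lemma hilbert_dot_gt0 x : x != 0 -> 0 < hilbert_dot x x.
Proof.
move=> xn0; rewrite lt_def (predot_ge0 hform_predot) andbT.
apply: contra xn0 => /eqP h; apply/eqP/hnorm_eq0.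
by rewrite /hnorm /pnorm -[hform x x]/(hilbert_dot x x) h sqrtC0.
Qed.

HB.instance Definition _ := isDotProduct.Build C hquot hilbert_dot hilbert_dot_gt0.

Lemma hilbert_dot_norm (x : hquot) : hilbert_dot x x = `|x| ^+ 2.
Proof. by rewrite -[X in _ = X ^+ 2]/(pnorm hform x) pnormK. Qed.

Definition hilbert_quotient : hilbertType R :=
  @HilbertType R hquot hilbert_dot hilbert_dot_norm.

End HilbertQuotient.

(** * Ultraproducts of finite-dimensional Hilbert spaces *)

Section Ultraproduct.
Variable R : realType.
Local Notation C := (Cplx R).
Variable h : nat -> nat.

Definition bdd k (x : forall N, 'cV[C]_(k N)) : Prop :=
  ubounded (fun N => cdot (x N) (x N)).

Lemma le_1sqr (t : C) : 0 <= t -> t <= 1 + t ^+ 2.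
Proof.
move=> t0; rewrite -subr_ge0.
have -> : 1 + t ^+ 2 - t = (t - 2^-1) ^+ 2 + 3 / 4 by field.
rewrite addr_ge0 ?divr_ge0 ?ler0n // -realEsqr realB ?ger0_real //.
Qed.

Lemma bdd_cdot k (x y : forall N, 'cV[C]_(k N)) : bdd x -> bdd y ->
  ubounded (fun N => cdot (x N) (y N)).
Proof.
move=> [B xB] [D yD]; exists (1 + B * D) => N.
apply: le_trans (le_1sqr (normr_ge0 _)) _; rewrite lerD2l.
apply: le_trans (predot_CauchySchwarz cdotP _ _) _.
have p0 (z : 'cV[C]_(k N)) : 0 <= cdot z z by exact: predot_ge0 cdotP _.
apply: ler_pM => //; [apply: le_trans (xB N)|apply: le_trans (yD N)];
  by apply: real_ler_norm; exact: ger0_real.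
Qed.

Lemma bddZD k a (x y : forall N, 'cV[C]_(k N)) : bdd x -> bdd y ->
  bdd (fun N => a *: x N + y N).
Proof.
move=> xb yb; have bxy := bdd_cdot xb yb; have byx := bdd_cdot yb xb.
have cb c z : ubounded z -> ubounded (fun N => c * z N : C).
  by move=> zb; apply: uboundedM => //; exact: ubounded_cst.
have := uboundedD (cb a _ (uboundedD (cb a^* _ xb) bxy)) (uboundedD (cb a^* _ byx) yb).
congr ubounded; apply/funext => N /=.
rewrite (predot_linear cdotP) !(predotDr cdotP).
by rewrite !(predotZr cdotP).
Qed.

Lemma bdd0 k : bdd (fun N => 0 : 'cV[C]_(k N)).
Proof. by exists 0 => N; rewrite (predot0l cdotP) normr0. Qed.

Lemma bddZ k a (x : forall N, 'cV[C]_(k N)) : bdd x -> bdd (fun N => a *: x N).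
Proof.
move=> xb; have := bddZD a xb (bdd0 k).
by congr bdd; apply: functional_extensionality_dep => N; rewrite addr0.
Qed.

Record ufam := Ufam { uval : forall N, 'cV[C]_(h N); ubdd : bdd uval }.

Lemma ufam_eq (x y : ufam) : (forall N, uval x N = uval y N) -> x = y.
Proof.
case: x => x xb; case: y => y yb /= xy; have e : x = y by apply: functional_extensionality_dep.
by subst y; rewrite (Prop_irrelevance xb yb).
Qed.

HB.instance Definition _ := gen_eqMixin ufam.
HB.instance Definition _ := gen_choiceMixin ufam.

Lemma uaddP (x y : ufam) : bdd (fun N => uval x N + uval y N).
Proof.
have := bddZD 1 (ubdd x) (ubdd y).
by congr bdd; apply: functional_extensionality_dep => N; rewrite scale1r.
Qed.
Definition uadd x y := Ufam (uaddP x y).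
Definition uzero := Ufam (bdd0 h).
Definition uscale a x := Ufam (bddZ a (ubdd x)).
Lemma uoppP (x : ufam) : bdd (fun N => - uval x N).
Proof.
have := bddZ (-1) (ubdd x).
by congr bdd; apply: functional_extensionality_dep => N; rewrite scaleN1r.
Qed.
Definition uopp x := Ufam (uoppP x).

Lemma uaddA : associative uadd.
Proof. by move=> x y z; apply: ufam_eq => N /=; rewrite addrA. Qed.
Lemma uaddC : commutative uadd.
Proof. by move=> x y; apply: ufam_eq => N /=; rewrite addrC. Qed.
Lemma uadd0 : left_id uzero uadd.
Proof. by move=> x; apply: ufam_eq => N /=; rewrite add0r. Qed.
Lemma uaddN : left_inverse uzero uopp uadd.
Proof. by move=> x; apply: ufam_eq => N /=; rewrite addNr. Qed.
HB.instance Definition _ := GRing.isZmodule.Build ufam uaddA uaddC uadd0 uaddN.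

Lemma uscaleA a b x : uscale a (uscale b x) = uscale (a * b) x.
Proof. by apply: ufam_eq => N /=; rewrite scalerA. Qed.
Lemma uscale1 : left_id 1 uscale.
Proof. by move=> x; apply: ufam_eq => N /=; rewrite scale1r. Qed.
Lemma uscaleDr : right_distributive uscale +%R.
Proof. by move=> a x y; apply: ufam_eq => N /=; rewrite scalerDr. Qed.
Lemma uscaleDl x : {morph uscale^~ x : a b / a + b}.
Proof. by move=> a b; apply: ufam_eq => N /=; rewrite scalerDl. Qed.
HB.instance Definition _ := GRing.Zmodule_isLmodule.Build C ufam
  uscaleA uscale1 uscaleDr uscaleDl.

Definition udot (x y : ufam) : C := ulim (fun N => cdot (uval x N) (uval y N)).

Lemma udot_predot : predot udot.
Proof.
have b := fun x y => bdd_cdot (ubdd x) (ubdd y).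
split=> [a x y z|x y|x].
- rewrite /udot -ulimZ // -ulimD //; last by apply: uboundedM => //; exact: ubounded_cst.
  by congr ulim; apply/funext => N; exact: predot_linear cdotP _ _ _ _.
- rewrite /udot -ulim_conj //; congr ulim; apply/funext => N.
  exact: predot_herm cdotP _ _.
- apply: ulim_ge0 => //; apply: filterS filterT => N _.
  exact: predot_ge0 cdotP _.
Qed.

Lemma ulim_near_lt (x : nat -> C) (b : C) : ubounded x ->
  (forall N, 0 <= x N) -> ulim x < b -> freeU [set N | x N < b].
Proof.
move=> xb x0 xlt.
have p : 0 < b - ulim x by rewrite subr_gt0.
have /cvgrPdist_lt/(_ _ p) := ulim_cvg xb; apply: filterS => N /=.
rewrite distrC => hN.
have l0 : 0 <= ulim x by apply: (ulim_ge0 xb); apply: filterS filterT => M _; exact: x0.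
have := le_lt_trans (real_ler_norm (realB (ger0_real (x0 N)) (ger0_real l0))) hN.
by rewrite ltrBlDr subrK.
Qed.

(** Diagonal argument: the limit has at the index N the vector x_(kap N) N, where
    kap N is how far the steps of x at N stay small. For each k, the indices N
    with kap N >= k form a set of the ultrafilter. *)
Lemma ufam_complete (x : nat -> ufam) :
  (forall k, pnorm udot (x k.+1 - x k) <= (2 ^+ k)^-1) ->
  exists l, forall k, pnorm udot (l - x k) <= 4 * (2 ^+ k)^-1.
Proof.
move=> xc.
pose dist k N := pnorm (@cdot R _) (uval (x k.+1) N - uval (x k) N).
pose A k := [set N | dist k N <= 2 * (2 ^+ k)^-1].
have p2 k : 0 < (2 ^+ k)^-1 :> C by rewrite invr_gt0 exprn_gt0.
have AU k : freeU (A k).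
  have lt : udot (x k.+1 - x k) (x k.+1 - x k) < (2 * (2 ^+ k)^-1) ^+ 2.
    rewrite -(pnormK udot).
    apply: le_lt_trans (_ : ((2 ^+ k)^-1) ^+ 2 < _).
      by rewrite ler_pXn2r ?nnegrE ?(pnorm_ge0 udot_predot) // ltW.
    rewrite exprMn ltr_pMl ?exprn_gt0 //.
    by rewrite -natrX ltr1n.
  have := ulim_near_lt (bdd_cdot (ubdd _) (ubdd _)) _ lt.
  move=> /(_ (fun N => predot_ge0 cdotP _)).
  apply: filterS => N /= hN; rewrite /A /= /dist.
  rewrite -(ler_pXn2r (ltn0Sn 1)) ?nnegrE ?(pnorm_ge0 cdotP) ?mulr_ge0 ?(ltW (p2 k)) //.
  by rewrite pnormK ltW.
pose B k N : bool := (k <= N)%N && `[< forall i, (i < k)%N -> A i N >].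
have B0 N : exists k, B k N by exists 0%N; apply/andP; split=> //; apply/asboolP.
have BN N k : B k N -> (k <= N)%N by case/andP.
pose kap N := ex_maxn (B0 N) (@BN N).
have kapB N : B (kap N) N by rewrite /kap; case: ex_maxnP.
have kap_max N k : B k N -> (k <= kap N)%N.
  by rewrite /kap; case: ex_maxnP => i _ him /him.
have BU k : freeU [set N | B k N].
  have : freeU [set N | forall i, (i < k)%N -> A i N].
    elim: k => [|k IH]; first by apply: filterS filterT.
    apply: filterS2 IH (AU k) => N h1 h2 i; rewrite ltnS leq_eqVlt => /orP[/eqP -> //|].
    exact: h1.
  apply: filterS2 (freeU_ge k) => N h1 h2; apply/andP; split=> //.
  by apply/asboolP.
pose l N := uval (x (kap N)) N.
have close k N : B k N -> pnorm (@cdot R _) (l N - uval (x k) N) <= 4 * (2 ^+ k)^-1.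
  move=> hB; have kk := kap_max _ _ hB.
  have /andP[_ /asboolP hA] := kapB N.
  have key i : (k + i <= kap N)%N ->
      pnorm (@cdot R _) (uval (x (k + i)%N) N - uval (x k) N) <=
      4 * (2 ^+ k)^-1 - 4 * (2 ^+ (k + i))^-1.
    elim: i => [|i IH] hi.
      by rewrite addn0 !subrr (pnorm0 cdotP).
    have -> : uval (x (k + i.+1)%N) N - uval (x k) N =
        (uval (x (k + i.+1)%N) N - uval (x (k + i)%N) N) + (uval (x (k + i)%N) N - uval (x k) N).
      by rewrite addrA subrK.
    apply: le_trans (ler_pnormD cdotP _ _) _.
    have hi' : (k + i < kap N)%N by rewrite -addnS.
    have d1 : dist (k + i)%N N <= 2 * (2 ^+ (k + i))^-1 by apply: hA.
    rewrite addnS; apply: le_trans (lerD d1 (IH (ltnW hi'))) _.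
    have -> : 4 * (2 ^+ (k + i).+1)^-1 = 2 * (2 ^+ (k + i))^-1 :> C.
      by rewrite exprS invfM mulrA; congr (_ * _); field.
    have -> : 4 * (2 ^+ (k + i))^-1 = 2 * (2 ^+ (k + i))^-1 + 2 * (2 ^+ (k + i))^-1 :> C by ring.
    by rewrite addrC opprD addrA subrK.
  have := key (kap N - k)%N; rewrite subnKC // => /(_ (leqnn _)) h1.
  apply: le_trans h1 _; rewrite gerBl mulr_ge0 //; exact: ltW.
have lb : bdd l.
  have [D hD] := ubdd (x 0%N).
  exists ((1 + D + 4) ^+ 2) => N.
  have lp : 0 <= cdot (l N) (l N) by exact: predot_ge0 cdotP _.
  rewrite ger0_norm // -pnormK.
  have p0 : pnorm (@cdot R _) (uval (x 0%N) N) <= 1 + D.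
    apply: le_trans (le_1sqr (pnorm_ge0 cdotP _)) _.
    rewrite lerD2l pnormK; apply: le_trans (hD N).
    by apply: real_ler_norm; apply: ger0_real; exact: predot_ge0 cdotP _.
  have tot : pnorm (@cdot R _) (l N) <= 1 + D + 4.
    have -> : l N = uval (x 0%N) N + (l N - uval (x 0%N) N) by rewrite addrC subrK.
    apply: le_trans (ler_pnormD cdotP _ _) _; apply: lerD => //.
    have /close : B 0%N N by apply/andP; split=> //; apply/asboolP.
    by rewrite expr0 invr1 mulr1.
  have q0 := pnorm_ge0 cdotP (l N).
  by rewrite ler_pXn2r ?nnegrE // (le_trans q0 tot).
exists (Ufam lb) => k.
have q0 : 0 <= 4 * (2 ^+ k)^-1 :> C by rewrite mulr_ge0 // ltW.
rewrite -(ler_pXn2r (ltn0Sn 1)) ?nnegrE ?(pnorm_ge0 udot_predot) // pnormK.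
rewrite -[leRHS](@ulim_cst R); apply: ler_ulim.
- exact: bdd_cdot (ubdd _) (ubdd _).
- exact: ubounded_cst.
apply: filterS (BU k) => N hB /=.
have := close k N hB; rewrite -(ler_pXn2r (ltn0Sn 1)) ?nnegrE ?(pnorm_ge0 cdotP) //.
by rewrite pnormK.
Qed.

Definition ultraproduct_pre : preHilbert R := PreHilbert udot_predot ufam_complete.
Definition ultraproduct : hilbertType R := hilbert_quotient ultraproduct_pre.

End Ultraproduct.

(** * Inner products on H (x) C^n *)

Section TensDot.
Variable R : realType.
Local Notation C := (Cplx R).

Lemma hdot_predot (H' : hilbertType R) : predot (@hdot R H').
Proof.
split=> [a x y z|x y|x].
- by rewrite linearPl.
- by rewrite hermC mul1r.
- exact: dnorm_ge0.
Qed.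

Lemma tensdot_predot (U : lmodType C) (dot : U -> U -> C) n :
  predot dot -> predot (tensdot dot (n := n)).
Proof.
move=> dP; split=> [a x y z|x y|x].
- by apply: tensdot_linear; exact: predot_linear dP.
- by apply: tensdot_herm; exact: predot_herm dP.
- by apply: sumr_ge0 => i _; exact: predot_ge0 dP _.
Qed.

Lemma tensdot_eq0 (H' : hilbertType R) n (y : tens H' n) :
  tensdot (@hdot R H') y y = 0 -> y = 0.
Proof.
move=> y0; apply/ffunP => i; rewrite ffunE; apply/eqP.
rewrite -(dnorm_eq0 (@hdot R H')); apply/eqP.
by move/psumr_eq0P : y0 => /(_ (fun i _ => predot_ge0 (hdot_predot H') (y i)) i); apply.
Qed.

Lemma tens_linearE (U : lmodType C) n a (x y : tens U n) i :
  (a *: x + y) i = a *: x i + y i.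
Proof. by rewrite !ffunE. Qed.

End TensDot.

(** * Operators on ultraproducts *)

Section UltraOperators.
Variables (R : realType) (h : nat -> nat) (d : nat).
Local Notation C := (Cplx R).
Local Notation H := (ultraproduct R h).
Local Notation K := (tens H d).
Local Notation dotK := (tensdot (@hdot R H) (n := d)).

Implicit Types Y Z : forall N, 'cV[C]_(d * h N).

Lemma bdd_blk Y i : bdd Y -> bdd (fun N => blk (Y N) i).
Proof.
move=> [B YB]; exists B => N.
have p0 k (z : 'cV[C]_k) : 0 <= cdot z z by exact: predot_ge0 cdotP _.
apply: le_trans (YB N); rewrite !ger0_norm // [leRHS]cdot_blk (bigD1 i) //= lerDl.
by apply: sumr_ge0.
Qed.

Definition ublk Y (Yb : bdd Y) i : ufam R h := Ufam (bdd_blk i Yb).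

(** The identification of H (x) C^d with the ultraproduct of the C^d (x) C^(h N),
    extended by 0 to unbounded sequences. *)
Definition c_ucls Y : K :=
  [ffun i => if pselect (bdd Y) is left Yb then hcls (ublk Yb i : ultraproduct_pre R h) else 0].

Lemma c_uclsE Y (Yb : bdd Y) i : c_ucls Y i = hcls (ublk Yb i : ultraproduct_pre R h).
Proof.
rewrite ffunE; case: pselect => // Yb'.
by rewrite (Prop_irrelevance Yb Yb').
Qed.

Lemma c_ucls_linear a Y Z : bdd Y -> bdd Z ->
  c_ucls (fun N => a *: Y N + Z N) = a *: c_ucls Y + c_ucls Z.
Proof.
move=> Yb Zb; have b := bddZD a Yb Zb.
apply/ffunP => i; rewrite tens_linearE (c_uclsE b) (c_uclsE Yb) (c_uclsE Zb).
rewrite -[a *: _]hclsZ -hclsD; congr hcls; apply: ufam_eq => N /=.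
by apply/colP => k; rewrite !mxE.
Qed.

Lemma c_tensdot_ucls Y Z : bdd Y -> bdd Z ->
  dotK (c_ucls Y) (c_ucls Z) = ulim (fun N => cdot (Y N) (Z N)).
Proof.
move=> Yb Zb.
have -> : (fun N => cdot (Y N) (Z N)) = (fun N => \sum_i cdot (blk (Y N) i) (blk (Z N) i)).
  by apply/funext => N; rewrite cdot_blk.
rewrite ulim_sum; last by move=> i; apply: bdd_cdot; exact: bdd_blk.
apply: eq_bigr => i _; rewrite (c_uclsE Yb) (c_uclsE Zb).
exact: hformE.
Qed.

Definition c_urep (y : K) N : 'cV[C]_(d * h N) :=
  unblk (fun i => uval (repr (y i : hquot (ultraproduct_pre R h))) N).

Lemma c_bdd_urep y : bdd (c_urep y).
Proof.
rewrite /bdd; have -> : (fun N => cdot (c_urep y N) (c_urep y N)) = (fun N =>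
    \sum_i cdot (uval (repr (y i : hquot (ultraproduct_pre R h))) N)
                (uval (repr (y i : hquot (ultraproduct_pre R h))) N)).
  apply/funext => N; rewrite cdot_blk; apply: eq_bigr => i _.
  by rewrite /c_urep !blkK.
by apply: ubounded_sum => i; exact: ubdd.
Qed.

Lemma c_ucls_urep y : c_ucls (c_urep y) = y.
Proof.
apply/ffunP => i; rewrite (c_uclsE (c_bdd_urep y)).
rewrite -[RHS](hcls_repr (y i : hquot (ultraproduct_pre R h))); congr hcls.
by apply: ufam_eq => N /=; rewrite /c_urep blkK.
Qed.

Lemma c_ucls_ampl (A : 'M[C]_d) Y : bdd Y ->
  bdd (fun N => tensmx A (1%:M : 'M[C]_(h N)) *m Y N) ->
  tensop id A (c_ucls Y) = c_ucls (fun N => tensmx A 1%:M *m Y N).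
Proof.
move=> Yb Ab; apply/ffunP => i; rewrite ffunE (c_uclsE Ab).
transitivity (hcls (\sum_l A i l *: ublk Yb l : ultraproduct_pre R h)).
  rewrite (big_morph (@hcls R (ultraproduct_pre R h)) (@hclsD R _) (erefl _)).
  by apply: eq_bigr => l _; rewrite hclsZ (c_uclsE Yb).
congr hcls; apply: ufam_eq => N /=; rewrite blk_tensmx.
rewrite (big_morph (fun x : ufam R h => uval x N) (id1 := 0) (op1 := +%R)) //.
by apply: eq_bigr => l _; rewrite mul1mx.
Qed.

End UltraOperators.

(** What is used of the ultraproduct of the spaces C^d (x) C^(h N): vectors are
    classes of bounded sequences, and inner products are ultralimits. *)
Record ultramodel (R : realType) (h : nat -> nat) (d : nat) := UltraModel {
  um_space : hilbertType R;
  ucls : (forall N, 'cV[Cplx R]_(d * h N)) -> tens um_space d;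
  urep : tens um_space d -> forall N, 'cV[Cplx R]_(d * h N);
  ucls_linear : forall a Y Z, bdd Y -> bdd Z ->
    ucls (fun N => a *: Y N + Z N) = a *: ucls Y + ucls Z;
  tensdot_ucls : forall Y Z, bdd Y -> bdd Z ->
    tensdot (@hdot R um_space) (ucls Y) (ucls Z) = ulim (fun N => cdot (Y N) (Z N));
  bdd_urep : forall y, bdd (urep y);
  ucls_urep : forall y, ucls (urep y) = y;
  ucls_ampl : forall (A : 'M[Cplx R]_d) Y, bdd Y ->
    bdd (fun N => tensmx A (1%:M : 'M[Cplx R]_(h N)) *m Y N) ->
    tensop id A (ucls Y) = ucls (fun N => tensmx A 1%:M *m Y N) }.

Lemma ultramodel_exists (R : realType) (h : nat -> nat) (d : nat) :
  inhabited (ultramodel R h d).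
Proof.
exact: inhabits (UltraModel (@c_ucls_linear R h d)
  (@c_tensdot_ucls R h d) (@c_bdd_urep R h d)
  (@c_ucls_urep R h d) (@c_ucls_ampl R h d)).
Qed.

Section UltraLift.
Variables (R : realType) (h : nat -> nat) (d : nat) (um : ultramodel R h d).
Local Notation C := (Cplx R).
Local Notation H := (um_space um).
Local Notation K := (tens H d).
Local Notation dotK := (tensdot (@hdot R H) (n := d)).
Local Notation ucls := (@ucls R h d um).
Local Notation urep := (@urep R h d um).
Implicit Types Y Z : forall N, 'cV[C]_(d * h N).

Lemma ucls_eq Y Z : bdd Y -> bdd Z ->
  ulim (fun N => cdot (Y N - Z N) (Y N - Z N)) = 0 -> ucls Y = ucls Z.
Proof.
move=> Yb Zb YZ.
have db : bdd (fun N => (-1) *: Z N + Y N) by exact: bddZD.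
apply/eqP; rewrite -subr_eq0; apply/eqP.
have -> : ucls Y - ucls Z = ucls (fun N => (-1) *: Z N + Y N).
  by rewrite (ucls_linear um _ Zb Yb) scaleN1r addrC.
apply: tensdot_eq0; rewrite (tensdot_ucls um db db) -[RHS]YZ; congr ulim.
by apply/funext => N; rewrite scaleN1r addrC.
Qed.

Definition unif_bounded (M : forall N, 'M[C]_(d * h N)) : Prop :=
  exists B : C, forall N v, cdot (M N *m v) (M N *m v) <= B * cdot v v.

Lemma bdd_mul M Y : unif_bounded M -> bdd Y -> bdd (fun N => M N *m Y N).
Proof.
move=> [B MB] [D YD]; exists (`|B| * D) => N.
have p0 k (z : 'cV[C]_k) : 0 <= cdot z z by exact: predot_ge0 cdotP _.
rewrite ger0_norm //; apply: le_trans (MB N _) _.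
apply: le_trans (_ : `|B * cdot (Y N) (Y N)| <= _).
  apply: real_ler_norm; apply: ger0_real; exact: le_trans (MB N (Y N)).
by rewrite normrM ler_wpM2l.
Qed.

Definition ulift (M : forall N, 'M[C]_(d * h N)) (y : K) : K :=
  ucls (fun N => M N *m urep y N).

(** The uniform bound makes the action independent of the sequence that
    represents a class. *)
Lemma ulift_ucls M Y : unif_bounded M -> bdd Y ->
  ulift M (ucls Y) = ucls (fun N => M N *m Y N).
Proof.
move=> Mb Yb; have rb := bdd_urep (ucls Y).
apply: ucls_eq; [exact: bdd_mul|exact: bdd_mul|].
have db : bdd (fun N => (-1) *: Y N + urep (ucls Y) N) by exact: bddZD.
have e0 : ulim (fun N => cdot ((-1) *: Y N + urep (ucls Y) N) ((-1) *: Y N + urep (ucls Y) N)) = 0.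
  rewrite -(tensdot_ucls um db db) (ucls_linear um _ Yb rb) ucls_urep scaleN1r addNr.
  exact: predot0l (tensdot_predot _ (hdot_predot H)) _.
have [B MB] := Mb.
have mb : bdd (fun N => M N *m ((-1) *: Y N + urep (ucls Y) N)) by exact: bdd_mul.
have -> : (fun N => cdot (M N *m urep (ucls Y) N - M N *m Y N)
                         (M N *m urep (ucls Y) N - M N *m Y N)) =
  (fun N => cdot (M N *m ((-1) *: Y N + urep (ucls Y) N)) (M N *m ((-1) *: Y N + urep (ucls Y) N))).
  apply/funext => N.
  have -> : (-1) *: Y N + urep (ucls Y) N = urep (ucls Y) N - Y N.
    by rewrite scaleN1r addrC.
  by rewrite mulmxBr.
apply/eqP; rewrite eq_le; apply/andP; split.
  rewrite -[X in _ <= X](mulr0 B) -e0 -ulimZ; last exact: bdd_cdot.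
  apply: ler_ulim; [exact: bdd_cdot| |].
    by apply: uboundedM; [exact: ubounded_cst|exact: bdd_cdot].
  by apply: filterS filterT => N _; exact: MB.
apply: ulim_ge0; first exact: bdd_cdot.
by apply: filterS filterT => N _; exact: predot_ge0 cdotP _.
Qed.

Lemma ulift_linear M : unif_bounded M -> linear (ulift M).
Proof.
move=> Mb a x y.
have xb := bdd_urep x; have yb := bdd_urep y.
have mx := bdd_mul Mb xb; have my := bdd_mul Mb yb.
have bb := bddZD a xb yb.
rewrite -{1}(ucls_urep x) -{1}(ucls_urep y) -(ucls_linear um a xb yb) (ulift_ucls Mb bb).
rewrite /ulift -(ucls_linear um a mx my).
by congr ucls; apply: functional_extensionality_dep => N; rewrite linearP.
Qed.

Lemma unif_bounded_tens (A : 'M[C]_d) :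
  unif_bounded (fun N => tensmx A (1%:M : 'M[C]_(h N))).
Proof.
pose S := \sum_i \sum_l `|A i l|.
have S0 : 0 <= S by do 2!apply: sumr_ge0 => ? _.
exists (S ^+ 2 *+ d) => N v.
have p0 k (z : 'cV[C]_k) : 0 <= cdot z z by exact: predot_ge0 cdotP _.
set s := cdot v v.
have sp l : pnorm (@cdot R _) (blk v l) <= sqrtC s.
  rewrite ler_sqrtC ?nnegrE ?p0 // /s cdot_blk (bigD1 l) //= lerDl.
  by apply: sumr_ge0.
rewrite cdot_blk mulrnAl -[X in _ *+ X]card_ord -sumr_const; apply: ler_sum => i _.
rewrite -pnormK -[s]sqrtCK -exprMn ler_pXn2r ?nnegrE ?mulr_ge0 ?sqrtC_ge0 ?p0 //.
rewrite blk_tensmx; apply: le_trans (ler_pnorm_sum cdotP _ _ _) _.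
apply: le_trans (_ : \sum_l `|A i l| * sqrtC s <= _).
  apply: ler_sum => l _; rewrite (pnormZ cdotP) mul1mx.
  by rewrite ler_wpM2l.
rewrite -mulr_suml; apply: ler_wpM2r; first by rewrite sqrtC_ge0 p0.
by rewrite [leRHS](bigD1 i) //= lerDl; do 2!apply: sumr_ge0 => ? _.
Qed.

End UltraLift.

(** * Realization on a Hilbert space *)

Section Realization.
Variable R : realType.
Local Notation C := (Cplx R).

Lemma linear_pack (U V : lmodType C) (f : U -> V) : linear f ->
  exists F : {linear U -> V}, forall x, F x = f x.
Proof.
move=> fl; pose F := HB.pack_for {linear U -> V} f (GRing.isLinear.Build C U V *:%R f fl).
by exists F.
Qed.

Lemma tensop_linear (U V : lmodType C) (T : U -> V) m n (M : 'M[C]_(m, n)) :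
  linear T -> linear (tensop T M).
Proof.
move=> Tl a x y; apply/ffunP => i; rewrite tens_linearE !ffunE.
rewrite scaler_sumr -big_split; apply: eq_bigr => k _ /=.
by rewrite tens_linearE Tl scalerDr !scalerA mulrC.
Qed.

Lemma linear_fun (U V : lmodType C) (F : {linear U -> V}) : linear F.
Proof. by move=> a x y; rewrite linearP. Qed.

Lemma id_linear (U : lmodType C) : linear (@id U). Proof. by []. Qed.

Lemma tensop_adj (U V : lmodType C) (dotU : U -> U -> C) (dotV : V -> V -> C)
    (T : U -> V) (S : V -> U) m n (M : 'M[C]_(m, n)) x y :
  predot dotU -> predot dotV -> adjoint_op dotU dotV T S ->
  tensdot dotV (tensop T M x) y = tensdot dotU x (tensop S (M^t* ) y).
Proof.
move=> dU dV TS; rewrite /tensdot.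
transitivity (\sum_i \sum_k M i k * dotV (T (x k)) (y i)).
  apply: eq_bigr => i _; rewrite ffunE (predot_suml dV); apply: eq_bigr => k _.
  by rewrite (predotZl dV).
rewrite exchange_big; apply: eq_bigr => k _ /=.
rewrite ffunE (predot_sumr dU); apply: eq_bigr => i _.
by rewrite (predotZr dU) TS !mxE conjCK.
Qed.

Section Hilbert.
Variables (g d e : nat) (A : 'I_g -> 'M[C]_d) (Gc : word g -> 'M[C]_e).

(** The operators R_j = (U - I) (I (x) A_j). *)
Definition rmap (H : lmodType C) (U : tens H d -> tens H d) j (x : tens H d) : tens H d :=
  U (ampl A j x) - ampl A j x.

Definition realizes (H : hilbertType R) (U : {linear tens H d -> tens H d})
    (V : {linear 'cV[C]_e -> tens H d}) : Prop :=
  let dotK := tensdot (@hdot R H) (n := d) in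
  [/\ unitary_op dotK U, isometry_op (@cdot R e) dotK V &
   forall j a v, Gc (j :: a) *m v = adjc dotK V (U (ampl A j (opword (rmap U) a (V v))))].

Record finite_realization (N : nat) := FiniteRealization {
  fr_dim : nat;
  fr_U : 'M[C]_(d * fr_dim);
  fr_V : 'M[C]_(d * fr_dim, e);
  fr_unitary : fr_U *m fr_U^t* = 1%:M;
  fr_unitary' : fr_U^t* *m fr_U = 1%:M;
  fr_isometry : fr_V^t* *m fr_V = 1%:M;
  fr_coef : forall j (a : word g), (size a < N)%N ->
    fr_V^t* *m fr_U *m tensmx (A j) 1%:M *m
      wordmx (fun j => (fr_U - 1%:M) *m tensmx (A j) 1%:M) a *m fr_V = Gc (j :: a) }.

(** The unitaries realizing ever longer initial segments of G pass to the
    ultraproduct, where they realize all of G. *)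
Theorem realization_exists :
  (forall N, inhabited (finite_realization N)) -> exists H U V, @realizes H U V.
Proof.
move=> fin.
have [f _] : exists f : forall N, finite_realization N, True.
  have ex N : exists x : finite_realization N, True by have [x] := fin N; exists x.
  by exists (fun N => projT1 (cid (ex N))).
pose h N := fr_dim (f N).
pose U N : 'M[C]_(d * h N) := fr_U (f N).
pose V N : 'M[C]_(d * h N, e) := fr_V (f N).
pose bA N j := tensmx (A j) (1%:M : 'M[C]_(h N)).
pose Rm N j := (U N - 1%:M) *m bA N j.
have UU N : U N *m (U N)^t* = 1%:M := fr_unitary (f N).
have UU' N : (U N)^t* *m U N = 1%:M := fr_unitary' (f N).
have VV N : (V N)^t* *m V N = 1%:M := fr_isometry (f N).
have VG N j (a : word g) : (size a < N)%N ->
    (V N)^t* *m U N *m bA N j *m wordmx (Rm N) a *m V N = Gc (j :: a) := @fr_coef _ (f N) j a.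
clearbody U V; clear fin; clearbody h.
have [um] := ultramodel_exists R h d.
pose H := um_space um.
pose dotK := tensdot (@hdot R H) (n := d).
have Ub : unif_bounded (fun N => U N).
  by exists 1 => N v; rewrite mul1r cdot_adj mulmxA UU' mul1mx.
have Sb : unif_bounded (fun N => (U N)^t* ).
  by exists 1 => N v; rewrite mul1r cdot_adj trmxCK mulmxA UU mul1mx.
have [Ul UlE] := linear_pack (ulift_linear (um := um) Ub).
have [Sl SlE] := linear_pack (ulift_linear (um := um) Sb).
have Vb (v : 'cV[C]_e) : bdd (fun N => V N *m v).
  by exists `|cdot v v| => N; rewrite cdot_adj mulmxA VV mul1mx.
have Vlin : linear (fun v => ucls um (fun N => V N *m v)).
  move=> a x y; rewrite -(ucls_linear um a (Vb x) (Vb y)); congr ucls.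
  by apply: functional_extensionality_dep => N; rewrite linearP.
have [Vl VlE] := linear_pack Vlin.
exists H, Ul, Vl; split.
- exists Sl; split=> [x y|x|x].
  + rewrite UlE SlE.
    rewrite -{1}(ucls_urep y) -{2}(ucls_urep x).
    have xb := bdd_urep x; have yb := bdd_urep y.
    rewrite /ulift (tensdot_ucls um (bdd_mul Ub xb) yb) (tensdot_ucls um xb (bdd_mul Sb yb)).
    by congr ulim; apply/funext => N; rewrite cdot_adj.
  + have xb := bdd_urep x.
    rewrite UlE SlE [ulift (fun N => U N) x]/ulift (ulift_ucls um Sb (bdd_mul Ub xb)) -[RHS](ucls_urep x).
    by congr ucls; apply: functional_extensionality_dep => N; rewrite mulmxA UU' mul1mx.
  + have xb := bdd_urep x.
    rewrite UlE SlE [ulift (fun N => (U N)^t* ) x]/ulift (ulift_ucls um Ub (bdd_mul Sb xb)) -[RHS](ucls_urep x).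
    by congr ucls; apply: functional_extensionality_dep => N; rewrite mulmxA UU mul1mx.
- move=> u v; rewrite !VlE (tensdot_ucls um (Vb u) (Vb v)).
  rewrite -[RHS](@ulim_cst R); congr ulim; apply/funext => N.
  by rewrite cdot_adj mulmxA VV mul1mx.
have Ab j : unif_bounded (fun N => bA N j) by exact: unif_bounded_tens.
have amplE j Y : bdd Y -> ampl A j (ucls um Y) = ucls um (fun N => bA N j *m Y N).
  by move=> Yb; apply: ucls_ampl => //; exact: bdd_mul (Ab j) Yb.
have wordb (a : word g) v : bdd (fun N => wordmx (Rm N) a *m (V N *m v)) /\
    opword (rmap Ul) a (Vl v) = ucls um (fun N => wordmx (Rm N) a *m (V N *m v)).
  elim: a => [|j a [Yb IH]].
    have e0 : (fun N => wordmx (Rm N) [::] *m (V N *m v)) = (fun N => V N *m v).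
      by apply: functional_extensionality_dep => N; rewrite wordmx_nil mul1mx.
    by rewrite e0; split; [exact: Vb|exact: VlE].
  set Y := (fun N => wordmx (Rm N) a *m (V N *m v)) in Yb IH *.
  have Zb := bdd_mul (Ab j) Yb; have UZb := bdd_mul Ub Zb.
  have e1 : (fun N => wordmx (Rm N) (j :: a) *m (V N *m v)) =
      (fun N => (-1) *: (bA N j *m Y N) + U N *m (bA N j *m Y N)).
    apply: functional_extensionality_dep => N.
    by rewrite wordmx_cons /Rm /Y -!mulmxA mulmxBl mul1mx scaleN1r addrC.
  rewrite e1; split; first exact: (bddZD (-1) Zb UZb).
  rewrite (ucls_linear um (-1) Zb UZb) /= IH /rmap (amplE j Y Yb) UlE (ulift_ucls um Ub Zb).
  by rewrite scaleN1r addrC.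
move=> j a v; apply/colP => i; rewrite [RHS]mxE.
have [Yb ->] := wordb a v.
have Zb := bdd_mul (Ab j) Yb; have UZb := bdd_mul Ub Zb.
rewrite (amplE j _ Yb) UlE (ulift_ucls um Ub Zb) VlE (tensdot_ucls um UZb (Vb _)).
rewrite -[LHS](@ulim_cst R); apply: ulim_eq.
apply: filterS (freeU_ge (size a).+1) => N /= aN.
rewrite -(VG N j a aN) -[LHS]cdot_delta -!mulmxA cdot_adj trmxCK.
by [].
Qed.

Variables (H : hilbertType R) (U : {linear tens H d -> tens H d})
  (V : {linear 'cV[C]_e -> tens H d}).
Hypothesis UV : realizes U V.
Local Notation dotK := (tensdot (@hdot R H) (n := d)).
Local Notation Rm := (rmap U).
Local Notation bA := (ampl (H := H) A).

Lemma dotK_predot : predot dotK.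
Proof. by apply: tensdot_predot; exact: hdot_predot. Qed.

Lemma ampl_linear (B : 'I_g -> 'M[C]_d) j : linear (ampl (H := H) B j).
Proof. exact: tensop_linear (@id_linear _). Qed.

Lemma rmap_linear j : linear (Rm j).
Proof.
move=> a x y; rewrite /rmap !ampl_linear linearP scalerBr.
by rewrite opprD addrACA.
Qed.

Lemma opword_linear a : linear (opword Rm a).
Proof.
elim: a => [|j a IH] k x y //=.
by rewrite IH rmap_linear.
Qed.

Lemma ampl_adj j x y :
  dotK (ampl (fun j => (A j)^t* ) j x) y = dotK x (bA j y).
Proof.
rewrite /ampl (tensop_adj (dotU := @hdot R H) (S := id)) ?trmxCK //; exact: hdot_predot.
Qed.

Lemma unitary_dot x y : dotK (U x) (U y) = dotK x y.
Proof. by case: UV => -[S [US SU _] _ _]; rewrite US SU. Qed.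

(** As W_(x_j a) + A_j W_a = U A_j W_a, each coefficient of W^* L_A W that should
    vanish is a difference of inner products equal by unitarity of U. *)
Lemma formal_identity_realization (W : word g -> {linear 'cV[C]_e -> tens H d}) :
  (forall a v, W a v = opword Rm a (V v)) -> formal_identity A Gc W.
Proof.
move=> WE; have dP := dotK_predot.
have Wcons j a v : W (j :: a) v = U (bA j (W a v)) - bA j (W a v) by rewrite !WE.
split=> [a b j k v|k a v|v].
- apply/colP => i; rewrite !mxE !Wcons ampl_adj.
  rewrite !(predotBl dP) !(predotBr dP) unitary_dot; ring.
- rewrite Wcons addrC subrK; case: UV => _ _ ->; rewrite WE.
  by apply/colP => i; rewrite !mxE WE.
apply/colP => i; rewrite mxE !WE /=.
by case: UV => _ iso _; rewrite iso cdot_delta.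
Qed.

(** Two terms of each Cauchy product survive, those where the factor from
    I - sum_j R_j x_j has degree 0 or 1, and they cancel. *)
Lemma fps_inverse_realization (J : word g -> {linear tens H d -> tens H d}) :
  (forall a x, J a x = opword Rm a x) ->
  fps_inverse (fps_sub (fps_const id) (fps_lin Rm)) J.
Proof.
move=> JE.
have fE a x : fps_sub (fps_const id) (fps_lin Rm) a x =
    if a is [::] then x else if a is [:: j] then - Rm j x else 0.
  by rewrite /fps_sub /fps_const /fps_lin; case: a => [|j [|k a]]; rewrite ?subr0 ?sub0r.
split; apply/funext => a; apply/funext => x; rewrite /fps_mul.
  case: a => [|j a]; first by rewrite big_ord_recl big_ord0 addr0 fE JE.
  rewrite big_ord_recl big_ord_recl big1 ?addr0 => [|i _].
    by rewrite !fE /= take0 drop0 !JE /= addrN.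
  by rewrite fE /=; case: a i => [[]|k a i].
case/lastP: a => [|a j]; first by rewrite big_ord_recl big_ord0 addr0 fE JE.
rewrite size_rcons big_ord_recr big_ord_recr /= big1 ?add0r => [|i _]; last first.
  rewrite fE drop_rcons; last exact: ltnW.
  case: (drop i a) (size_drop i a) => [|k [|l b]] /=; rewrite ?linear0 //.
  by move/esym/eqP; rewrite subn_eq0 leqNgt ltn_ord.
rewrite -cats1 drop_size_cat // take_size_cat //.
rewrite take_oversize ?drop_oversize ?size_cat ?addn1 // !fE !JE /opword foldr_cat /=.
have [F FE] := linear_pack (opword_linear a).
rewrite -[foldr _ _ a]/(opword Rm a _) -[X in _ + X]/(opword Rm a (Rm j x)).
by rewrite -!FE linearN addNr; case: (a).
Qed.

End Hilbert.
End Realization.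

(** * Neumann series *)

Section Neumann.
Variable R : realType.
Local Notation C := (Cplx R).

(** A norm on a bare module, with completeness along sequences with geometric
    steps. *)
Record complete_norm (K : lmodType C) (q : K -> C) : Prop := CompleteNorm {
  cn_ge0 : forall x, 0 <= q x;
  cn_triangle : forall x y, q (x + y) <= q x + q y;
  cn_scale : forall a x, q (a *: x) = `|a| * q x;
  cn_eq0 : forall x, q x = 0 -> x = 0;
  cn_complete : forall (s : nat -> K) (c : C), 0 <= c ->
    (exists N0, forall N, (N0 <= N)%N -> q (s N.+1 - s N) <= (2 ^+ N)^-1 * c) ->
    exists l, forall eps, 0 < eps -> exists N0, forall N, (N0 <= N)%N -> q (s N - l) < eps }.

Definition cn_lim (K : lmodType C) (q : K -> C) (s : nat -> K) (l : K) : Prop :=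
  forall eps, 0 < eps -> exists N0, forall N, (N0 <= N)%N -> q (s N - l) < eps.

Variables (K : lmodType C) (q : K -> C) (qP : complete_norm q).

Lemma cnN x : q (- x) = q x.
Proof. by rewrite -scaleN1r (cn_scale qP) normrN1 mul1r. Qed.

Lemma cn0 : q 0 = 0.
Proof. by rewrite -(scale0r 0) (cn_scale qP) normr0 mul0r. Qed.

Lemma cn_sum I (r : seq I) (F : I -> K) : q (\sum_(i <- r) F i) <= \sum_(i <- r) q (F i).
Proof.
elim/big_rec2: _ => [|i x y _ h]; first by rewrite cn0.
by apply: le_trans (cn_triangle qP _ _) _; rewrite lerD2l.
Qed.

Lemma cn_lim_unique s l l' : cn_lim q s l -> cn_lim q s l' -> l = l'.
Proof.
move=> sl sl'; apply/eqP; rewrite -subr_eq0; apply/eqP/(cn_eq0 qP)/eqP.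
have q0 := cn_ge0 qP (l - l'); move: q0; rewrite le0r => /orP [//|q0].
have q2 : 0 < q (l - l') / 2 by rewrite divr_gt0.
have [N0 h] := sl _ q2; have [N1 h'] := sl' _ q2.
have := ltrD (h _ (leq_maxl N0 N1)) (h' _ (leq_maxr N0 N1)).
rewrite -splitr => /(le_lt_trans _) lt; have : q (l - l') < q (l - l'); last by rewrite ltxx.
apply: lt; rewrite -(cnN (_ - l)); apply: le_trans (cn_triangle qP _ _).
by rewrite opprB addrA subrK.
Qed.

Lemma cn_lim_lin s s' l l' a : cn_lim q s l -> cn_lim q s' l' ->
  cn_lim q (fun N => a *: s N + s' N) (a *: l + l').
Proof.
move=> sl sl' eps eps0.
have a1 : 0 < `|a| + 1 by rewrite ltr_wpDl.
have e2 : 0 < eps / 2 / (`|a| + 1) by rewrite !divr_gt0.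
have [N0 h] := sl _ e2.
have [N1 h'] := sl' (eps / 2) (divr_gt0 eps0 (ltr0n _ 2)).
exists (maxn N0 N1) => N; rewrite geq_max => /andP [/h hN /h' hN'].
rewrite opprD addrACA -scalerBr [eps]splitr.
apply: le_lt_trans (cn_triangle qP _ _) _; rewrite ltr_leD ?(ltW hN') // (cn_scale qP).
have [->|a0] := eqVneq a 0; first by rewrite normr0 mul0r divr_gt0.
apply: lt_trans (_ : `|a| * (eps / 2 / (`|a| + 1)) < _).
  by rewrite ltr_pM2l ?normr_gt0.
rewrite mulrCA gtr_pMr ?divr_gt0 //.
by rewrite ltr_pdivrMr // mul1r ltrDl.
Qed.

Variable T : {linear K -> K}.
Hypothesis T_bounded : exists2 M, 0 <= M & forall x, q (T x) <= M * q x.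
Hypothesis T_decay : forall x, exists2 c, 0 <= c &
  exists N0, forall N, (N0 <= N)%N -> q (iter N T x) <= (2 ^+ N)^-1 * c.

Lemma iter_linear N : linear (iter N T).
Proof. by elim: N => [|N IH] a x y //=; rewrite IH linearP. Qed.

Lemma iter_cn_lim0 x : cn_lim q (fun N => iter N T x) 0.
Proof.
move=> eps eps0; have [c c0 [N0 h]] := T_decay x.
have [N1 h1] := pow2_small c0 eps0.
exists (maxn N0 N1) => N; rewrite geq_max => /andP [/h hN /h1 hN'].
by rewrite subr0 (le_lt_trans hN).
Qed.

Lemma cn_lim_bounded (S : {linear K -> K}) s l : (exists2 M, 0 <= M & forall x, q (S x) <= M * q x) ->
  cn_lim q s l -> cn_lim q (fun N => S (s N)) (S l).
Proof.
move=> [M M0 MS] sl eps eps0.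
have M1 : 0 < M + 1 by rewrite ltr_wpDl.
have [N0 h] := sl _ (divr_gt0 eps0 M1); exists N0 => N /h hN.
rewrite -linearB; apply: le_lt_trans (MS _) _.
rewrite -(@ltr_pM2l _ (M + 1)) // in hN.
rewrite mulrCA mulfV ?gt_eqF // mulr1 in hN.
by apply: le_lt_trans hN; rewrite mulrDl mul1r lerDl (cn_ge0 qP).
Qed.

(** T need not be a contraction: geometric decay of each orbit, from some power on
    that depends on the vector, makes the series converge, and boundedness of T
    lets T pass through the limit. *)
Theorem neumann_series : exists J : {linear K -> K},
  [/\ forall x, cn_lim q (fun N => \sum_(i < N) iter i T x) (J x),
      cancel (fun x => x - T x) J & cancel J (fun x => x - T x)].
Proof.
have ex x : exists l, cn_lim q (fun N => \sum_(i < N) iter i T x) l.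
  have [c c0 [N0 h]] := T_decay x.
  apply: (cn_complete qP c0); exists N0 => N /h; rewrite big_ord_recr /=.
  by rewrite addrAC subrr add0r.
have [j jP] := choice ex.
have itB N a x y : iter N T (a *: x + y) = a *: iter N T x + iter N T y by rewrite iter_linear.
have jl : linear j.
  move=> a x y; apply: cn_lim_unique (jP _) _ => eps eps0.
  have [N0 h] := cn_lim_lin a (jP x) (jP y) eps0.
  exists N0 => N /h; rewrite scaler_sumr -big_split /=.
  by under eq_bigr do rewrite -itB.
have [J JE] := linear_pack jl; exists J.
have tele N x : \sum_(i < N) iter i T x - \sum_(i < N) iter i T (T x) = x - iter N T x.
  elim: N => [|N IH]; first by rewrite !big_ord0 !subrr.
  rewrite !big_ord_recr /= opprD addrACA IH -iterSr /=.
  by rewrite addrA subrK.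
have JP x : cn_lim q (fun N => \sum_(i < N) iter i T x) (J x) by rewrite JE; exact: jP.
have limB x : cn_lim q (fun N => x - iter N T x) x.
  move=> eps /(iter_cn_lim0 x) [N0 h]; exists N0 => N /h.
  by rewrite subr0 addrAC subrr add0r cnN.
have JT x : J x - J (T x) = x.
  apply: cn_lim_unique (limB x) => eps eps0.
  have [N0 h] := cn_lim_lin (-1) (JP (T x)) (JP x) eps0.
  by exists N0 => N /h; rewrite !scaleN1r ![- _ + _]addrC tele.
split=> // x; first by rewrite linearB JT.
rewrite -[RHS]JT; congr (_ - _).
have h := cn_lim_bounded T_bounded (JP x).
apply: cn_lim_unique h _ => eps /(JP (T x)) [N0 h]; exists N0 => N /h.
by rewrite linear_sum; under eq_bigr do rewrite -iterSr.
Qed.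

End Neumann.

(** * Norm estimates on amplifications *)

Section Ell1.
Variable R : realType.
Local Notation C := (Cplx R).

Definition ell1 (V : lmodType C) (p : V -> C) n (x : tens V n) : C := \sum_k p (x k).

Lemma ell1_ge0 (V : lmodType C) (p : V -> C) n (x : tens V n) :
  (forall y, 0 <= p y) -> 0 <= ell1 p x.
Proof. by move=> p0; apply: sumr_ge0. Qed.

Lemma le_ell1 (V : lmodType C) (p : V -> C) n (x : tens V n) k :
  (forall y, 0 <= p y) -> p (x k) <= ell1 p x.
Proof. by move=> p0; rewrite /ell1 (bigD1 k) //= lerDl sumr_ge0. Qed.

Lemma ell1_complete (V : lmodType C) (p : V -> C) n :
  complete_norm p -> complete_norm (ell1 p (n := n)).
Proof.
move=> pP; split=> [x|x y|a x|x|s c c0 [N0 h]].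
- by apply: ell1_ge0; exact: cn_ge0 pP.
- rewrite /ell1 -big_split /=; apply: ler_sum => k _.
  by rewrite ffunE (cn_triangle pP).
- by rewrite /ell1 mulr_sumr; apply: eq_bigr => k _; rewrite ffunE (cn_scale pP).
- move=> x0; apply/ffunP => k; rewrite ffunE; apply: (cn_eq0 pP).
  apply/eqP; rewrite eq_le (cn_ge0 pP) andbT -x0.
  by apply: le_ell1; exact: cn_ge0 pP.
have ex k : exists l, cn_lim p (fun N => s N k) l.
  apply: (cn_complete pP c0); exists N0 => N /h; apply: le_trans.
  have -> : s N.+1 k - s N k = (s N.+1 - s N) k by rewrite !ffunE.
  by apply: le_ell1; exact: cn_ge0 pP.
have [l lP] := choice ex; exists [ffun k => l k] => eps eps0.
have en : 0 < eps / n.+1%:R by rewrite divr_gt0 ?ltr0n.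
have [N1 N1P] := choice (fun k => lP k _ en).
exists (\max_k N1 k)%N => N /bigmax_leqP hN.
apply: le_lt_trans (_ : \sum_(k < n) eps / n.+1%:R < _).
  apply: ler_sum => k _; rewrite !ffunE; apply: ltW; apply: N1P; exact: hN.
rewrite sumr_const card_ord -[_ *+ n]mulr_natr mulrAC ltr_pdivrMr ?ltr0n //.
by rewrite ltr_pM2l // ltr_nat.
Qed.

Lemma hilbert_complete_norm (H : hilbertType R) : complete_norm (fun x : H => `|x|).
Proof.
split=> [x|x y|a x|x|s c c0 [N0 h]]; rewrite ?normr_ge0 ?ler_normD ?normrZ //.
  by move/eqP; rewrite normr_eq0 => /eqP.
(* The tail of a geometric series; the factor 1 - 2^-m makes the induction work. *)
have tele N m : (N0 <= N)%N -> `|s (N + m)%N - s N| <= (2 ^+ N)^-1 * c * 2.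
  move=> hN; apply: le_trans (_ : (2 ^+ N)^-1 * c * 2 * (1 - (2 ^+ m)^-1) <= _); last first.
    by rewrite ler_piMr ?mulr_ge0 ?invr_ge0 ?exprn_ge0 // gerBl invr_ge0 exprn_ge0.
  elim: m => [|m IH]; first by rewrite addn0 !subrr normr0 expr0 invr1 subrr mulr0.
  rewrite addnS -[s _.+1](subrK (s (N + m)%N)) -addrA; apply: le_trans (ler_normD _ _) _.
  apply: le_trans (lerD (h _ (leq_trans hN (leq_addr _ _))) IH) _.
  rewrite exprD exprS !invfM le_eqVlt; apply/orP; left; apply/eqP.
  have : (2 : C) != 0 by rewrite pnatr_eq0.
  move: (2 ^+ N)^-1 (2 ^+ m)^-1 => a b two; by field.
have cs : cvg (s @ \oo).
  apply/cauchy_cvgP/cauchy_exP => eps eps0.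
  have [N1 h1] := pow2_small (mulr_ge0 c0 (ler0n _ 2)) eps0.
  exists (s (maxn N0 N1)); exists (maxn N0 N1) => // N /= hN.
  rewrite /= -ball_normE /= distrC -[N](subnKC hN).
  apply: le_lt_trans (tele _ _ (leq_maxl _ _)) _.
  by rewrite -mulrA h1 ?leq_maxr.
exists (lim (s @ \oo)) => eps eps0.
have /cvgrPdist_lt/(_ eps eps0) [N1 _ h1] := cs.
by exists N1 => N /h1 /=; rewrite distrC.
Qed.

Definition entry_sum m n (M : 'M[C]_(m, n)) : C := \sum_i \sum_k `|M i k|.

Lemma entry_sum_ge0 m n (M : 'M[C]_(m, n)) : 0 <= entry_sum M.
Proof. by apply: sumr_ge0 => i _; apply: sumr_ge0. Qed.

Lemma ell1_tensop (U V : lmodType C) (p : U -> C) (q : V -> C) (T : U -> V) m n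
    (M : 'M[C]_(m, n)) (b : C) x : complete_norm p -> complete_norm q -> 0 <= b ->
  (forall y, q (T y) <= b * p y) ->
  ell1 q (tensop T M x) <= entry_sum M * b * ell1 p x.
Proof.
move=> pP qP b0 Tb; rewrite /ell1 /entry_sum -mulrA mulr_suml; apply: ler_sum => i _.
rewrite ffunE mulr_suml; apply: le_trans (cn_sum qP _ _) _; apply: ler_sum => k _.
rewrite (cn_scale qP) ler_wpM2l //; apply: le_trans (Tb _) _.
by rewrite ler_wpM2l //; apply: le_ell1; exact: cn_ge0 pP.
Qed.

Lemma entry_sum_le m n (M : 'M[C]_(m, n)) : entry_sum M <= (m * n)%:R * (opnorm M)%:C%C.
Proof.
apply: le_trans (_ : \sum_(i < m) \sum_(k < n) (opnorm M)%:C%C <= _).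
  by apply: ler_sum => i _; apply: ler_sum => k _; exact: opnorm_entry.
by rewrite !sumr_const !card_ord -mulrnA mulr_natl mulnC.
Qed.

End Ell1.

Section WordSums.
Variables (R : realType) (g : nat).
Local Notation C := (Cplx R).

Lemma big_tuple_cons (V : nmodType) (I : finType) N (F : seq I -> V) :
  \sum_(a : N.+1.-tuple I) F a = \sum_j \sum_(a : N.-tuple I) F (j :: a).
Proof.
rewrite pair_big /= (reindex (fun p : I * N.-tuple I => [tuple of p.1 :: p.2])) //=.
exists (fun a => (thead a, [tuple of behead a])) => [[j a] _|a _] /=.
  by congr pair; apply: val_inj.
by rewrite -tuple_eta.
Qed.

Lemma tensop_comp (U V W : lmodType C) (T : {linear V -> W}) (F : U -> V) m n k
    (M : 'M[C]_(m, n)) (N : 'M[C]_(n, k)) x :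
  tensop T M (tensop F N x) = tensop (fun y => T (F y)) (M *m N) x.
Proof.
apply/ffunP => i; rewrite !ffunE.
under eq_bigr => l _ do rewrite ffunE linear_sum scaler_sumr.
rewrite exchange_big /=; apply: eq_bigr => l _.
rewrite mxE scaler_suml; apply: eq_bigr => p _.
by rewrite linearZ scalerA.
Qed.

(** A word of length N+1 is a letter followed by a word of length N, in the
    coefficients and in X alike. *)
Lemma iter_linsum (U V : lmodType C) (T : 'I_g -> {linear V -> V}) (F : U -> V) n
    (X : 'I_g -> 'M[C]_n) x N :
  iter N (linsum T X) (tensop F 1%:M x) =
  \sum_(a : N.-tuple 'I_g) tensop (fun y => opword T a (F y)) (wordmx X a) x.
Proof.
elim: N => [|N IH] /=.
  rewrite (big_pred1 [tuple]) => [|a]; first by rewrite /= wordmx_nil.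
  by apply/esym/eqP; exact: tuple0.
rewrite IH (big_tuple_cons N (fun a => tensop (fun y => opword T a (F y)) (wordmx X a) x)).
apply: eq_bigr => j _.
have [S SE] := linear_pack (tensop_linear (X j) (@linear_fun _ _ _ (T j))).
rewrite -SE linear_sum; apply: eq_bigr => a _.
by rewrite SE tensop_comp wordmx_cons.
Qed.

(** The upper limit that defines the spectral radius is less than tau, hence so
    are the N-th roots for N large. *)
Lemma Delta_words n (X : 'I_g -> 'M[C]_n) (tau : R) : 0 < tau -> Delta tau X ->
  exists N0, forall N, (N0 <= N)%N -> forall a : N.-tuple 'I_g, opnorm (wordmx X a) <= tau ^+ N.
Proof.
move=> tau0; rewrite /Delta /spectral_radius /limn_esup /limf_esup.
move=> /ereal_inf_lt [_ [P [N0 _ NP] <-]] lt.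
exists N0.+1 => N hN a.
have N_gt0 : (0 < N)%N by exact: leq_ltn_trans hN.
have {}hN : P N by apply: NP => /=; exact: ltnW.
have le1 : opnorm (wordmx X a) `^ (N%:R^-1) <= tau.
  rewrite -lee_fin; apply/ltW; apply: le_lt_trans lt.
  apply: le_trans (ereal_sup_ubound _); last by exists N.
  by rewrite lee_fin; apply: (@le_bigmax _ _ _ _ (fun a : N.-tuple 'I_g => opnorm (wordmx X a) `^ (N%:R^-1)) a).
rewrite -[opnorm _]powRr1 ?opnorm_ge0 //.
rewrite -[X in _ `^ X](@mulVf _ (N%:R : R)) ?pnatr_eq0 -?lt0n // powRrM powR_mulrn ?powR_ge0 //.
by rewrite lerXn2r ?nnegrE ?powR_ge0 // ltW.
Qed.

End WordSums.

(** * Convergence of a realization *)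

Section Untens.
Variable R : realType.
Local Notation C := (Cplx R).

Definition retens e n (x : tens 'cV[C]_e n) : 'cV[C]_(e * n) :=
  \col_p x (mxtens_unindex p).2 (mxtens_unindex p).1 0.

Lemma retensK e n : cancel (@retens e n) (@untens R e n).
Proof.
move=> x; apply/ffunP => k; rewrite ffunE; apply/colP => i; rewrite !mxE.
by rewrite mxtens_indexK.
Qed.

Lemma untensK e n : cancel (@untens R e n) (@retens e n).
Proof.
move=> u; apply/colP => p; rewrite mxE ffunE mxE.
by case: (mxtens_unindex p) (mxtens_unindexK p) => i k /= ->.
Qed.

Lemma untens_linear e n : linear (@untens R e n).
Proof. by move=> a u v; apply/ffunP => k; rewrite !ffunE; apply/colP => i; rewrite !mxE. Qed.

Lemma retens_linear e n : linear (@retens e n).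
Proof. by move=> a u v; apply/colP => p; rewrite !mxE !ffunE !mxE. Qed.

Lemma tensdot_untens e n (u v : 'cV[C]_(e * n)) :
  tensdot (@cdot R e) (untens u) (untens v) = cdot u v.
Proof.
rewrite cdotE sum_mxtens /tensdot exchange_big /=; apply: eq_bigr => k _.
by rewrite cdotE; apply: eq_bigr => i _; rewrite !ffunE !mxE.
Qed.

Lemma untens_tensmx e n (M : 'M[C]_e) (X : 'M[C]_n) u :
  untens (tensmx M X *m u) = tensop (mulmx M) X (untens u).
Proof.
apply/ffunP => k; rewrite !ffunE; apply/colP => i; rewrite !mxE summxE sum_mxtens exchange_big.
apply: eq_bigr => l _; rewrite [RHS]mxE [X in _ = _ * X]mxE mulr_sumr.
by apply: eq_bigr => q _; rewrite tensmxE ffunE [X in _ = _ * (_ * X)]mxE mulrCA mulrA.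
Qed.

Lemma tensop1 (U V : lmodType C) (T : U -> V) n (x : tens U n) k : tensop T 1%:M x k = T (x k).
Proof.
rewrite ffunE (bigD1 k) //= mxE eqxx scale1r big1 ?addr0 // => l lk.
by rewrite mxE eq_sym (negPf lk) scale0r.
Qed.

Lemma eq_tensop (U V : lmodType C) (S T : U -> V) m n (M : 'M[C]_(m, n)) (x : tens U n) :
  S =1 T -> tensop S M x = tensop T M x.
Proof. by move=> ST; apply/ffunP => k; rewrite !ffunE; apply: eq_bigr => l _; rewrite ST. Qed.

End Untens.

Section Convergence.
Variables (R : realType) (g d e : nat) (A : 'I_g -> 'M[Cplx R]_d) (Gc : word g -> 'M[Cplx R]_e).
Local Notation C := (Cplx R).
Hypothesis Gc0 : Gc [::] = 0.
Variables (H : hilbertType R) (U : {linear tens H d -> tens H d})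
  (V : {linear 'cV[C]_e -> tens H d}).
Hypothesis UV : realizes A Gc U V.
Local Notation dotK := (tensdot (@hdot R H) (n := d)).
Local Notation Rm := (rmap A U).
Local Notation bA := (ampl (H := H) A).
Local Notation VsU := (fun h : tens H d => adjc dotK V (U h)).
Local Notation p := (ell1 (fun x : H => `|x|) (n := d)).
Local Notation q n := (ell1 p (n := n)).

Lemma p_complete : complete_norm p.
Proof. apply: ell1_complete; exact: hilbert_complete_norm. Qed.

Lemma q_complete n : complete_norm (q n).
Proof. apply: ell1_complete; exact: p_complete. Qed.

Lemma dotK_norm (y : tens H d) : dotK y y = \sum_l `|y l| ^+ 2.
Proof. by apply: eq_bigr => l _; rewrite hdot_norm. Qed.

Lemma pnorm_le_ell1 y : pnorm dotK y <= p y.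
Proof.
have p0 := cn_ge0 p_complete y.
rewrite -(ler_pXn2r (ltn0Sn 1)) ?nnegrE ?pnorm_ge0 //; last exact: dotK_predot.
rewrite pnormK dotK_norm expr2 {1}/ell1 mulr_suml; apply: ler_sum => l _.
by rewrite expr2 ler_wpM2l // (le_ell1 (p := fun x : H => `|x|)).
Qed.

Lemma entry_le_pnorm (y : tens H d) l : `|y l| <= pnorm dotK y.
Proof.
rewrite -(ler_pXn2r (ltn0Sn 1)) ?nnegrE ?pnorm_ge0 //; last exact: dotK_predot.
by rewrite pnormK dotK_norm (bigD1 l) //= lerDl sumr_ge0 // => i _; rewrite exprn_ge0.
Qed.

Lemma pnorm_unitary y : pnorm dotK (U y) = pnorm dotK y.
Proof. by rewrite /pnorm (unitary_dot UV). Qed.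

Lemma ell1_unitary y : p (U y) <= d%:R * p y.
Proof.
apply: le_trans (_ : \sum_(l < d) p y <= _); last by rewrite sumr_const card_ord mulr_natl.
apply: ler_sum => l _; apply: le_trans (entry_le_pnorm _ _) _.
by rewrite pnorm_unitary pnorm_le_ell1.
Qed.

Lemma ell1_ampl j y : p (bA j y) <= entry_sum (A j) * p y.
Proof.
rewrite -[entry_sum _]mulr1; apply: ell1_tensop => [||//|x]; try exact: hilbert_complete_norm.
by rewrite mul1r.
Qed.

Lemma entry_sum_le_all j : entry_sum (A j) <= \sum_i entry_sum (A i).
Proof. by rewrite (bigD1 j) //= lerDl sumr_ge0 // => i _; exact: entry_sum_ge0. Qed.

Lemma rmap_bounded : exists2 M, 0 <= M & forall j y, p (Rm j y) <= M * p y.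
Proof.
pose S := \sum_i entry_sum (A i).
have S0 : 0 <= S by apply: sumr_ge0 => i _; exact: entry_sum_ge0.
exists ((d%:R + 1) * S) => [|j y]; first by rewrite mulr_ge0 ?addr_ge0.
have py := cn_ge0 p_complete y.
have bAj : p (bA j y) <= S * p y.
  by apply: le_trans (ell1_ampl j y) _; rewrite ler_wpM2r // entry_sum_le_all.
apply: le_trans (cn_triangle p_complete _ _) _; rewrite (cnN p_complete) -mulrA mulrDl mul1r.
rewrite lerD //; apply: le_trans (ell1_unitary _) _.
by rewrite ler_wpM2l.
Qed.

Lemma opword_bounded M : 0 <= M -> (forall j y, p (Rm j y) <= M * p y) ->
  forall (a : word g) y, p (opword Rm a y) <= M ^+ size a * p y.
Proof.
move=> M0 RM; elim=> [|j a IH] y /=; first by rewrite mul1r.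
by apply: le_trans (RM _ _) _; rewrite exprS -mulrA ler_wpM2l.
Qed.

Lemma ell1_linsum n (T : 'I_g -> tens H d -> tens H d) (X : 'I_g -> 'M[C]_n) :
  (exists2 M, 0 <= M & forall j y, p (T j y) <= M * p y) ->
  exists2 M, 0 <= M & forall x, q n (linsum T X x) <= M * q n x.
Proof.
move=> [M M0 TM]; exists (\sum_j entry_sum (X j) * M) => [|x].
  by apply: sumr_ge0 => j _; rewrite mulr_ge0 ?entry_sum_ge0.
apply: le_trans (cn_sum (q_complete n) _ _) _; rewrite mulr_suml; apply: ler_sum => j _.
by apply: ell1_tensop => //; exact: p_complete.
Qed.

Lemma linsum_linear n (T : 'I_g -> tens H d -> tens H d) (X : 'I_g -> 'M[C]_n) :
  (forall j, linear (T j)) -> linear (linsum T X).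
Proof.
move=> Tl a x y; rewrite /linsum scaler_sumr -big_split; apply: eq_bigr => j _ /=.
exact: tensop_linear.
Qed.

Lemma iter_linsum_rmap (W0 : lmodType C) (F : W0 -> tens H d) n (X : 'I_g -> 'M[C]_n) x N :
  iter N (linsum Rm X) (tensop F 1%:M x) =
  \sum_(a : N.-tuple 'I_g) tensop (fun y => opword Rm a (F y)) (wordmx X a) x.
Proof.
have [Rl RlE] := choice (fun j => linear_pack (rmap_linear A U j)).
have -> : Rm = (fun j => Rl j : tens H d -> tens H d) by apply/funext => j; apply/funext => y.
exact: iter_linsum.
Qed.

(** The N-th power of sum_j R_j (x) X_j is a sum over g^N words, each of size at
    most (tau M)^N up to a constant when M bounds the R_j; tau is chosen such that
    g tau M <= 1/2. *)
Lemma linsum_decay : exists2 tau : R, 0 < tau &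
  forall n (X : 'I_g -> 'M[C]_n), Delta tau X -> forall x, exists2 c, 0 <= c &
  exists N0, forall N, (N0 <= N)%N -> q n (iter N (linsum Rm X) x) <= (2 ^+ N)^-1 * c.
Proof.
have [M M0 RM] := rmap_bounded.
have ME : (complex.Re M)%:C%C = M by rewrite RRe_real // ger0_real.
set m := complex.Re M in ME.
have m0 : 0 <= m by rewrite -lecR ME.
have D0 : 0 < 2 * g.+1%:R * (m + 1) by rewrite !mulr_gt0 // ltr_wpDl.
exists (2 * g.+1%:R * (m + 1))^-1; first by rewrite invr_gt0.
set tau := _^-1; move=> n X XD x.
have tau0 : 0 < tau by rewrite invr_gt0.
exists ((n * n)%:R * q n x); first by rewrite mulr_ge0 // (cn_ge0 (q_complete n)).
have [N0 hN0] := Delta_words tau0 XD; exists N0 => N /hN0 hN.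
have xE : x = tensop id 1%:M x by apply/ffunP => k; rewrite tensop1.
rewrite {1}xE iter_linsum_rmap; apply: le_trans (cn_sum (q_complete n) _ _) _.
have qx := cn_ge0 (q_complete n) x.
apply: le_trans (_ : \sum_(a : N.-tuple 'I_g)
    (n * n)%:R * (tau ^+ N)%:C%C * M ^+ N * q n x <= _).
  apply: ler_sum => a _; apply: le_trans (_ : entry_sum (wordmx X a) * M ^+ N * q n x <= _).
    apply: ell1_tensop; rewrite ?exprn_ge0 //; try exact: p_complete.
    by move=> y; rewrite -{2}(size_tuple a); exact: opword_bounded.
  rewrite !ler_wpM2r ?exprn_ge0 //; apply: le_trans (entry_sum_le _) _.
  by rewrite ler_wpM2l // lecR.
rewrite sumr_const card_tuple card_ord -[_ *+ _]mulr_natr.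
have small : (tau ^+ N)%:C%C * M ^+ N * (g ^ N)%:R <= (2 ^+ N)^-1 :> C.
  rewrite natrX rmorphXn -!exprMn -exprVn lerXn2r ?nnegrE ?mulr_ge0 ?invr_ge0 //.
    by rewrite lecR ltW.
  have -> : (g%:R : C) = (g%:R : R)%:C%C by rewrite rmorph_nat.
  have -> : (2^-1 : C) = (2^-1 : R)%:C%C by rewrite fmorphV rmorph_nat.
  rewrite -ME -!rmorphM lecR.
  rewrite /tau -mulrA mulrC ler_pdivrMr // -mulrA mulKf ?pnatr_eq0 //.
  by rewrite mulrC ler_pM // ?lerDl // ler_nat leqnSn.
rewrite [leLHS](_ : _ = (tau ^+ N)%:C%C * M ^+ N * (g ^ N)%:R * ((n * n)%:R * q n x)); last by ring.
by rewrite ler_wpM2r // mulr_ge0.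
Qed.

Lemma VsU_linear : linear VsU.
Proof.
move=> a x y; apply/colP => i; rewrite !mxE linearP.
by rewrite (predot_linear (dotK_predot d H)).
Qed.

Lemma VsU_entry y i : `|VsU y i 0| <= p y.
Proof.
rewrite mxE; apply: le_trans (predot_le (dotK_predot d H) _ _) _.
have -> : pnorm dotK (V (delta_mx i 0)) = 1.
  by case: UV => _ iso _; rewrite /pnorm iso cdot_delta mxE !eqxx sqrtC1.
by rewrite mulr1 pnorm_unitary pnorm_le_ell1.
Qed.

Lemma linsum_rmap n (X : 'I_g -> 'M[C]_n) x :
  linsum Rm X x = tensop U 1%:M (linsum bA X x) - linsum bA X x.
Proof.
apply/ffunP => k; rewrite [RHS]ffunE tensop1 [in RHS]ffunE /linsum !sum_ffunE linear_sum.
rewrite -sumrB; apply: eq_bigr => j _; rewrite !ffunE linear_sum -sumrB.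
by apply: eq_bigr => l _; rewrite linearZ scalerBr.
Qed.

Lemma linsum_adj n (X : 'I_g -> 'M[C]_n) x y :
  tensdot dotK (linsum (ampl (H := H) (fun j => (A j)^t* )) (fun j => (X j)^t* ) x) y =
  tensdot dotK x (linsum bA X y).
Proof.
have dP := dotK_predot d H; have dP2 := tensdot_predot n dP.
rewrite (predot_suml dP2) (predot_sumr dP2); apply: eq_bigr => j _.
by rewrite (tensop_adj (S := bA j) _ _ _ dP dP) ?trmxCK // => u v; exact: ampl_adj.
Qed.

Lemma fps_part_iter (W : word g -> {linear 'cV[C]_e -> tens H d}) n (X : 'I_g -> 'M[C]_n) u N :
  (forall a v, W a v = opword Rm a (V v)) ->
  fps_part W X u N = iter N (linsum Rm X) (tensop V 1%:M (untens u)).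
Proof.
move=> WE; rewrite iter_linsum_rmap; apply: eq_bigr => a _.
exact: eq_tensop.
Qed.

(** The relation G_(x_j a) = V^* U A_j W_a, summed over the words x_j a. *)
Lemma mxfps_partS (W : word g -> {linear 'cV[C]_e -> tens H d}) n (X : 'I_g -> 'M[C]_n) u N :
  (forall a v, W a v = opword Rm a (V v)) ->
  untens (mxfps_part Gc X N.+1 *m u) = tensop VsU 1%:M (linsum bA X (fps_part W X u N)).
Proof.
move=> WE; rewrite /mxfps_part.
have [Vm VmE] := linear_pack VsU_linear.
have [Al AlE] := choice (fun j => linear_pack (ampl_linear (H := H) A j)).
have -> : VsU = Vm by apply/funext => y; rewrite VmE.
have [ut utE] := linear_pack (@untens_linear R e n).
rewrite (big_tuple_cons N (fun a => tensmx (Gc a) (wordmx X a))) mulmx_suml -utE linear_sum.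
have [Vt VtE] := linear_pack (tensop_linear (1%:M : 'M[C]_n) (linear_fun Vm)).
rewrite -VtE linear_sum; apply: eq_bigr => j _.
have -> : bA j = Al j by apply/funext => y; rewrite AlE.
rewrite mulmx_suml linear_sum /fps_part.
have [At AtE] := linear_pack (tensop_linear (X j) (linear_fun (Al j))).
rewrite -AtE !linear_sum; apply: eq_bigr => a _.
rewrite utE untens_tensmx AtE tensop_comp VtE tensop_comp mul1mx wordmx_cons.
apply: eq_tensop => v; rewrite VmE AlE WE.
by case: UV => _ _ ->.
Qed.

(** For w = W(X) u and a = A(X) w, the equation (I - R(X)) w = V u reads
    w + a = V u + U a. Expanding the inner product of two such vectors and using
    that U is unitary and V isometric gives the identity at X. *)
Theorem realization_converges (W : word g -> {linear 'cV[C]_e -> tens H d}) :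
  (forall a v, W a v = opword Rm a (V v)) ->
  exists2 tau : R, 0 < tau &
     forall n (X : 'I_g -> 'M[Cplx R]_n), Delta tau X ->
     exists (GX : 'M[Cplx R]_(e * n))
            (WX : {linear 'cV[Cplx R]_(e * n) -> tens (tens H d) n})
            (JX : {linear tens (tens H d) n -> tens (tens H d) n}),
       series (mxfps_part Gc X) @ \oo --> GX /\
       fps_cvg W X WX /\
       (forall u : 'cV[Cplx R]_(e * n),
          (1%:M + GX + GX^t* ) *m u
          = adjc (tensdot dotK (n := n)) WX (pencil_op A X (WX u))) /\
       cancel (fun h => h - linsum Rm X h) JX /\
       cancel JX (fun h => h - linsum Rm X h) /\
       (forall u, WX u = JX (tensop V 1%:M (untens u))) /\
       (forall u, untens (GX *m u) = tensop VsU 1%:M (linsum bA X (WX u))).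
Proof.
move=> WE; have [tau tau0 decay] := linsum_decay; exists tau => // n X /decay dec.
have [T TE] := linear_pack (linsum_linear X (rmap_linear A U)).
have iterE N x : iter N T x = iter N (linsum Rm X) x.
  by elim: N => //= N ->; rewrite TE.
have qP := q_complete n.
have Tb : exists2 M, 0 <= M & forall x, q n (T x) <= M * q n x.
  have [M M0 h] := ell1_linsum X rmap_bounded; exists M => // x.
  by rewrite TE.
have Td x : exists2 c, 0 <= c & exists N0, forall N, (N0 <= N)%N ->
    q n (iter N T x) <= (2 ^+ N)^-1 * c.
  by have [c c0 [N0 h]] := dec x; exists c => //; exists N0 => N /h; rewrite iterE.
have [J [Jlim JK KJ]] := neumann_series qP Tb Td.
have Vtl : linear (fun u : 'cV[C]_(e * n) => J (tensop V 1%:M (untens u))).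
  by move=> a x y; rewrite untens_linear (tensop_linear _ (linear_fun V)) linearP.
have [WX WXE] := linear_pack Vtl.
pose Phi (x : tens (tens H d) n) := tensop VsU 1%:M (linsum bA X x).
have VsUl := VsU_linear.
have bAl : linear (linsum bA X) by apply: linsum_linear; exact: ampl_linear.
have Phil : linear Phi by move=> a x y; rewrite /Phi bAl (tensop_linear _ VsUl).
have [Ph PhE] := linear_pack Phil.
have Gl : linear (fun u => retens (Phi (WX u))).
  by move=> a x y; rewrite linearP Phil retens_linear.
have [Gm GmE] := linear_pack Gl.
pose GX : 'M[C]_(e * n) := \matrix_(i, j) Gm (delta_mx j 0) i 0.
have GXE u : GX *m u = retens (Phi (WX u)).
  rewrite -GmE; apply/colP => i; rewrite mxE.
  rewrite {2}[u]matrix_sum_delta linear_sum summxE; apply: eq_bigr => k _.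
  by rewrite big_ord1 linearZ !mxE mulrC.
have GXu u : untens (GX *m u) = Phi (WX u) by rewrite GXE retensK.
have WlimE u : cn_lim (q n) (fun N => \sum_(i < N) fps_part W X u i) (WX u).
  move=> eps eps0; rewrite WXE; have [N0 h] := Jlim (tensop V 1%:M (untens u)) eps eps0.
  exists N0 => N /h; under eq_bigr do rewrite iterE -(fps_part_iter _ _ _ WE).
  by [].
exists GX, WX, J; split; first last.
  split.
    move=> u k l; apply/cvgrPdist_lt => eps eps0.
    have [N0 h] := WlimE u eps eps0; exists N0 => // N /h; apply: le_lt_trans.
    rewrite distrC /series /= big_mkord.
    apply: le_trans (le_ell1 _ k (cn_ge0 p_complete)).
    apply: le_trans (le_ell1 (p := fun x : H => `|x|) _ l (fun _ => normr_ge0 _)).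
    by rewrite !ffunE !sum_ffunE.
  split; last by split=> [x|]; [rewrite -TE; exact: JK|split=> // x; rewrite -TE; exact: KJ].
  pose UA u := tensop U 1%:M (linsum bA X (WX u)).
  pose V1 u : tens (tens H d) n := tensop V 1%:M (untens u).
  have dP := dotK_predot d H; have dP2 := tensdot_predot n dP.
  have cP := @cdot_predot R e.
  have GV u v : cdot (GX *m u) v = tensdot dotK (UA u) (V1 v).
    rewrite -tensdot_untens GXu; apply: eq_bigr => k _; rewrite !tensop1.
    rewrite (predot_herm cP) -(adjcP (predot_linear dP) (predot_herm dP)).
    by rewrite -(predot_herm dP).
  have WV u : WX u + linsum bA X (WX u) = V1 u + UA u.
    have := KJ (V1 u); rewrite TE -WXE linsum_rmap opprB addrA => /eqP.
    by rewrite subr_eq => /eqP.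
  have VV u v : tensdot dotK (V1 u) (V1 v) = cdot u v.
    rewrite -tensdot_untens; apply: eq_bigr => k _; rewrite !tensop1.
    by case: UV => _ iso _; rewrite iso.
  have UU u v : tensdot dotK (UA u) (UA v) =
      tensdot dotK (linsum bA X (WX u)) (linsum bA X (WX v)).
    by apply: eq_bigr => k _; rewrite !tensop1 (unitary_dot UV).
  move=> u; apply/colP => i; rewrite [RHS]mxE -[LHS]cdot_delta.
  move: (delta_mx i 0) => v.
  rewrite /pencil_op !(predotDl dP2) linsum_adj.
  have := congr2 (tensdot dotK (n := n)) (WV u) (WV v).
  rewrite !(predotDl dP2) !(predotDr dP2) VV UU -GV (predot_herm dP2 (V1 u)) -GV.
  rewrite -(predot_herm cdotP) => E.
  have -> : cdot ((1%:M + GX + GX^t* ) *m u) v = cdot u v + cdot (GX *m u) v + cdot u (GX *m v).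
    rewrite !mulmxDl mul1mx !(predotDl cdotP).
    by rewrite [cdot (GX^t* *m u) v]cdot_adj trmxCK.
  have cancel_last (a b c f x y z : C) : a + b + (c + f) = x + y + (z + f) -> x + z + y = a + c + b.
    by rewrite !addrA => /addIr E'; rewrite addrAC -E' addrAC.
  exact: cancel_last E.
apply: mx_cvg => i j; rewrite -(@cvg_shiftS _ (fun k => series (mxfps_part Gc X) k i j)).
have bAb : exists2 M, 0 <= M & forall k y, p (bA k y) <= M * p y.
  exists (\sum_k entry_sum (A k)) => [|k y]; first by apply: sumr_ge0 => k _; exact: entry_sum_ge0.
  by apply: le_trans (ell1_ampl k y) _; rewrite ler_wpM2r ?entry_sum_le_all ?(cn_ge0 p_complete).
have [M M0 MP] := ell1_linsum X bAb.
have Phib x k : `|retens (Phi x) k 0| <= M * q n x.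
  rewrite mxE tensop1; apply: le_trans (VsU_entry _ _) _; apply: le_trans (MP x).
  exact: le_ell1 (cn_ge0 p_complete).
have M1 : 0 < M + 1 by rewrite ltr_wpDl.
apply/cvgrPdist_lt => eps eps0.
have [N0 h] := WlimE (delta_mx j 0) _ (divr_gt0 eps0 M1).
exists N0 => // N /h hN /=.
have entryE (B : 'M[C]_(e * n)) : B i j = (B *m (delta_mx j 0 : 'cV[C]_(e * n))) i 0 by rewrite -colE mxE.
have [rt rtE] := linear_pack (@retens_linear R e n).
have sE : series (mxfps_part Gc X) N.+1 *m delta_mx j 0 =
    retens (Phi (\sum_(k < N) fps_part W X (delta_mx j 0) k)).
  rewrite /series /= big_mkord big_ord_recl.
  have -> : mxfps_part Gc X 0%N = 0.
    rewrite /mxfps_part big1 // => a _; rewrite (tuple0 a) /= Gc0.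
    by apply/matrixP => k l; rewrite !mxE mul0r.
  rewrite add0r mulmx_suml -PhE linear_sum -rtE linear_sum; apply: eq_bigr => k _.
  by rewrite rtE PhE /Phi -mxfps_partS // untensK.
rewrite !entryE sE GXE distrC.
have PhiB x y : retens (Phi x) i 0 - retens (Phi y) i 0 = retens (Phi (x - y)) i 0.
  by rewrite -!PhE linearB -!rtE linearB !mxE.
rewrite PhiB; apply: le_lt_trans (Phib _ _) _.
move: hN; rewrite ltr_pdivlMr // mulrC; apply: le_lt_trans.
by rewrite ler_wpM2r ?lerDl // (cn_ge0 qP).
Qed.

End Convergence.

(** * The realization theorem *)

Lemma transfer_function_realization (R : realType) (g d e : nat) (A : 'I_g -> 'M[Cplx R]_d)
    (Gc : word g -> 'M[Cplx R]_e) (H : hilbertType R) (U : {linear tens H d -> tens H d})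
    (V : {linear 'cV[Cplx R]_e -> tens H d}) (W : word g -> {linear 'cV[Cplx R]_e -> tens H d})
    (VsU : tens H d -> 'cV[Cplx R]_e) a v :
  Gc [::] = 0 -> VsU 0 = 0 ->
  (forall j a v, Gc (j :: a) *m v = VsU (ampl A j (opword (rmap A U) a (V v)))) ->
  (forall a v, W a v = opword (rmap A U) a (V v)) ->
  Gc a *m v = fps_mul (fps_const VsU) (fps_mul (fps_lin (ampl (H := H) A)) W) a v.
Proof.
move=> Gc0 VsU0 GcE WE.
rewrite {1}/fps_mul big_ord_recl [X in _ + X]big1 ?addr0 /= => [|i _]; last first.
  by case: a i => [[]|j a i].
rewrite take0 drop0 /= /fps_mul; case: a => [|j a].
  by rewrite big_ord_recl big_ord0 /fps_lin /= addr0 Gc0 mul0mx VsU0.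
rewrite big_ord_recl big_ord_recl big1 ?addr0 => [|i _].
  by rewrite /fps_lin /= take0 drop0 add0r GcE WE.
by rewrite /fps_lin /=; case: a i => [[]|k a i].
Qed.

Theorem theorem1p9 (R : realType) (g d e r s : nat)
    (A : 'I_g -> 'M[Cplx R]_d) (Q : ncpoly R g r s) (G : graded_fun R g e)
    (d_gt0 : (0 < d)%N) (e_gt0 : (0 < e)%N)
    (bounded_DA : free_bounded (spectrahedron A))
    (DA_sub_GQ : forall n (X : 'I_g -> 'M[Cplx R]_n),
       spectrahedron A X -> pseudoconvex Q X)
    (free_G : free_function (pseudoconvex Q) G)
    (analytic_G : free_analytic (pseudoconvex Q) G)
    (G0 : forall n, G n (fun=> 0) = 0)
    (psd_G : forall n (X : 'I_g -> 'M[Cplx R]_n),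
       spectrahedron A X -> psd (1%:M + G n X + (G n X)^t* )) :
  exists2 Gc : word g -> 'M[Cplx R]_e, power_series_near0 G Gc &
  exists (H : hilbertType R)
         (W : word g -> {linear 'cV[Cplx R]_e -> tens H d})
         (U : {linear tens H d -> tens H d})
         (V : {linear 'cV[Cplx R]_e -> tens H d}),
  let dotK := tensdot (@hdot R H) (n := d) in
  let bA := ampl (H := H) A in
  let Rm := fun (j : 'I_g) (h : tens H d) => U (bA j h) - bA j h in
  let VsU := fun h : tens H d => adjc dotK V (U h) in
  unitary_op dotK U /\
  isometry_op (@cdot R e) dotK V /\
  formal_identity A Gc W /\
  (exists J : word g -> {linear tens H d -> tens H d},
     fps_inverse (fps_sub (fps_const id) (fps_lin Rm)) J /\
     forall a v, W a v = fps_mul J (fps_const V) a v) /\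
  (forall a v,
     Gc a *m v = fps_mul (fps_const VsU) (fps_mul (fps_lin bA) W) a v) /\
  (forall j a v,
     Gc (j :: a) *m v = VsU (bA j (opword Rm a (V v)))) /\
  (exists2 tau : R, 0 < tau &
     forall n (X : 'I_g -> 'M[Cplx R]_n), Delta tau X ->
     exists (GX : 'M[Cplx R]_(e * n))
            (WX : {linear 'cV[Cplx R]_(e * n) -> tens (tens H d) n})
            (JX : {linear tens (tens H d) n -> tens (tens H d) n}),
       series (mxfps_part Gc X) @ \oo --> GX /\
       fps_cvg W X WX /\
       (forall u : 'cV[Cplx R]_(e * n),
          (1%:M + GX + GX^t* ) *m u
          = adjc (tensdot dotK (n := n)) WX (pencil_op A X (WX u))) /\
       cancel (fun h => h - linsum Rm X h) JX /\
       cancel JX (fun h => h - linsum Rm X h) /\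
       (forall u, WX u = JX (tensop V 1%:M (untens u))) /\
       (forall u, untens (GX *m u) = tensop VsU 1%:M (linsum bA X (WX u)))).
Proof.
have free_A : free_function (spectrahedron A) G.
  by move=> n m X Y T /DA_sub_GQ DX /DA_sub_GQ DY; exact: free_G.
have [rho rho0 ball_DA] := spectrahedron_ball A.
exists (coef G rho); first exact: power_series_coef rho0 ball_DA free_A G0 psd_G.
have Gc0 := coef_nil rho G0.
have [H [U [V UV]]] : exists H U V, @realizes R g d e A (coef G rho) H U V.
  apply: realization_exists => N.
  have [h [U [V [UU UU' VV UVE]]]] :=
    truncated_realization d_gt0 bounded_DA rho0 ball_DA free_A G0 psd_G N.
  by exists; exact: FiniteRealization UU UU' VV UVE.
have [J JE] := choice (fun a => linear_pack (opword_linear A U a)).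
have Wl a : linear (fun v : 'cV[Cplx R]_e => J a (V v)) by move=> c x y; rewrite !linearP.
have [F FJ] := choice (fun a => linear_pack (Wl a)).
pose W : word g -> {linear 'cV[Cplx R]_e -> tens H d} := F.
have WE (a : word g) (v : 'cV[Cplx R]_e) : W a v = opword (rmap A U) a (V v).
  by rewrite -JE -FJ.
have [unitary_U isometry_V GcE] := UV.
exists H, W, U, V; split=> //; split=> //.
split; first exact: (formal_identity_realization UV (W := W) WE).
split.
  exists J; split; first exact: fps_inverse_realization JE.
  move=> a v; rewrite /fps_mul big_ord_recr /= take_size drop_size /= big1 ?add0r //= => i _.
  rewrite /fps_const; case: (drop i a) (size_drop i a) => [|k b _].
    by move/esym/eqP; rewrite subn_eq0 leqNgt ltn_ord.
  by rewrite linear0.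
split; last by split; [exact: GcE|exact: (realization_converges Gc0 UV (W := W) WE)].
move=> a v; apply: transfer_function_realization => //.
apply/colP => i; rewrite !mxE linear0; exact: predot0l (dotK_predot d H) _.
Qed.
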